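(* Let $\Omega\subset\mathbb{R}^N$ be an open and bounded Lipschitz set and $s\in(0,1)$. Then $$\frac{1}{h_s(\Omega)}=\min\big\{\|\varphi\|_{L^\infty(\mathbb{R}^N\times\mathbb{R}^N)}\, :\, \varphi\in L^\infty(\mathbb{R}^N\times\mathbb{R}^N),\ R^*_{s,1}(\varphi)=1 \mbox{ in }\Omega\big\}.$$
   Context: The $s$-perimeter of a Borel set $E$ is $P_s(E)=\int_{\mathbb{R}^N}\int_{\mathbb{R}^N}\frac{|1_E (x)-1_E (y)|}{|x-y|^{N+s}}\, dx\, dy$ and the $s$-Cheeger constant of $\Omega$ is $h_s(\Omega)=\inf_{E\subset\Omega}\frac{P_s(E)}{|E|}$ (infimum over subsets of positive Lebesgue measure). $\widetilde W^{s,1}_0(\Omega)$ is the closure of $C^\infty_0(\Omega)$ with respect to the norm $u\mapsto \int_{\mathbb{R}^N}\int_{\mathbb{R}^N}\frac{|u(x)-u(y)|}{|x-y|^{N+s}}dx\,dy+\|u\|_{L^1(\Omega)}$ (functions extended by $0$), and $\widetilde W^{-s,\infty}(\Omega)$ is its topological dual. The operator $R^*_{s,1}:L^\infty(\mathbb{R}^N\times\mathbb{R}^N)\to \widetilde W^{-s,\infty}(\Omega)$, adjoint of $R_{s,1}(u)(x,y)=\frac{u(x)-u(y)}{|x-y|^{N+s}}$, is defined by $$\langle R^*_{s,1}(\varphi),u\rangle=\int_{\mathbb{R}^N}\int_{\mathbb{R}^N} \varphi(x,y)\,\frac{u(x)-u(y)}{|x-y|^{N+s}}\, dx\,dy,\qquad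 u \in \widetilde W^{s,1}_0(\Omega).$$ The constraint $R^*_{s,1}(\varphi)=1$ in $\Omega$ means $\langle R^*_{s,1}(\varphi),u\rangle=\int_\Omega u\,dx$ for every $u\in C^\infty_0(\Omega)$. *)

(* Defs.v *)
From HB Require Import structures.
From mathcomp Require Import all_boot all_order all_algebra.
From mathcomp Require Import all_classical all_reals all_analysis.
From mathcomp Require Import measurable_realfun.

Set Implicit Arguments.
Unset Strict Implicit.
Unset Printing Implicit Defensive.

Import Order.TTheory GRing.Theory Num.Theory.
Import numFieldNormedType.Exports.

Local Open Scope classical_set_scope.
Local Open Scope ring_scope.

(* Borel sigma-algebra; the topology of 'M[R]_(m, n) is the usual one. *)
HB.instance Definition _ (R : realType) (m n : nat) :=
  Measurable.copy 'M[R]_(m, n) (g_sigma_algebraType (@open 'M[R]_(m, n))).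

Section lebesgue_rV.
Context {R : realType}.

Definition rV_cons n (p : measurableTypeR R * 'rV[R]_n) : 'rV[R]_n.+1 :=
  \row_i oapp (p.2 ord0) p.1 (unlift ord0 i).

Lemma rV_cons0 n p : @rV_cons n p ord0 ord0 = p.1.
Proof. by rewrite mxE unlift_none. Qed.

Lemma rV_consS n p i : @rV_cons n p ord0 (lift ord0 i) = p.2 ord0 i.
Proof. by rewrite mxE liftK. Qed.

Lemma open_rV_measurable n (A : set 'rV[R]_n) : open A -> measurable A.
Proof. exact: sub_sigma_algebra. Qed.

Let qball n (q : 'rV[rat]_n * nat) : set 'rV[R]_n :=
  ball (map_mx ratr q.1 : 'rV[R]_n) (q.2.+1%:R^-1).

Lemma open_rV_bigcup n (U : set 'rV[R]_n) : open U ->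
  U = \bigcup_(q in [set q | qball q `<=` U]) qball q.
Proof.
move=> oU; apply/seteqP; split => [x Ux|x [q qU]]; last exact: qU.
have : nbhs x U by rewrite nbhsE; exists U.
rewrite -nbhs_ballE => -[e /= e0 xeU].
have [k ke] : exists k : nat, (k.+1%:R : R)^-1 < e / 2.
  have [k] := @ltr_add_invr R 0 (e / 2) ltac:(by rewrite divr_gt0).
  by rewrite add0r; exists k.
have k0 : 0 < (k.+1%:R : R)^-1 by rewrite invr_gt0.
have /choice[a xa] : forall i, exists a : rat,
    ball (x ord0 i) k.+1%:R^-1 (ratr a : R).
  move=> i; have [a] := @rat_in_itvoo R (x ord0 i - k.+1%:R^-1)
     (x ord0 i + k.+1%:R^-1) ltac:(by rewrite ltrD2l gtrN).
  rewrite in_itv/= => ?; exists a.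
  by rewrite /ball/= distrC ltr_distl.
have xq : ball x k.+1%:R^-1 (map_mx ratr (\row_i a i) : 'rV[R]_n).
  split=> // i j; rewrite !mxE ord1; exact: xa.
exists (\row_i a i, k) => /=; last exact: ball_sym.
rewrite /qball => y /= ay; apply: xeU.
apply: le_ball (ball_triangle xq ay).
by rewrite [leRHS]splitr lerD// ltW.
Qed.

Lemma measurable_rV_cons n : measurable_fun setT (@rV_cons n).
Proof.
apply: (measurability (@open 'rV[R]_n.+1)) => // _ [U oU <-].
rewrite setTI [in X in measurable X](open_rV_bigcup oU) preimage_bigcup.
rewrite bigcup_mkcond; apply: countable_bigcupT_measurable => // -[a k].
case: ifPn => // _.
have -> : @rV_cons n @^-1` qball (a, k) =
    ball (ratr (a ord0 ord0) : R) k.+1%:R^-1 `*`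
    qball (\row_i a ord0 (lift ord0 i), k).
  apply/seteqP; split => [p [k0 ap]|p [ap1 [k0 ap2]]] /=.
    split; first by move: (ap ord0 ord0); rewrite rV_cons0 mxE => H; exact: H.
    by split=> // i j; move: (ap ord0 (lift ord0 j)); rewrite rV_consS (ord1 i) !mxE => H; exact: H.
  split=> // i j; rewrite ord1; case: (unliftP ord0 j) => [l|] ->.
    by rewrite rV_consS; move: (ap2 ord0 l); rewrite !mxE => H; exact: H.
  by rewrite rV_cons0 mxE; exact: ap1.
apply: measurableX; first by apply: open_measurable; exact: ball_open.
apply: open_rV_measurable; exact: (@ball_open R 'rV[R]_n).
Qed.

Definition rV_uncons n (x : 'rV[R]_n.+1) : measurableTypeR R * 'rV[R]_n :=
  (x ord0 ord0, \row_i x ord0 (lift ord0 i)).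

Lemma rV_consK n : cancel (@rV_cons n) (@rV_uncons n).
Proof.
move=> [t v]; congr pair; first exact: rV_cons0.
by apply/rowP => i; rewrite mxE rV_consS.
Qed.

Lemma measurable_rV_uncons n : measurable_fun setT (@rV_uncons n).
Proof.
apply/measurable_fun_pairP; split.
  apply: (measurability _ (RGenOpens.measurableE R)) => _ [_ [a [b ->]] <-].
  rewrite setTI; apply: open_rV_measurable.
  by move/continuousP: (@coord_continuous R 1 n.+1 ord0 ord0); exact.
apply: (measurability (@open 'rV[R]_n)) => // _ [U oU <-].
rewrite setTI; apply: open_rV_measurable.
move: U oU; apply/continuousP => x A [P Px PA].
exists (fun i j => if unlift ord0 j is Some l then P i l else setT) => [i j|y yP].
  case: unliftP => [l ->|_]; last exact: filterT.
  by rewrite (ord1 i); have := Px ord0 l; rewrite mxE.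
apply: PA => i l; rewrite mxE.
by rewrite (ord1 i); have := yP ord0 (lift ord0 l); rewrite liftK.
Qed.

Section step.
Context n (m : {sigma_finite_measure set 'rV[R]_n -> \bar R}).

Definition lebesgue_rV_step : set 'rV[R]_n.+1 -> \bar R :=
  pushforward (lebesgue_measure \x m)%E (@rV_cons n).

Let stepM : {measure set 'rV[R]_n.+1 -> \bar R} :=
  measure_function_pushforward__canonical__measure_function_Measure
    (lebesgue_measure \x m)%E (@measurable_rV_cons n).

HB.instance Definition _ := isMeasure.Build _ _ _ lebesgue_rV_step
  (measure0 stepM) (measure_ge0 stepM) (@measure_semi_sigma_additive _ _ _ stepM).

Let step_sigma_finite : sigma_finite setT lebesgue_rV_step.
Proof.
have /sigma_finiteP[F [FT ndF Ffin]] := sigma_finiteT (@lebesgue_measure R).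
have /sigma_finiteP[G [GT ndG Gfin]] := sigma_finiteT m.
exists (fun k => @rV_uncons n @^-1` (F k `*` G k)).
  rewrite -preimage_bigcup (_ : \bigcup_k _ = setT) ?preimage_setT//.
  apply/seteqP; split=> // -[t v] _.
  have [i _ Fit] : (\bigcup_i F i) t by rewrite -FT.
  have [j _ Gjv] : (\bigcup_j G j) v by rewrite -GT.
  exists (maxn i j) => //; split.
    by move/subsetPset: (ndF _ _ (leq_maxl i j)); exact.
  by move/subsetPset: (ndG _ _ (leq_maxr i j)); exact.
move=> k; have [mF Foo] := Ffin k; have [mG Goo] := Gfin k; split.
  rewrite -[X in measurable X]setTI.
  by apply: measurable_rV_uncons => //; exact: measurableX.
rewrite /lebesgue_rV_step /pushforward -comp_preimage.
rewrite (_ : _ \o _ = id); last by apply/funext => p; exact: rV_consK.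
by rewrite preimage_id product_measure1E// lte_mul_pinfty// ge0_fin_numE.
Qed.

HB.instance Definition _ :=
  Measure_isSigmaFinite.Build _ _ _ lebesgue_rV_step step_sigma_finite.

End step.

(* Lebesgue measure on R^n, on the Borel sets: the image of
   lebesgue_measure \x lebesgue_rV n' under (t, v) |-> (t, v_0, v_1, ...). *)
Fixpoint lebesgue_rV n : {sigma_finite_measure set 'rV[R]_n -> \bar R} :=
  if n is n'.+1 then lebesgue_rV_step (lebesgue_rV n')
  else \d_(0 : 'rV[R]_0).

Definition box n (a b : 'rV[R]_n) : set 'rV[R]_n :=
  [set x | forall i, a ord0 i <= x ord0 i <= b ord0 i].

Let boxS n (a b : 'rV[R]_n.+1) (p : measurableTypeR R * 'rV[R]_n) :
  box a b (rV_cons p) <->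
  (`[a ord0 ord0, b ord0 ord0]%classic `*`
     box (rV_uncons a).2 (rV_uncons b).2) p.
Proof.
split=> [abp|[/= p1 p2] i].
  split=> [|i] /=; first by rewrite in_itv/=; have := abp ord0; rewrite rV_cons0.
  by have := abp (lift ord0 i); rewrite rV_consS !mxE.
case: (unliftP ord0 i) => [j|] ->.
  by rewrite rV_consS; have := p2 j; rewrite !mxE.
by rewrite rV_cons0; move: p1; rewrite in_itv.
Qed.

Lemma measurable_box n (a b : 'rV[R]_n) : measurable (box a b).
Proof.
elim: n a b => [|n IH] a b.
  by rewrite (_ : box a b = setT)//; apply/seteqP; split=> // x _ [].
rewrite (_ : box a b = @rV_uncons n @^-1` (`[a ord0 ord0, b ord0 ord0]%classic
     `*` box (rV_uncons a).2 (rV_uncons b).2)).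
  rewrite -[X in measurable X]setTI; apply: measurable_rV_uncons => //.
  exact: measurableX.
have unconsK (x : 'rV[R]_n.+1) : rV_cons (rV_uncons x) = x.
  apply/rowP => i; rewrite -[0]/ord0; case: (unliftP ord0 i) => [j|] ->.
    by rewrite rV_consS mxE.
  by rewrite rV_cons0.
apply/seteqP; split=> x abx; first by apply/boxS; rewrite unconsK.
by rewrite -(unconsK x); apply/boxS.
Qed.

(* The measure built by the recursion above is the usual volume. *)
Lemma lebesgue_rV_box n (a b : 'rV[R]_n) :
  (forall i, a ord0 i <= b ord0 i) ->
  lebesgue_rV n (box a b) = (\prod_i (b ord0 i - a ord0 i))%:E.
Proof.
elim: n a b => [|n IH] a b ab.
  rewrite big_ord0 /= diracE (_ : _ \in _) // inE => -[] //.
rewrite /= /lebesgue_rV_step /pushforward.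
rewrite (_ : _ @^-1` _ = `[a ord0 ord0, b ord0 ord0]%classic
     `*` box (rV_uncons a).2 (rV_uncons b).2); last first.
  by apply/seteqP; split=> p /boxS.
rewrite product_measure1E//; last exact: measurable_box.
rewrite IH => [|i]; last by rewrite !mxE.
rewrite big_ord_recl EFinM.
congr (_ * (_)%:E)%E; last by apply: eq_bigr => i _; rewrite !mxE.
transitivity (lebesgue_measure (`[a ord0 ord0, b ord0 ord0]%classic : set R)).
  by [].
rewrite lebesgue_measure_itv/= lte_fin.
by case: ltgtP (ab ord0) => // -> _; rewrite subrr.
Qed.

End lebesgue_rV.
Arguments lebesgue_rV {R} n.

Section fractional.
Context {R : realType} {N : nat}.
Local Notation RN := 'rV[R]_N.
Local Notation mu := (@lebesgue_rV R N).

(* The library norm `|x| on row vectors is the sup norm. *)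
Definition enorm (x : RN) : R := Num.sqrt (\sum_i x ord0 i ^+ 2).

(* On the null set x = y, where the quotient is meaningless, it is 0 by the
   convention r / 0 = 0. *)
Definition Rs (s : R) (u : RN -> R) (x y : RN) : R :=
  (u x - u y) / enorm (x - y) `^ (N%:R + s).

Definition perimeter (s : R) (E : set RN) : \bar R :=
  (\int[mu]_y \int[mu]_x
    (`|\1_E x - \1_E y| / enorm (x - y) `^ (N%:R + s))%:E)%E.

(* +oo when Omega is empty. *)
Definition cheeger (s : R) (Omega : set RN) : \bar R :=
  ereal_inf [set (perimeter s E / mu E)%E | E in
    [set E : set RN | [/\ measurable E, E `<=` Omega & (0 < mu E)%E]]].

Definition partial (i : 'I_N) (u : RN -> R) : RN -> R :=
  fun x => 'D_(delta_mx ord0 i) u x.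

Definition iter_partial (l : seq 'I_N) (u : RN -> R) : RN -> R :=
  foldr partial u l.

Definition smooth (u : RN -> R) : Prop :=
  forall l : seq 'I_N, continuous (iter_partial l u) /\
    forall i x, derivable (iter_partial l u) x (delta_mx ord0 i).

Definition Ccinfty (Omega : set RN) : set (RN -> R) :=
  [set u | [/\ smooth u, compact (closure [set x | u x != 0]) &
               closure [set x | u x != 0] `<=` Omega]].

(* Near each boundary point, and after an orthogonal change of coordinates
   y = x *m Q, Omega is the strict epigraph, in the direction of the i-th
   coordinate, of a Lipschitz function of the N - 1 other coordinates. *)
Definition lipschitz_set (Omega : set RN) : Prop :=
  forall p, (closure Omega `\` interior Omega) p ->
  exists (i : 'I_N) (Q : 'M[R]_N) (g : 'rV[R]_N.-1 -> R),
    [/\ Q *m Q^T = 1%:M, [lipschitz g y | y in setT] &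
        \forall x \near p,
          Omega x <-> g (col' i (x *m Q)) < (x *m Q) ord0 i].

(* The pairing < R_{s,1}^* phi, u >. *)
Definition Rs_adj (s : R) (phi : RN * RN -> R) (u : RN -> R) : \bar R :=
  (\int[mu]_y \int[mu]_x (phi (x, y) * Rs s u x y)%:E)%E.

Definition Rs_adj_eq1 (s : R) (Omega : set RN) (phi : RN * RN -> R) : Prop :=
  forall u, Ccinfty Omega u ->
    Rs_adj s phi u = (\int[mu]_(x in Omega) (u x)%:E)%E.

Definition Linfty : set (RN * RN -> R) :=
  [set phi | phi \in Lfun (mu \x mu)%E +oo%E].

Definition Linfty_norm (phi : RN * RN -> R) : \bar R :=
  'N[(mu \x mu)%E]_(+oo) [EFin \o phi]%E.

End fractional.

Definition is_min {R : realType} (A : set (\bar R)) (m : \bar R) : Prop :=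
  A m /\ lbound A m.

(* Main.v *)
Require Import Defs.
From HB Require Import structures.
From mathcomp Require Import all_boot all_order all_algebra finmap.
From mathcomp Require Import all_classical all_reals all_analysis.
From mathcomp Require Import measurable_realfun ess_sup_inf ring lra.

(** The identity is a duality between two convex problems: the minimum on the
    right is the dual formulation of the Cheeger problem relaxed from sets to
    functions. Write [u] for the Gagliardo seminorm, the L1 norm on the product
    space of R_{s,1} u (x, y) = (u x - u y) |x - y|^(-N-s), so that P_s(E) is the
    seminorm of the indicator of E.

    Existence of an admissible phi with norm at most 1 / h_s. By the coarea and
    layer-cake formulas, the inequality h_s |E| <= P_s(E) for sets implies the
    Poincare inequality h_s int |u| <= [u] for test functions
    (cheeger_mul_integral_le), and h_s > 0 since Omega is bounded (cheeger_pos).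
    Hence R_{s,1} u |-> int u is a well defined linear functional on the image of
    the test functions, a subspace of L1 of the product, with norm at most 1 / h_s.
    The Hahn-Banach theorem (hahn_banach) extends it to all of L1, and the duality
    of L1 and L^oo (L1_dual_representation, from the Radon-Nikodym theorem)
    represents the extension by a bounded phi, for which R*_{s,1} phi = 1
    (exists_minimizer).

    Lower bound for every admissible phi. The constraint gives
    int w <= |phi|_oo [w] for every test function w, and the claim follows once the
    same inequality |E| <= |phi|_oo P_s(E) is known for measurable subsets E of Omega
    of finite perimeter (measure_le_perimeter). This is an approximation of the
    indicator of E by test functions, in energy, and it is where the Lipschitz
    boundary enters. Near the boundary there is a direction pointing inwards
    (inward_direction); a partition of unity subordinate to finitely many
    neighbourhoods (inward_partition) is used to patch translates of the indicator,
    each moved by a distance t in its own inward direction. The result is supported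
    at a positive distance from the complement of Omega and so can be mollified into
    a test function with the same integral and no larger seminorm
    (exists_Ccinfty_approx). Patching multiplies the seminorm by 1 + O(t), up to the
    L1 distance between the indicator and its translates (gagliardo_patched), and
    this distance is O(t^s) for sets of finite fractional perimeter
    (translation_le_gagliardo). Letting t tend to 0 concludes.

    Smoothness of mollifiers rests on the functions P(1/x) exp(-1/x), a class that
    is stable under derivation. *)

Set Implicit Arguments.
Unset Strict Implicit.
Unset Printing Implicit Defensive.

Import Order.TTheory GRing.Theory Num.Theory.
Import numFieldNormedType.Exports.

Local Open Scope classical_set_scope.
Local Open Scope ring_scope.

(** * Lebesgue measure, norms and cubes in R^n *)

Section rV_measurability.
Context {R : realType}.

Lemma continuous_rV_measurable n (f : 'rV[R]_n -> R) :
  continuous f -> measurable_fun setT f.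
Proof.
move=> cf; apply: (measurability _ (RGenOpens.measurableE R)) => _ [_ [a [b ->]] <-].
rewrite setTI; apply: open_rV_measurable.
exact: (proj1 (continuousP _) cf).
Qed.

Lemma measurable_coord n (i : 'I_n) :
  measurable_fun setT (fun x : 'rV[R]_n => x ord0 i).
Proof. by apply: continuous_rV_measurable; exact: coord_continuous. Qed.

Lemma measurable_fun_rV d (T : measurableType d) n (f : T -> 'rV[R]_n) :
  (forall i, measurable_fun setT (fun t => f t ord0 i)) -> measurable_fun setT f.
Proof.
move=> mf; apply: (measurability (@open 'rV[R]_n)) => // _ [U oU <-].
rewrite setTI [in X in measurable X](open_rV_bigcup oU) preimage_bigcup.
rewrite bigcup_mkcond; apply: countable_bigcupT_measurable => // -[a k].
case: ifPn => // _.
rewrite (_ : _ @^-1` _ = \bigcap_(i in [set: 'I_n])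
   ((fun t => f t ord0 i) @^-1` ball (ratr (a ord0 i) : R) k.+1%:R^-1)); last first.
  apply/seteqP; split => [t [k0 at_] i _|t at_] /=.
    by have := at_ ord0 i; rewrite mxE; exact.
  split => [|i j]; first by rewrite invr_gt0.
  by rewrite ord1 mxE; exact: (at_ j I).
apply: fin_bigcap_measurable => // i _.
rewrite -[X in measurable X]setTI; apply: mf => //.
by apply: open_measurable; exact: ball_open.
Qed.

Lemma measurable_addr_rV n (a : 'rV[R]_n) : measurable_fun setT (fun x : 'rV[R]_n => x + a).
Proof.
apply: measurable_fun_rV => i.
rewrite (_ : (fun _ => _) = (fun t : 'rV[R]_n => t ord0 i + a ord0 i)); last first.
  by apply/funext => t; rewrite mxE.
by apply: measurable_funD => //; exact: measurable_coord.
Qed.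

Lemma measurable_add_rV n :
  measurable_fun setT (fun p : 'rV[R]_n * 'rV[R]_n => p.1 + p.2).
Proof.
apply: measurable_fun_rV => i.
rewrite (_ : (fun _ => _) = (fun p : 'rV[R]_n * 'rV[R]_n => p.1 ord0 i + p.2 ord0 i)).
  apply: measurable_funD.
    exact: (measurableT_comp (measurable_coord i) measurable_fst).
  exact: (measurableT_comp (measurable_coord i) measurable_snd).
by apply/funext => t; rewrite mxE.
Qed.

Lemma measurable_opp_rV n : measurable_fun setT (fun x : 'rV[R]_n => - x).
Proof.
apply: measurable_fun_rV => i.
rewrite (_ : (fun _ => _) = (fun t : 'rV[R]_n => - t ord0 i)).
  apply: (@measurable_funN _ _ R setT _); exact: measurable_coord.
by apply/funext => t; rewrite mxE.
Qed.

End rV_measurability.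

Section translation_invariance.
Context {R : realType}.
Local Open Scope ereal_scope.

(** Both sides are measures agreeing on half-open intervals. *)
Lemma lebesgue_measure_shift (a : R) (A : set R) : measurable A ->
  lebesgue_measure A = lebesgue_measure ((fun x => (x + a)%R) @^-1` A).
Proof.
have ma : measurable_fun setT (fun x : measurableTypeR R => (x + a)%R : measurableTypeR R).
  by apply: measurable_funD.
move=> mA.
apply: (@lebesgue_measure_unique R
  (measure_function_pushforward__canonical__measure_function_Measure
     (@lebesgue_measure R) ma)) => // X [[c d] cd <-].
rewrite /= /pushforward.
rewrite (_ : _ @^-1` _ = `](c - a)%R, (d - a)%R]%classic); last first.
  by apply/seteqP; split=> x /=; rewrite !in_itv/= ltrBlDr lerBrDr.
rewrite !lebesgue_measure_itv/= !lte_fin ltrD2r.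
by rewrite -!EFinB opprB addrA subrK.
Qed.

Lemma ge0_integral_shiftR (a : R) (f : R -> \bar R) :
  measurable_fun setT f -> (forall x, 0 <= f x) ->
  \int[lebesgue_measure]_x f (x + a)%R = \int[lebesgue_measure]_x f x.
Proof.
move=> mf f0.
have ma : measurable_fun setT (fun x : measurableTypeR R => (x + a)%R : measurableTypeR R).
  by apply: measurable_funD.
rewrite [RHS](eq_measure_integral
  (measure_function_pushforward__canonical__measure_function_Measure
     (@lebesgue_measure R) ma)); last first.
  by move=> A mA _; exact: lebesgue_measure_shift.
by rewrite ge0_integral_pushforward//= preimage_setT.
Qed.

Lemma rV_cons_add n (p : measurableTypeR R * 'rV[R]_n) (a : 'rV[R]_n.+1) :
  (rV_cons p + a = rV_cons ((p.1 + a ord0 ord0)%R, p.2 + (rV_uncons a).2))%R.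
Proof.
apply/rowP => i; rewrite -[0%R]/ord0; case: (unliftP ord0 i) => [j|] ->.
  by rewrite mxE !rV_consS !mxE.
by rewrite mxE !rV_cons0.
Qed.

Lemma integral_lebesgue_rVS n (f : 'rV[R]_n.+1 -> \bar R) :
  measurable_fun setT f -> (forall x, 0 <= f x) ->
  \int[lebesgue_rV n.+1]_x f x =
  \int[lebesgue_measure]_t \int[lebesgue_rV n]_v f (rV_cons (t, v)).
Proof.
move=> mf f0.
rewrite [LHS](eq_measure_integral
  (measure_function_pushforward__canonical__measure_function_Measure
     (@lebesgue_measure R \x lebesgue_rV n) (@measurable_rV_cons R n)))//.
rewrite ge0_integral_pushforward ?preimage_setT//=.
rewrite fubini_tonelli1//.
  by apply: measurableT_comp => //; exact: measurable_rV_cons.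
exact: measurable_rV_cons.
Qed.

(** Induction on the dimension: integrate out the first coordinate, where the
    translation invariance is that of the line. *)
Lemma ge0_integral_shift n (a : 'rV[R]_n) (f : 'rV[R]_n -> \bar R) :
  measurable_fun setT f -> (forall x, 0 <= f x) ->
  \int[lebesgue_rV n]_x f (x + a)%R = \int[lebesgue_rV n]_x f x.
Proof.
elim: n a f => [|n IH] a f mf f0.
  by apply: eq_integral => x _; congr f; apply/rowP => -[].
have mfc : measurable_fun setT (fun p => f (@rV_cons R n p)).
  by apply: measurableT_comp => //; exact: measurable_rV_cons.
rewrite !integral_lebesgue_rVS//; last first.
  by apply: measurableT_comp => //; exact: measurable_addr_rV.
rewrite -(@ge0_integral_shiftR (a ord0 ord0)
  (fun t => \int[lebesgue_rV n]_v f (rV_cons (t, v)))); last 2 first.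
- exact: (@measurable_fun_fubini_tonelli_F _ _ _ _ _ (lebesgue_rV n) _ mfc).
- by move=> t; exact: integral_ge0.
apply: eq_integral => t _.
rewrite -[RHS](IH (rV_uncons a).2)//; last first.
  by apply: (measurableT_comp mfc); exact: measurable_pair1.
by apply: eq_integral => v _; rewrite rV_cons_add.
Qed.

Lemma integral_shift n (a : 'rV[R]_n) (f : 'rV[R]_n -> \bar R) :
  measurable_fun setT f ->
  \int[lebesgue_rV n]_x f (x + a)%R = \int[lebesgue_rV n]_x f x.
Proof.
move=> mf; rewrite integralE [RHS]integralE; congr (_ - _).
  rewrite -(ge0_integral_shift a (measurable_funepos mf) (funepos_ge0 f)).
  by apply: eq_integral => x _; rewrite !funeposE.
rewrite -(ge0_integral_shift a (measurable_funeneg mf) (funeneg_ge0 f)).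
by apply: eq_integral => x _; rewrite !funenegE.
Qed.

End translation_invariance.

Section norm_box.
Context {R : realType}.

Lemma rV_norm_leP n (x : 'rV[R]_n) (r : R) : 0 <= r ->
  `|x| <= r <-> forall i, `|x ord0 i| <= r.
Proof.
move=> r0; rewrite /Num.norm/= mx_normrE; split.
  by move=> /bigmax_leP[_ h] i; exact: (h (ord0, i)).
by move=> h; apply/bigmax_leP; split=> // -[i j] _; rewrite (ord1 i); exact: h.
Qed.

Lemma norm_coord n (x : 'rV[R]_n) i : `|x ord0 i| <= `|x|.
Proof. by move: i; apply/(rV_norm_leP x (normr_ge0 x)). Qed.

Lemma enorm_ge0 n (x : 'rV[R]_n) : 0 <= enorm x.
Proof. exact: sqrtr_ge0. Qed.

Lemma norm_le_enorm n (x : 'rV[R]_n) : `|x| <= enorm x.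
Proof.
apply/(rV_norm_leP _ (enorm_ge0 _)) => i; rewrite -sqrtr_sqr ler_sqrt ?sumr_ge0//.
by rewrite (bigD1 i)//= lerDl sumr_ge0// => j _; exact: sqr_ge0.
by move=> j _; exact: sqr_ge0.
Qed.

Lemma enorm_le_norm n (x : 'rV[R]_n) : enorm x <= Num.sqrt n%:R * `|x|.
Proof.
rewrite -[ `|x|](@ger0_norm)// -sqrtr_sqr -sqrtrM// ler_sqrt ?mulr_ge0 ?sqr_ge0//.
rewrite (_ : n%:R * _ = \sum_(i < n) `|x| ^+ 2); last by rewrite sumr_const card_ord mulr_natl.
apply: ler_sum => i _; rewrite -(@real_normK _ (x ord0 i)) ?num_real//.
by rewrite lerXn2r ?nnegrE// norm_coord.
Qed.

Lemma enormN n (x : 'rV[R]_n) : enorm (- x) = enorm x.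
Proof. by congr Num.sqrt; apply: eq_bigr => i _; rewrite mxE sqrrN. Qed.

(** A ball of the sup norm: its volume is explicit, and it is comparable to
    Euclidean balls by the two norm inequalities above. *)
Definition cube n (y : 'rV[R]_n) (r : R) : set 'rV[R]_n := [set x | `|x - y| <= r].

Lemma cubeE n (y : 'rV[R]_n) r : 0 <= r ->
  cube y r = box (y - const_mx r) (y + const_mx r).
Proof.
move=> r0; apply/seteqP; split => x /=.
  move=> /(rV_norm_leP _ r0) h i; have := h i; rewrite !mxE ler_norml.
  by move=> /andP[? ?]; apply/andP; split; lra.
move=> h; apply/(rV_norm_leP _ r0) => i; have := h i; rewrite !mxE ler_norml.
by move=> /andP[? ?]; apply/andP; split; lra.
Qed.

Lemma measurable_cube n (y : 'rV[R]_n) r : 0 <= r -> measurable (cube y r).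
Proof. by move=> r0; rewrite cubeE//; exact: measurable_box. Qed.

Lemma lebesgue_cube n (y : 'rV[R]_n) r : 0 <= r ->
  lebesgue_rV n (cube y r) = ((r *+ 2) ^+ n)%:E.
Proof.
move=> r0; rewrite cubeE// lebesgue_rV_box => [|i]; last first.
  by rewrite !mxE lerD2l; lra.
congr EFin; rewrite (eq_bigr (fun=> r *+ 2)) ?prodr_const ?card_ord//.
by move=> i _; rewrite !mxE; ring.
Qed.

Lemma bounded_rV_lty n (A : set 'rV[R]_n) : measurable A -> bounded_set A ->
  (lebesgue_rV n A < +oo)%E.
Proof.
move=> mA [M [_ bA]]; pose r := Num.max 0 (M + 1).
have r0 : 0 <= r by rewrite le_max lexx.
have h : A `<=` cube 0 r.
  move=> x Ax; rewrite /cube/= subr0 (le_trans (bA (M + 1) _ _ Ax)) ?le_max ?lexx ?orbT//.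
  by rewrite ltrDl.
apply: (@le_lt_trans _ _ (lebesgue_rV n (cube 0 r))).
  by apply: le_measure; rewrite ?inE//; exact: measurable_cube.
by rewrite lebesgue_cube// ltry.
Qed.

End norm_box.

(** * The fractional kernel *)

Section tonelli.
Context {R : realType}.
Local Open Scope ereal_scope.

Lemma tonelli2 d1 d2 (T1 : measurableType d1) (T2 : measurableType d2)
    (m1 : {sigma_finite_measure set T1 -> \bar R})
    (m2 : {sigma_finite_measure set T2 -> \bar R}) (F : T1 -> T2 -> \bar R) :
  measurable_fun setT (fun p : T1 * T2 => F p.1 p.2) ->
  (forall a b, 0 <= F a b) ->
  \int[m1]_a \int[m2]_b F a b = \int[m2]_b \int[m1]_a F a b.
Proof.
move=> mF F0.
by rewrite [LHS](@fubini_tonelli _ _ T1 T2 R m1 m2 (fun p => F p.1 p.2)).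
Qed.

(** Cyclic exchange of three integrals: pulls the outermost one inside. *)
Lemma tonelli3 d1 d2 d3 (T1 : measurableType d1) (T2 : measurableType d2)
    (T3 : measurableType d3) (m1 : {sigma_finite_measure set T1 -> \bar R})
    (m2 : {sigma_finite_measure set T2 -> \bar R})
    (m3 : {sigma_finite_measure set T3 -> \bar R}) (F : T1 -> T2 -> T3 -> \bar R) :
  measurable_fun setT (fun p : T1 * T2 * T3 => F p.1.1 p.1.2 p.2) ->
  (forall a b c, 0 <= F a b c) ->
  \int[m1]_a \int[m2]_b \int[m3]_c F a b c = \int[m2]_b \int[m3]_c \int[m1]_a F a b c.
Proof.
move=> mF F0.
have mG : measurable_fun setT (fun p : T1 * T2 => \int[m3]_c F p.1 p.2 c).
  have := @measurable_fun_fubini_tonelli_F _ _ (T1 * T2)%type T3 R m3 _ mF.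
  by apply => p; exact: F0.
rewrite [LHS](@fubini_tonelli _ _ T1 T2 R m1 m2 (fun p => \int[m3]_c F p.1 p.2 c))//=; last first.
  by move=> p; apply: integral_ge0 => c _; exact: F0.
apply: eq_integral => b _.
rewrite [LHS](@fubini_tonelli _ _ T1 T3 R m1 m3 (fun p => F p.1 b p.2))//=.
have h : measurable_fun setT (fun p : T1 * T3 => ((p.1, b), p.2)).
  apply/measurable_fun_pairP; split; last exact: measurable_snd.
  by apply/measurable_fun_pairP; split; [exact: measurable_fst|exact: measurable_cst].
exact: (measurableT_comp mF h).
Qed.

Lemma geometric_nneseries_le (C a : R) : (0 <= C)%R -> (0 <= a < 1)%R ->
  \sum_(0 <= k <oo) (C * a ^+ k)%:E <= (C / (1 - a))%:E.
Proof.
move=> C0 /andP[a0 a1]; apply: lime_le.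
  by apply: is_cvg_nneseries => k _ _; rewrite lee_fin mulr_ge0// exprn_ge0.
apply: nearW => n; rewrite sumEFin lee_fin.
have := @geometric_seriesE R C a; rewrite lt_eqF// => /(_ isT) => E.
have := congr1 (fun f => f n) E; rewrite /series/= => ->.
rewrite ler_pM// ?mulr_ge0 ?invr_ge0 ?subr_ge0 ?exprn_ile1 ?(ltW a1)//.
by rewrite ler_piMr// gerBl exprn_ge0.
Qed.

End tonelli.

Section kernel.
Context {R : realType} {N : nat} (s : R).
Local Notation RN := 'rV[R]_N.
Local Notation mu := (@lebesgue_rV R N).

Definition fractional_kernel (x y : RN) : R := enorm (x - y) `^ (- (N%:R + s)).
Local Notation kern := fractional_kernel.

Lemma RsE (u : RN -> R) x y : Rs s u x y = (u x - u y) * kern x y.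
Proof. by rewrite /Rs /fractional_kernel powRN. Qed.

Lemma kern_ge0 x y : 0 <= kern x y.
Proof. exact: powR_ge0. Qed.

Lemma kern_sym x y : kern x y = kern y x.
Proof. by rewrite /fractional_kernel -enormN opprB. Qed.

Lemma kern_shift a x y : kern (x + a) (y + a) = kern x y.
Proof. by rewrite /fractional_kernel opprD addrACA subrr addr0. Qed.

Lemma measurable_kern : measurable_fun setT (fun p : RN * RN => kern p.1 p.2).
Proof.
apply: (measurableT_comp (measurable_powR _)).
apply: (measurableT_comp (f := @Num.sqrt R)).
  exact: (continuous_measurable_fun (@sqrt_continuous R)).
apply: measurable_sum => i.
apply: measurable_funX.
rewrite (_ : (fun _ => _) = (fun p : RN * RN => p.1 ord0 i - p.2 ord0 i)); last first.
  by apply/funext => p; rewrite !mxE.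
apply: measurable_funB.
  exact: (measurableT_comp (measurable_coord i) measurable_fst).
exact: (measurableT_comp (measurable_coord i) measurable_snd).
Qed.

Lemma measurable_kernl y : measurable_fun setT (kern ^~ y).
Proof.
have m2 : measurable_fun setT (fun x : RN => (x, y)).
  by apply/measurable_fun_pairP; split; [exact: measurable_id|exact: measurable_cst].
exact: (measurableT_comp measurable_kern m2).
Qed.

Definition gagliardo (u : RN -> R) : \bar R :=
  (\int[mu]_y \int[mu]_x (`|u x - u y| * kern x y)%:E)%E.

Lemma perimeterE (E : set RN) : perimeter s E = gagliardo \1_E.
Proof.
by apply: eq_integral => y _; apply: eq_integral => x _; rewrite /fractional_kernel powRN.
Qed.

Lemma measurable_gagliardo_fun (u : RN -> R) : measurable_fun setT u ->
  measurable_fun setT (fun p : RN * RN => `|u p.1 - u p.2| * kern p.1 p.2).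
Proof.
move=> mu_; apply: measurable_funM; last exact: measurable_kern.
apply: (measurableT_comp (@normr_measurable R setT)); apply: measurable_funB.
  exact: (measurableT_comp mu_ measurable_fst).
exact: (measurableT_comp mu_ measurable_snd).
Qed.

Lemma gagliardo_fun_ge0 (u : RN -> R) x y : (0 <= (`|u x - u y| * kern x y)%:E)%E.
Proof. by rewrite lee_fin mulr_ge0// kern_ge0. Qed.

End kernel.

Section kappa.
Context {R : realType} {N : nat} (s : R).
Hypotheses (N_gt0 : (0 < N)%N) (s_gt0 : 0 < s) (s_lt1 : s < 1).
Local Notation RN := 'rV[R]_N.
Local Notation mu := (@lebesgue_rV R N).
Local Notation kern := (@fractional_kernel R N s).

Let p : R := N%:R + s.
Let pow2 (x : R) : R := 2 `^ x.
Let pow2D x y : pow2 (x + y) = pow2 x * pow2 y.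
Proof. by rewrite /pow2 powRD// pnatr_eq0 implybT. Qed.
Let pow2_gt0 x : 0 < pow2 x.
Proof. exact: powR_gt0. Qed.
Let pow2X x n : pow2 x ^+ n = pow2 (x * n%:R).
Proof. by rewrite /pow2 powRrM powR_mulrn// powR_ge0. Qed.
Let pow2M x y : pow2 x `^ y = pow2 (x * y).
Proof. by rewrite /pow2 powRrM. Qed.
Let pow2_1 : pow2 1 = 2.
Proof. by rewrite /pow2 powRr1. Qed.
Let pow2_lt1 x : x < 0 -> pow2 x < 1.
Proof.
move=> x0; rewrite /pow2 /powR pnatr_eq0/= -[ltRHS]expR0 ltr_expR nmulr_rlt0//.
by rewrite ln_gt0// ltr1n.
Qed.

(* The coefficients are upper bounds of min(1, |z|) |z|^(-p), p = N + s, on the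
   dyadic shells 2^(-k-1) < |z| <= 2^(-k) and 2^k <= |z| < 2^(k+1). *)
Let near_coef k : R := pow2 (- k%:R) * pow2 ((k%:R + 1) * p).
Let far_coef k : R := pow2 (- (k%:R * p)).

Let dyadic_small (r : R) : 0 < r -> r < 1 ->
  exists k : nat, pow2 (- (k%:R + 1)) < r <= pow2 (- k%:R).
Proof.
move=> r0 r1.
have ex : exists k : nat, pow2 (- (k%:R + 1)) < r.
  have [k kr] : exists k : nat, (k.+1%:R : R)^-1 < r.
    have [k] := @ltr_add_invr R 0 r r0.
    by rewrite add0r; exists k.
  exists k; apply: le_lt_trans kr; rewrite /pow2 powRN lef_pV2 ?posrE ?powR_gt0//.
  rewrite natr1 powR_mulrn// -natrX ler_nat ltnW//; exact: ltn_expl.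
exists (ex_minn ex); case: ex_minnP => k kr kmin; rewrite kr/=.
case: k kr kmin => [|k] kr kmin; first by rewrite oppr0 /pow2 powRr0 ltW.
rewrite leNgt; apply/negP => h; have := kmin k.
by rewrite natr1 h ltnn => /(_ isT).
Qed.

Let dyadic_large (r : R) : 1 <= r ->
  exists k : nat, pow2 k%:R <= r < pow2 (k%:R + 1).
Proof.
move=> r1.
have ex : exists k : nat, r < pow2 (k%:R + 1).
  have [k kr] : exists k : nat, r < k%:R.
    by exists (Num.Def.archi_bound r); rewrite archi_boundP// (le_trans _ r1).
  exists k; apply: (lt_trans kr); rewrite /pow2 natr1 powR_mulrn// -natrX ltr_nat.
  by rewrite (ltn_trans (ltnSn _))// ltn_expl.
exists (ex_minn ex); case: ex_minnP => k kr kmin; rewrite kr andbT.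
case: k kr kmin => [|k] kr kmin; first by rewrite /pow2 powRr0.
rewrite leNgt; apply/negP => h; have := kmin k.
by rewrite natr1 h ltnn => /(_ isT).
Qed.

Let kern_le_norm (z : RN) (r : R) : 0 < r -> r <= `|z| -> kern z 0 <= r `^ (- p).
Proof.
move=> r0 rz; rewrite /fractional_kernel subr0 !powRN lef_pV2 ?posrE ?powR_gt0//; last first.
  by rewrite (lt_le_trans r0)// (le_trans rz)// norm_le_enorm.
rewrite ge0_ler_powR// ?nnegrE ?enorm_ge0//.
- by rewrite addr_ge0// ltW.
- exact: ltW.
- exact: le_trans rz (norm_le_enorm _).
Qed.

(* A step function dominating the k-th inner and the k-th outer dyadic shell;
   full cubes are used instead of shells since their volume is immediate. *)
Let shell k (z : RN) : R :=
  near_coef k * \1_(cube 0 (pow2 (- k%:R))) z + far_coef k * \1_(cube 0 (pow2 (k%:R + 1))) z.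

Let near_coef_ge0 k : 0 <= near_coef k.
Proof. by rewrite mulr_ge0// ltW. Qed.

Let far_coef_ge0 k : 0 <= far_coef k.
Proof. exact: powR_ge0. Qed.

Let shell_ge0 k z : 0 <= shell k z.
Proof. by rewrite addr_ge0// mulr_ge0. Qed.

Let shell_bound (z : RN) : exists k, Num.min 1 `|z| * kern z 0 <= shell k z.
Proof.
have [->|z0] := eqVneq z 0.
  by exists 0%N; rewrite normr0 min_r ?mul0r ?shell_ge0.
have {}z0 : 0 < `|z| by rewrite normr_gt0.
have [z1|z1] := ltP `|z| 1.
  have [k /andP[kz zk]] := dyadic_small z0 z1.
  exists k; apply: (@le_trans _ _ (near_coef k)).
    apply: ler_pM => //; first exact: powR_ge0.
    apply: le_trans (kern_le_norm (pow2_gt0 _) (ltW kz)) _.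
    by rewrite pow2M mulrNN.
  rewrite /shell indicE mem_set ?mulr1; first by rewrite lerDl mulr_ge0.
  by rewrite /cube/= subr0.
have [k /andP[kz zk]] := dyadic_large z1.
exists k; apply: (@le_trans _ _ (far_coef k)).
  rewrite mul1r.
  apply: le_trans (kern_le_norm (pow2_gt0 _) kz) _.
  by rewrite pow2M mulrN.
rewrite /shell addrC indicE mem_set ?mulr1; first by rewrite lerDl mulr_ge0.
by rewrite /cube/= subr0 ltW.
Qed.

Let measurable_shell k : measurable_fun setT (shell k).
Proof.
by apply: measurable_funD; apply: measurable_funM => //;
  apply: measurable_indic; apply: measurable_cube; rewrite ltW.
Qed.

Let integral_shell k : (\int[mu]_z (shell k z)%:E =
  (pow2 (2 * N%:R + s) * pow2 (s - 1) ^+ k)%:E + (pow2 (2 * N%:R) * pow2 (- s) ^+ k)%:E)%E.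
Proof.
have mc r : 0 <= r -> measurable (cube (0 : RN) r) := @measurable_cube R N 0 r.
under eq_integral do rewrite EFinD.
rewrite ge0_integralD//=; last 4 first.
- by move=> z _; rewrite lee_fin mulr_ge0.
- apply/measurable_EFinP; apply: measurable_funM => //.
  by apply: measurable_indic; apply: mc; rewrite ltW.
- by move=> z _; rewrite lee_fin mulr_ge0.
- apply/measurable_EFinP; apply: measurable_funM => //.
  by apply: measurable_indic; apply: mc; rewrite ltW.
have I c r : 0 <= c -> 0 <= r ->
    (\int[mu]_z (c * \1_(cube 0 r) z)%:E = (c * (r *+ 2) ^+ N)%:E)%E.
  move=> c0 r0; under eq_integral do rewrite EFinM.
  rewrite ge0_integralZl//; last first.
    by apply/measurable_EFinP; apply: measurable_indic; exact: mc.
  rewrite integral_indic//; last exact: (mc _ r0).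
  by rewrite setIT EFinM; congr (_ * _)%E; exact: lebesgue_cube.
have dbl x : x *+ 2 = pow2 1 * x by rewrite pow2_1 mulr_natl.
rewrite !I// ?ltW//; congr ((_)%:E + (_)%:E)%E.
  rewrite [pow2 _ *+ 2]dbl -pow2D !pow2X /near_coef -!pow2D; congr pow2.
  by rewrite /p; ring.
rewrite [pow2 _ *+ 2]dbl -pow2D !pow2X /far_coef -!pow2D; congr pow2.
by rewrite /p; ring.
Qed.

(** The singularity |z|^(-N-s) gains one power of |z| near the origin, which
    makes it integrable because s < 1, and it is integrable at infinity because
    s > 0. Summed over dyadic shells, both claims are geometric series of
    ratios 2^(s-1) and 2^(-s). *)
Lemma kern_min_bound : exists2 kappa : R, 0 <= kappa &
  forall y : RN, (\int[mu]_x (Num.min 1 `|x - y| * kern x y)%:E <= kappa%:E)%E.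
Proof.
pose A := pow2 (2 * N%:R + s) / (1 - pow2 (s - 1)).
pose B := pow2 (2 * N%:R) / (1 - pow2 (- s)).
have h1 : 0 <= pow2 (s - 1) < 1 by rewrite ltW//= pow2_lt1// subr_lt0.
have h2 : 0 <= pow2 (- s) < 1 by rewrite ltW//= pow2_lt1// oppr_lt0.
exists (A + B).
  case/andP: h1 => _ h1; case/andP: h2 => _ h2.
  by apply: addr_ge0; apply: divr_ge0; rewrite ?subr_ge0 ?(ltW h1) ?(ltW h2)// powR_ge0.
move=> y.
have mg : measurable_fun setT (fun z : RN => (Num.min 1 `|z| * kern z 0)%:E).
  apply/measurable_EFinP; apply: measurable_funM.
    apply: measurable_minr => //.
    by apply: continuous_rV_measurable; exact: norm_continuous.
  exact: measurable_kernl.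
have g0 z : (0 <= (Num.min 1 `|z| * kern z 0)%:E)%E.
  by rewrite lee_fin mulr_ge0 ?kern_ge0// le_min ler01 normr_ge0.
rewrite (_ : \int[mu]_x _ = \int[mu]_z (Num.min 1 `|z| * kern z 0)%:E)%E; last first.
  transitivity (\int[mu]_x (Num.min 1 `|x + (- y)| * kern (x + (- y)) 0)%:E)%E.
    by apply: eq_integral => x _; rewrite -(kern_shift s (- y) x y) subrr.
  exact: (ge0_integral_shift (- y) mg g0).
apply: (@le_trans _ _ (\int[mu]_z \sum_(0 <= k <oo) (shell k z)%:E)%E).
  apply: ge0_le_integral => //.
  - by apply: ge0_emeasurable_sum => k; [move=> *; rewrite lee_fin|
      move=> _; apply/measurable_EFinP].
  - move=> z _; have [k kz] := shell_bound z.
    apply: (@le_trans _ _ (shell k z)%:E); first by rewrite lee_fin.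
    rewrite (@nneseriesD1 _ (fun i => (shell i z)%:E) k)//; last by move=> *; rewrite lee_fin shell_ge0.
    by rewrite leeDl// nneseries_ge0// => *; rewrite lee_fin shell_ge0.
rewrite integral_nneseries//; last 2 first.
- by move=> k; apply/measurable_EFinP.
- by move=> k z _; rewrite lee_fin.
under eq_eseriesr do rewrite integral_shell.
rewrite nneseriesD; last 2 first.
- by move=> k _ _; rewrite lee_fin mulr_ge0 ?exprn_ge0// ltW.
- by move=> k _ _; rewrite lee_fin mulr_ge0 ?exprn_ge0// ltW.
by rewrite EFinD; apply: leeD; apply: geometric_nneseries_le; rewrite // ltW.
Qed.

End kappa.

(** * The Gagliardo seminorm and translations *)

Section seminorm.
Context {R : realType} {N : nat} (s : R).
Hypotheses (N_gt0 : (0 < N)%N) (s_gt0 : 0 < s) (s_lt1 : s < 1).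
Local Notation RN := 'rV[R]_N.
Local Notation mu := (@lebesgue_rV R N).
Local Notation kern := (@fractional_kernel R N s).
Local Notation gagliardo := (@gagliardo R N s).

Lemma measurable_comp_addr (u : RN -> R) a : measurable_fun setT u ->
  measurable_fun setT (fun x : RN => u (x + a)).
Proof. by move=> mu_; apply: (measurableT_comp mu_); exact: measurable_addr_rV. Qed.

Lemma emeasurable_comp_addr (f : RN -> \bar R) a : measurable_fun setT f ->
  measurable_fun setT (fun x : RN => f (x + a)).
Proof. by move=> mf; apply: (measurableT_comp mf); exact: measurable_addr_rV. Qed.

Lemma measurable_section (F : RN -> RN -> R) y :
  measurable_fun setT (fun p : RN * RN => F p.1 p.2) ->
  measurable_fun setT (fun x => (F x y)%:E).
Proof.
move=> mF; apply/measurable_EFinP.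
have m2 : measurable_fun setT (fun x : RN => (x, y)).
  by apply/measurable_fun_pairP; split; [exact: measurable_id|exact: measurable_cst].
exact: (measurableT_comp mF m2).
Qed.

Lemma measurable_inner (F : RN -> RN -> R) :
  measurable_fun setT (fun p : RN * RN => F p.1 p.2) ->
  (forall x y, 0 <= F x y) ->
  measurable_fun setT (fun y => \int[mu]_x (F x y)%:E)%E.
Proof.
move=> mF F0.
have h : measurable_fun setT (fun p : RN * RN => (F p.2 p.1)%:E).
  have m2 : measurable_fun setT (fun p : RN * RN => (p.2, p.1)).
    by apply/measurable_fun_pairP; split; [exact: measurable_snd|exact: measurable_fst].
  by apply/measurable_EFinP; exact: (measurableT_comp mF m2).
apply: (@measurable_fun_fubini_tonelli_F _ _ RN RN R mu _ h) => p.
by rewrite lee_fin.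
Qed.

Lemma measurable_gagliardo_section (u : RN -> R) y : measurable_fun setT u ->
  measurable_fun setT (fun x => (`|u x - u y| * kern x y)%:E).
Proof.
move=> mu_; apply: (@measurable_section (fun x y => `|u x - u y| * kern x y)).
exact: measurable_gagliardo_fun.
Qed.

Lemma measurable_gagliardo_inner (u : RN -> R) : measurable_fun setT u ->
  measurable_fun setT (fun y => \int[mu]_x (`|u x - u y| * kern x y)%:E)%E.
Proof.
move=> mu_; apply: (@measurable_inner (fun x y => `|u x - u y| * kern x y)).
  exact: measurable_gagliardo_fun.
by move=> x y; rewrite mulr_ge0// kern_ge0.
Qed.

Lemma double_integral_shift (F : RN -> RN -> R) b :
  measurable_fun setT (fun p : RN * RN => F p.1 p.2) -> (forall x y, 0 <= F x y) ->
  (\int[mu]_y \int[mu]_x (F (x + b) (y + b))%:E = \int[mu]_y \int[mu]_x (F x y)%:E)%E.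
Proof.
move=> mF F0; pose G y := (\int[mu]_x (F x y)%:E)%E.
have mG : measurable_fun setT G := measurable_inner mF F0.
have G0 y : (0 <= G y)%E by apply: integral_ge0 => x _; rewrite lee_fin.
transitivity (\int[mu]_y G (y + b)%R)%E; last exact: (ge0_integral_shift b mG G0).
apply: eq_integral => y _.
apply: (@ge0_integral_shift R N b (fun x => (F x (y + b)%R)%:E)).
  exact: measurable_section.
by move=> x; rewrite lee_fin.
Qed.

Lemma gagliardo_shift (u : RN -> R) a : measurable_fun setT u ->
  gagliardo (fun x => u (x + a)) = gagliardo u.
Proof.
move=> mu_; have g0 x y : 0 <= `|u x - u y| * kern x y by rewrite mulr_ge0// kern_ge0.
transitivity (\int[mu]_y \int[mu]_x
    (`|u (x + a) - u (y + a)| * kern (x + a) (y + a))%:E)%E.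
  by apply: eq_integral => y _; apply: eq_integral => x _; rewrite kern_shift.
exact: (@double_integral_shift (fun x y => `|u x - u y| * kern x y) a
  (measurable_gagliardo_fun s mu_) g0).
Qed.

Lemma kern_ge (x y : RN) r : 0 < `|x - y| -> `|x - y| <= r ->
  (Num.sqrt N%:R * r) `^ (- (N%:R + s)) <= kern x y.
Proof.
move=> xy0 xyr; have e0 := lt_le_trans xy0 (norm_le_enorm _).
have le : enorm (x - y) <= Num.sqrt N%:R * r.
  by apply: le_trans (enorm_le_norm _) _; rewrite ler_wpM2l// sqrtr_ge0.
rewrite /fractional_kernel !powRN lef_pV2 ?posrE ?powR_gt0//; last exact: lt_le_trans le.
rewrite ge0_ler_powR ?nnegrE ?enorm_ge0//.
- by rewrite addr_ge0// ltW.
- exact: le_trans (enorm_ge0 _) le.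
Qed.

(** On the diagonal, where the kernel carries no information, the increment
    vanishes. *)
Lemma increment_le_kern (u : RN -> R) (x y : RN) r : `|x - y| <= r -> 0 < r ->
  `|u x - u y| <= (Num.sqrt N%:R * r) `^ (N%:R + s) * (`|u x - u y| * kern x y).
Proof.
move=> xyr r0; have [->|xy] := eqVneq x y; first by rewrite subrr normr0 mul0r mulr0.
have xy0 : 0 < `|x - y| by rewrite normr_gt0 subr_eq0.
rewrite mulrCA ler_peMr//.
have q0 : 0 < (Num.sqrt N%:R * r) `^ (N%:R + s).
  by rewrite powR_gt0// mulr_gt0// sqrtr_gt0 ltr0n.
by rewrite mulrC -ler_pdivrMr// mul1r -powRN kern_ge.
Qed.

(** Fractional regularity in L1: insert an intermediate point x in
    |u(y + a) - u(y)| <= |u(y + a) - u(x)| + |u(x) - u(y)| and average over x in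
    the cube of radius |a| around y, where all distances are at most 2 |a| and
    the kernel is therefore at least of order |a|^(-N-s). *)
Lemma translation_le_gagliardo : exists2 C : R, 0 <= C &
  forall (u : RN -> R) (a : RN), measurable_fun setT u -> a != 0 ->
  (\int[mu]_y (`|u (y + a) - u y|)%:E <= (C * `|a| `^ s)%:E * gagliardo u)%E.
Proof.
exists (Num.sqrt N%:R `^ (N%:R + s) * 2 * 2 `^ s).
  by rewrite !mulr_ge0// powR_ge0.
move=> u a mu_ a0; set r := `|a|.
have r0 : 0 < r by rewrite normr_gt0.
set q := (Num.sqrt N%:R * (r *+ 2)) `^ (N%:R + s).
pose G y := (\int[mu]_x (`|u x - u y| * kern x y)%:E)%E.
have mG : measurable_fun setT G := measurable_gagliardo_inner mu_.
have G0 y : (0 <= G y)%E by apply: integral_ge0 => x _; exact: gagliardo_fun_ge0.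
have mFy y := measurable_gagliardo_section y mu_.
have q0 : 0 <= q by exact: powR_ge0.
have v0 : 0 < (r *+ 2) ^+ N by rewrite exprn_gt0// mulrn_wgt0.
have mtr : measurable_fun setT (fun y : RN => `|u (y + a) - u y|).
  apply: (measurableT_comp (@normr_measurable R setT)); apply: measurable_funB => //.
  exact: measurable_comp_addr.
Local Open Scope ereal_scope.
(* The inequality before integration in y. *)
have step (y : RN) : (((r *+ 2) ^+ N)%:E * (`|u (y + a)%R - u y|)%:E <= q%:E * (G (y + a)%R + G y))%E.
  have mc := @measurable_cube R N y r (ltW r0).
  pose H x := (`|u x - u (y + a)| * kern x (y + a))%:E + (`|u x - u y| * kern x y)%:E.
  have mH : measurable_fun setT H by exact: emeasurable_funD.
  have H0 x : 0 <= H x by rewrite adde_ge0// gagliardo_fun_ge0.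
  rewrite -(lebesgue_cube y (ltW r0)) muleC.
  rewrite -[leLHS](integral_cst mu mc).
  apply: (@le_trans _ _ (\int[mu]_(x in cube y r) (q%:E * H x))).
    apply: ge0_le_integral => //.
    - by move=> x _; rewrite lee_fin.
    - by apply: measurable_funeM; exact: measurable_funTS.
    - move=> x /= xy; rewrite /H -EFinD -EFinM lee_fin mulrDr.
      rewrite (_ : u (y + a)%R - u y = - (u x - u (y + a)%R) + (u x - u y))%R; last by ring.
      apply: le_trans (ler_normD _ _) _; rewrite normrN; apply: lerD.
        apply: increment_le_kern; last by rewrite mulrn_wgt0.
        rewrite opprD addrA (le_trans (ler_normB _ _))// mulr2n lerD//.
      apply: increment_le_kern; last by rewrite mulrn_wgt0.
      by rewrite (le_trans xy)// mulr2n lerDl ltW.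
  rewrite ge0_integralZl//; last exact: measurable_funTS.
  rewrite lee_wpmul2l//.
  apply: (@le_trans _ _ (\int[mu]_x H x)).
    exact: ge0_subset_integral.
  by rewrite ge0_integralD// => x _; exact: gagliardo_fun_ge0.
have GE : gagliardo u = \int[mu]_y G y by [].
clearbody G.
rewrite -(@lee_pmul2l _ ((r *+ 2) ^+ N)%:E)//.
rewrite -ge0_integralZl//; last 2 first.
- exact/measurable_EFinP.
- by rewrite lee_fin ltW.
apply: (@le_trans _ _ (\int[mu]_y (q%:E * (G (y + a)%R + G y)))).
  apply: ge0_le_integral => //.
  - by move=> y _; rewrite mule_ge0// lee_fin// ltW.
  - by apply: measurable_funeM; exact/measurable_EFinP.
  - apply: measurable_funeM; apply: emeasurable_funD => //.
    exact: (emeasurable_comp_addr a mG).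
rewrite ge0_integralZl//; last 2 first.
- apply: emeasurable_funD => //.
  exact: (emeasurable_comp_addr a mG).
- by move=> y _; rewrite adde_ge0.
rewrite ge0_integralD//; last first.
  exact: (emeasurable_comp_addr a mG).
rewrite (ge0_integral_shift a mG G0) -GE.
have g0 : 0 <= gagliardo u by rewrite GE; exact: integral_ge0.
have -> : gagliardo u + gagliardo u = 2%:E * gagliardo u.
  by rewrite (EFinD 1 1) ge0_muleDl ?lee_fin// !mul1e.
rewrite !muleA -!EFinM lee_wpmul2r// lee_fin.
have sN0 : (N%:R + s)%R == 0%R = false by apply/negbTE; rewrite gt_eqF// ltr_wpDl.
rewrite /q powRM ?sqrtr_ge0 ?mulrn_wge0 ?(ltW r0)//.
rewrite -(mulr_natl r) powRM ?(ltW r0)// exprMn.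
rewrite !(@powRD _ _ N%:R) ?sN0// !powR_mulrn ?sqrtr_ge0 ?(ltW r0)//.
by rewrite le_eqVlt; apply/orP; left; apply/eqP; ring.
Qed.

End seminorm.

(** * The Cheeger inequality, for sets and for functions *)

Section cheeger_bounds.
Context {R : realType} {N : nat} (s : R).
Hypotheses (N_gt0 : (0 < N)%N) (s_gt0 : 0 < s) (s_lt1 : s < 1).
Local Notation RN := 'rV[R]_N.
Local Notation mu := (@lebesgue_rV R N).
Local Notation kern := (@fractional_kernel R N s).
Local Notation gagliardo := (@gagliardo R N s).

Lemma gagliardo_ge0 (u : RN -> R) : (0 <= gagliardo u)%E.
Proof.
by apply: integral_ge0 => y _; apply: integral_ge0 => x _; exact: gagliardo_fun_ge0.
Qed.

Lemma cheeger_mul_le_perimeter (Omega E : set RN) (h : R) :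
  (mu Omega < +oo)%E -> measurable Omega -> measurable E -> E `<=` Omega ->
  0 <= h -> (h%:E <= cheeger s Omega)%E -> (h%:E * mu E <= perimeter s E)%E.
Proof.
move=> fO mO mE EO h0 hc.
have fE : (mu E < +oo)%E by apply: le_lt_trans fO; apply: le_measure; rewrite ?inE.
have [E0|E0] := eqVneq (mu E) 0%E.
  by rewrite E0 mule0 perimeterE; exact: gagliardo_ge0.
have Egt0 : (0 < mu E)%E by rewrite lt0e E0 measure_ge0.
have : (h%:E <= perimeter s E / mu E)%E.
  by apply: (le_trans hc); apply: ereal_inf_lbound; exists E.
case: (mu E) fE Egt0 => [r| |]// _; rewrite lte_fin => r0.
by rewrite inver gt_eqF// lee_pdivlMr.
Qed.

(** A cube A placed away from Omega, at bounded distance, interacts with every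
    point of E: the kernel is bounded below by some q on E x A, so that
    P_s(E) >= q |A| |E|. *)
Lemma cheeger_pos (Omega : set RN) : bounded_set Omega ->
  exists2 c : R, 0 < c & (c%:E <= cheeger s Omega)%E.
Proof.
move=> [M0 [_ bO]].
pose M := Num.max 1 (M0 + 1).
have M1 : 1 <= M by rewrite le_max lexx.
have OM x : Omega x -> `|x| <= M.
  by move=> Ox; apply: bO Ox; rewrite lt_max ltrDl ltr01 orbT.
pose A : set RN := cube (const_mx (M + 2)) 1.
have mA : measurable A by exact: measurable_cube.
pose q := (Num.sqrt N%:R * (2 * M + 3)) `^ (- (N%:R + s)).
have q0 : 0 < q by rewrite powR_gt0// mulr_gt0// ?sqrtr_gt0 ?ltr0n//; lra.
exists (q * 2 ^+ N); first by rewrite mulr_gt0// exprn_gt0.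
apply: le_ereal_inf_tmp => _ [E [mE EO E0] <-].
have key : ((q * 2 ^+ N)%:E * mu E <= perimeter s E)%E.
  have AE x y : A y -> E x -> q <= `|\1_E x - \1_E y| * kern x y.
    move=> /= Ay Ex.
    have xM := OM _ (EO _ Ex).
    have i0 : 'I_N := Ordinal N_gt0.
    have := le_trans (norm_coord (y - const_mx (M + 2)) i0) Ay.
    rewrite !mxE ler_norml => /andP[y1 _].
    have x1 : x ord0 i0 <= M.
      by rewrite (le_trans (ler_norm _))// (le_trans (norm_coord _ _)).
    have nEy : (y \in E) = false.
      apply/negbTE/negP; rewrite inE => /EO /OM yM.
      have : y ord0 i0 <= M.
        by rewrite (le_trans (ler_norm _))// (le_trans (norm_coord _ _)).
      by lra.
    rewrite !indicE nEy mem_set// subr0 normr1 mul1r; apply: kern_ge => //.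
      apply: lt_le_trans (norm_coord _ i0); rewrite !mxE normr_gt0 lt_eqF//; lra.
    rewrite (_ : x - y = x - ((y - const_mx (M + 2)) + const_mx (M + 2))); last by rewrite subrK.
    apply: le_trans (ler_normB _ _) _.
    have : `|(const_mx (M + 2) : RN)| <= M + 2.
      apply/rV_norm_leP => [|i]; first by lra.
      by rewrite mxE ger0_norm//; lra.
    have := ler_normD (y - const_mx (M + 2)) (const_mx (M + 2)).
    move: Ay; rewrite /A /cube/=; lra.
  have mi : measurable_fun setT (\1_E : RN -> R) by exact: measurable_indic.
  have mFy y := measurable_gagliardo_section s y mi.
  rewrite perimeterE /gagliardo.
  have mG := measurable_gagliardo_inner s mi.
  apply: (@le_trans _ _ (\int[mu]_(y in A) \int[mu]_x (`|\1_E x - \1_E y| * kern x y)%:E)%E); last first.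
    apply: ge0_subset_integral => //.
    by move=> y _; apply: integral_ge0 => x _; exact: gagliardo_fun_ge0.
  apply: (@le_trans _ _ (\int[mu]_(y in A) (cst (q%:E * mu E) y))%E).
    have muA : mu A = (2 ^+ N)%:E by rewrite /A lebesgue_cube// mulr2n.
    rewrite integral_cst// [X in (_ <= _ * X)%E](_ : _ = (2 ^+ N)%:E)//.
    by rewrite muleAC -EFinM.
  apply: ge0_le_integral => //.
  - by move=> y _; rewrite mule_ge0// lee_fin ltW.
  - exact: measurable_funTS.
  - move=> y Ay; rewrite -(integral_cst mu mE).
    apply: (@le_trans _ _ (\int[mu]_(x in E) (`|\1_E x - \1_E y| * kern x y)%:E)%E).
      apply: ge0_le_integral => //.
      - by move=> x _; rewrite lee_fin ltW.
      - exact: measurable_funTS.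
      - by move=> x Ex; rewrite lee_fin AE.
    by apply: ge0_subset_integral => // x _; exact: gagliardo_fun_ge0.
have : (mu E < +oo)%E.
  apply: bounded_rV_lty => //; exists M; split; first exact: num_real.
  by move=> K MK x Ex; apply: le_trans (OM x (EO x Ex)) (ltW MK).
case: (mu E) E0 key => [r| |]// + + _.
by rewrite lte_fin => r0; rewrite inver gt_eqF// lee_pdivlMr.
Qed.

(** The superlevel indicators of a and b differ exactly for t between a and b;
    this is the pointwise identity behind the coarea formula. *)
Lemma integral_indic_gap (a b : R) : 0 <= a -> 0 <= b ->
  (\int[lebesgue_measure]_t (`|(((0 <= t) && (t < a))%:R : R) - ((0 <= t) && (t < b))%:R|)%:E
   = `|a - b|%:E)%E.
Proof.
wlog : a b / a <= b => [wl a0 b0|ab a0 b0].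
  have [ab|/ltW ba] := leP a b; first exact: wl.
  by rewrite distrC -wl//; apply: eq_integral => t _; rewrite distrC.
transitivity (\int[lebesgue_measure]_t (\1_(`[a, b[%classic) t : R)%:E)%E.
  apply: eq_integral => t _; congr EFin; rewrite indicE.
  rewrite (_ : (t \in `[a, b[%classic) = (a <= t) && (t < b)); last first.
    by apply/idP/idP; rewrite inE/= in_itv.
  have [t0|t0] := leP 0 t => /=.
    have [ta|ta] := ltP t a => /=; first by rewrite (lt_le_trans ta ab) subrr normr0.
    by case: (t < b); rewrite ?subr0 ?normr0// sub0r normrN normr1.
  by rewrite subrr normr0 leNgt (lt_le_trans t0).
rewrite integral_indic ?setIT//.
transitivity (lebesgue_measure (`[a, b[%classic : set R)); first by [].
rewrite lebesgue_measure_itv/= lte_fin distrC ger0_norm ?subr_ge0//.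
by case: ltgtP ab => // -> _; rewrite subrr.
Qed.

(** The Cheeger inequality passes from sets to functions through superlevel
    sets: the layer-cake formula writes the integral of v, and the coarea formula
    its seminorm, as the integral over t of the volume, respectively of the
    perimeter, of {v > t} for t >= 0, which is a subset of Omega. *)
Lemma cheeger_mul_integral_le (Omega : set RN) (v : RN -> R) (h : R) :
  (mu Omega < +oo)%E -> measurable Omega ->
  measurable_fun setT v -> (forall x, 0 <= v x) -> (forall x, v x != 0 -> Omega x) ->
  0 <= h -> (h%:E <= cheeger s Omega)%E ->
  (h%:E * \int[mu]_x (v x)%:E <= gagliardo v)%E.
Proof.
move=> fO mO mv v0 vO h0 hc.
pose E t : set RN := [set x | 0 <= t /\ t < v x].
pose chi (t : measurableTypeR R) (x : RN) : R := ((0 <= t) && (t < v x))%:R.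
have chiE t x : \1_(E t) x = chi t x.
  rewrite indicE /chi; congr ((nat_of_bool _)%:R); apply/idP/idP; rewrite inE /E/=.
    by move=> [-> ->].
  by move=> /andP[].
have mchi : measurable_fun setT (fun p : measurableTypeR R * RN => chi p.1 p.2).
  rewrite (_ : (fun _ => _) = \1_[set p : measurableTypeR R * RN | 0 <= p.1 /\ p.1 < v p.2]).
    apply: measurable_indic.
    rewrite (_ : [set _ | _] = (fun p : measurableTypeR R * RN => p.1) @^-1` `[0, +oo[%classic `&`
       (fun p : measurableTypeR R * RN => v p.2 - p.1) @^-1` `]0, +oo[%classic); last first.
      by apply/seteqP; split => p /=; rewrite !in_itv/= !andbT subr_gt0.
    have m1 : measurable_fun setT (fun p : measurableTypeR R * RN => p.1).
      exact: measurable_fst.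
    have m2 : measurable_fun setT (fun p : measurableTypeR R * RN => v p.2 - p.1).
      by apply: measurable_funB => //; exact: (measurableT_comp mv measurable_snd).
    apply: measurableI.
    - rewrite -[X in measurable X]setTI; exact: m1.
    - rewrite -[X in measurable X]setTI; exact: m2.
  apply/funext => -[t x]; rewrite indicE /chi/=; congr ((nat_of_bool _)%:R).
  by apply/idP/idP; rewrite inE/=; [move=> /andP[]|move=> [-> ->]].
have mE t : measurable (E t).
  have [t0|t0] := leP 0 t; last first.
    rewrite (_ : E t = set0)//; apply/seteqP; split=> // x [t1 _].
    by move: t0; rewrite ltNge t1.
  rewrite (_ : E t = v @^-1` `]t, +oo[%classic).
    by rewrite -[X in measurable X]setTI; exact: mv.
  by apply/seteqP; split=> x /=; rewrite in_itv/= andbT => // -[].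
have EO t : E t `<=` Omega.
  by move=> x [t0 tv]; apply: vO; rewrite gt_eqF// (le_lt_trans t0).
have cake : (\int[mu]_x (v x)%:E = \int[lebesgue_measure]_t mu (E t))%E.
  transitivity (\int[mu]_x \int[lebesgue_measure]_t (chi t x)%:E)%E.
    apply: eq_integral => x _.
    have /(_ (v x) 0) := integral_indic_gap; rewrite subr0 ger0_norm// => <-//.
    apply: eq_integral => t _; congr EFin; rewrite /chi.
    have -> : (0 <= t) && (t < 0) = false by case: leP.
    by rewrite subr0 ger0_norm.
  rewrite -(@fubini_tonelli _ _ (measurableTypeR R) RN R lebesgue_measure mu (fun p => (chi p.1 p.2)%:E))//=.
    apply: eq_integral => t _; rewrite -(setIT (E t)) -integral_indic//.
    by apply: eq_integral => x _; rewrite chiE.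
  - exact/measurable_EFinP.
  - by move=> p; rewrite lee_fin.
have mF3 : measurable_fun setT (fun p : measurableTypeR R * RN * RN =>
    (`|chi p.1.1 p.2 - chi p.1.1 p.1.2| * kern p.2 p.1.2)%:E).
  pose T3 := (measurableTypeR R * RN * RN)%type.
  have m1 : measurable_fun setT (fun p : T3 => p.1.1).
    exact: (measurableT_comp measurable_fst measurable_fst).
  have m2 : measurable_fun setT (fun p : T3 => p.1.2).
    exact: (measurableT_comp measurable_snd measurable_fst).
  have m3 : measurable_fun setT (fun p : T3 => p.2) by exact: measurable_snd.
  have m13 : measurable_fun setT (fun p : T3 => (p.1.1, p.2)).
    by apply/measurable_fun_pairP; split.
  have m12 : measurable_fun setT (fun p : T3 => (p.1.1, p.1.2)).
    by apply/measurable_fun_pairP; split.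
  have m32 : measurable_fun setT (fun p : T3 => (p.2, p.1.2)).
    by apply/measurable_fun_pairP; split.
  apply/measurable_EFinP; apply: measurable_funM.
    apply: (measurableT_comp (@normr_measurable R setT)); apply: measurable_funB.
      exact: (measurableT_comp mchi m13).
    exact: (measurableT_comp mchi m12).
  exact: (measurableT_comp (@measurable_kern R N s) m32).
have coarea : (gagliardo v = \int[lebesgue_measure]_t perimeter s (E t))%E.
  transitivity (\int[lebesgue_measure]_t \int[mu]_y \int[mu]_x (`|chi t x - chi t y| * kern x y)%:E)%E; last first.
    apply: eq_integral => t _; rewrite perimeterE; apply: eq_integral => y _.
    by apply: eq_integral => x _; rewrite !chiE.
  rewrite (@tonelli3 R _ _ _ (measurableTypeR R) RN RN lebesgue_measure mu mu
    (fun t y x => (`|chi t x - chi t y| * kern x y)%:E)).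
  - apply: eq_integral => y _; apply: eq_integral => x _.
    have mt z : measurable_fun setT (fun t : measurableTypeR R => chi t z).
      have m2 : measurable_fun setT (fun t : measurableTypeR R => (t, z)).
        by apply/measurable_fun_pairP; split; [exact: measurable_id|exact: measurable_cst].
      exact: (measurableT_comp mchi m2).
    under [RHS]eq_integral do rewrite EFinM muleC.
    rewrite ge0_integralZl//; last 2 first.
    - apply/measurable_EFinP; apply: (measurableT_comp (@normr_measurable R setT)).
      exact: measurable_funB.
    - by rewrite lee_fin kern_ge0.
    by rewrite (integral_indic_gap (v0 x) (v0 y)) -EFinM mulrC.
  - exact: mF3.
  - by move=> *; rewrite lee_fin mulr_ge0// kern_ge0.
have mP : measurable_fun setT (fun t : measurableTypeR R => perimeter s (E t)).
  have mG : measurable_fun setT (fun p : measurableTypeR R * RN =>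
      \int[mu]_x (`|chi p.1 x - chi p.1 p.2| * kern x p.2)%:E)%E.
    apply: (@measurable_fun_fubini_tonelli_F _ _ _ RN R mu _ mF3) => p.
    by rewrite lee_fin mulr_ge0// kern_ge0.
  rewrite (_ : (fun _ => _) = (fun t : measurableTypeR R =>
      \int[mu]_y \int[mu]_x (`|chi t x - chi t y| * kern x y)%:E)%E).
    apply: (@measurable_fun_fubini_tonelli_F _ _ _ RN R mu _ mG) => p.
    by apply: integral_ge0 => x _; rewrite lee_fin mulr_ge0// kern_ge0.
  apply/funext => t; rewrite perimeterE; apply: eq_integral => y _.
  by apply: eq_integral => x _; rewrite !chiE.
have mM : measurable_fun setT (fun t : measurableTypeR R => mu (E t)).
  have /measurable_EFinP mchi' := mchi.
  rewrite (_ : (fun _ => _) = (fun t : measurableTypeR R => \int[mu]_x (chi t x)%:E)%E).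
    by apply: (@measurable_fun_fubini_tonelli_F _ _ _ RN R mu _ mchi') => p; rewrite lee_fin.
  apply/funext => t; rewrite -(setIT (E t)) -integral_indic//.
  by apply: eq_integral => x _; rewrite chiE.
rewrite cake coarea -ge0_integralZl//.
apply: ge0_le_integral => //.
- by move=> t _; rewrite mule_ge0.
- exact: measurable_funeM.
- by move=> t _; apply: (cheeger_mul_le_perimeter fO).
Qed.

End cheeger_bounds.

(** * Smooth functions of one variable vanishing on a half-line *)

Section derive_helpers.
Context {R : realType} {V : normedModType R}.

Lemma is_derive_cvgP (f : V -> R) a v df : is_derive a v f df <->
  (fun h => h^-1 *: (f (h *: v + a) - f a)) @ 0^' --> df.
Proof.
split=> [[df1 <-]|H]; first exact: df1.
have c : derivable f a v by apply/cvg_ex; exists df.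
by split => //; apply: cvg_lim.
Qed.

(** Derivatives are read off below from quadratic remainder estimates, which
    can be integrated, rather than from limits. *)
Lemma is_derive_quadratic (f : V -> R) a v df C :
  (forall h, `|f (h *: v + a) - f a - h * df| <= C * h ^+ 2) ->
  is_derive a v f df.
Proof.
move=> H; apply/is_derive_cvgP/cvgrPdist_le => /= e e0.
have C0 : 0 <= C by have := H 1; rewrite expr1n mulr1; apply: le_trans.
near=> h.
have h0 : h != 0 by near: h; exact: nbhs_dnbhs_neq.
rewrite distrC (_ : _ - df = h^-1 * (f (h *: v + a) - f a - h * df)); last first.
  by rewrite /GRing.scale/=; field.
rewrite normrM normfV ler_pdivrMl ?normr_gt0//.
apply: le_trans (H h) _; rewrite -(real_normK (num_real h)) expr2 mulrCA ler_wpM2l//.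
have : `|h| <= e / (C + 1).
  near: h; apply: nbhs_dnbhs; apply/nbhs_normP; exists (e / (C + 1)) => //=.
    by rewrite divr_gt0// ltr_pwDr.
  by move=> h; rewrite /ball_/= sub0r normrN => /ltW.
rewrite ler_pdivlMr ?ltr_pwDr// => he.
by apply: le_trans he; rewrite mulrC ler_wpM2l// lerDl.
Unshelve. all: by end_near. Qed.

End derive_helpers.

Section flat.
Context {R : realType}.

(** The functions P(1/x) exp(-1/x), extended by 0 to x <= 0. With an arbitrary
    polynomial P the class is stable under derivation, so that smoothness
    reduces to one computation of a derivative. *)
Definition flat (P : {poly R}) (x : R) : R :=
  if 0 < x then P.[x^-1] * expR (- x^-1) else 0.

Lemma flat_le0 P x : x <= 0 -> flat P x = 0.
Proof. by rewrite /flat leNgt => /negbTE ->. Qed.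

(** Powers of 1/x cost nothing: a factor x can always be extracted, which gives
    flatness at the origin. *)
Lemma flatX P x : flat P x = x * flat ('X * P) x.
Proof.
rewrite /flat; case: ifPn => x0; last by rewrite mulr0.
by rewrite hornerM hornerX !mulrA mulfV ?gt_eqF// mul1r.
Qed.

Lemma flat_bounded P : exists C, forall x, `|flat P x| <= C.
Proof.
have mono n : forall x : R, 0 < x -> x^-1 ^+ n * expR (- x^-1) <= n`!%:R.
  move=> x x0; set y := x^-1; have y0 : 0 < y by rewrite invr_gt0.
  rewrite expRN ler_pdivrMr ?expR_gt0//.
  case: n => [|n]; first by rewrite expr0 mul1r -expR0 ler_expR ltW.
  rewrite mulrC -ler_pdivrMr ?ltr0n ?fact_gt0//.
  by apply: le_trans (expR_ge1Dxn n (ltW y0)); rewrite lerDr.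
exists (\sum_(i < size P) `|P`_i| * i`!%:R) => x.
rewrite /flat; case: ifPn => x0; last first.
  by rewrite normr0 sumr_ge0// => i _; rewrite mulr_ge0.
rewrite horner_coef mulr_suml; apply: le_trans (ler_norm_sum _ _ _) _.
apply: ler_sum => i _; rewrite -mulrA normrM ler_wpM2l// ger0_norm ?mono//.
by rewrite mulr_ge0// ?expR_ge0// exprn_ge0// invr_ge0 ltW.
Qed.

Lemma is_derive_flat (P : {poly R}) (x : R) :
  is_derive x 1 (flat P) (flat ('X ^+ 2 * (P - P^`())) x).
Proof.
have [x0|x0|x0] := ltgtP x 0.
- rewrite flat_le0 ?ltW//.
  apply: (@near_eq_is_derive _ _ _ (cst 0) _ x 1 0).
  near=> y; rewrite flat_le0// ltW//; near: y.
  exact: open_nbhs_nbhs (conj (@open_lt R 0) x0).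
- pose F (y : R) := P.[y^-1] * expR (- y^-1).
  apply: (@near_eq_is_derive _ _ _ F).
    near=> y; rewrite /flat ifT//; near: y.
    exact: open_nbhs_nbhs (conj (@open_gt R 0) x0).
  rewrite /flat x0.
  have dV : is_derive x 1 (fun y : R => y^-1) (- x ^- 2).
    apply: is_derive_eq; first by apply: is_deriveV; rewrite gt_eqF.
    by rewrite /GRing.scale/= mulr1.
  have dP : is_derive x 1 (fun y : R => P.[y^-1]) (P^`().[x^-1] * (- x ^- 2)).
    exact: is_derive_eq.
  have dN : is_derive x 1 (fun y : R => - y^-1) (x ^- 2).
    by apply: is_derive_eq; rewrite opprK.
  have dE : is_derive x 1 (fun y : R => expR (- y^-1)) (expR (- x^-1) * x ^- 2).
    exact: is_derive_eq.
  apply: is_derive_eq.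
  rewrite /GRing.scale/= hornerM hornerXn hornerD hornerN.
  by rewrite exprVn; ring.
- have [C HC] := flat_bounded ('X * ('X * P)).
  rewrite x0 flat_le0//; apply: (@is_derive_quadratic _ _ _ _ _ _ C) => h.
  rewrite addr0 mulr0 subr0 (flat_le0 P (lexx 0)) subr0 /GRing.scale/= mulr1.
  rewrite flatX flatX mulrA -expr2 normrM mulrC ler_pM//.
  by rewrite ger0_norm// sqr_ge0.
Unshelve. all: by end_near. Qed.

End flat.

(** * Smooth functions of compact support *)

Section smooth_functions.
Context {R : realType} {N : nat}.
Local Notation RN := 'rV[R]_N.
Local Notation e_ i := (delta_mx ord0 i : RN).

(** Smoothness graded by the order of derivation, so that stability under sums
    and products can be shown by induction on the order. *)
Fixpoint Cn (n : nat) (u : RN -> R) : Prop :=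
  continuous u /\
  if n is n'.+1 then
    forall i, (forall x, derivable u x (e_ i)) /\ Cn n' (partial i u)
  else True.

Lemma Cn_continuous n u : Cn n u -> continuous u.
Proof. by case: n => [|n] []. Qed.

Lemma Cn_smooth (u : RN -> R) : (forall n, Cn n u) -> smooth u.
Proof.
move=> cu l; have H n : Cn n (iter_partial l u).
  elim: l n => [|i l IH] n //=.
  by have [_ /(_ i)[_]] := IH n.+1.
by split=> [|i x]; [exact: Cn_continuous (H 0%N)|have [_ /(_ i)[]] := H 1%N].
Qed.

Lemma CnS n u : Cn n.+1 u -> Cn n u.
Proof.
elim: n u => [|n IH] u [cu du]; split => // i.
by have [? ?] := du i; split => //; exact: IH.
Qed.

Lemma partialD i (u v : RN -> R) : (forall x, derivable u x (e_ i)) ->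
  (forall x, derivable v x (e_ i)) ->
  partial i (fun x => u x + v x) = (fun x => partial i u x + partial i v x).
Proof. by move=> du dv; apply/funext => x; rewrite /partial deriveD. Qed.

Lemma partialM i (u v : RN -> R) : (forall x, derivable u x (e_ i)) ->
  (forall x, derivable v x (e_ i)) ->
  partial i (fun x => u x * v x) = (fun x => u x * partial i v x + v x * partial i u x).
Proof. by move=> du dv; apply/funext => x; rewrite /partial deriveM. Qed.

Lemma CnD n u v : Cn n u -> Cn n v -> Cn n (fun x => u x + v x).
Proof.
elim: n u v => [|n IH] u v [cu du] [cv dv]; split => //.
- by move=> x; apply: continuousD; [exact: cu|exact: cv].
- by move=> x; apply: continuousD; [exact: cu|exact: cv].
- move=> i; have [diu Cu] := du i; have [div Cv] := dv i.
  split=> [x|]; first exact: derivableD.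
  by rewrite partialD//; exact: IH.
Qed.

Lemma CnM n u v : Cn n u -> Cn n v -> Cn n (fun x => u x * v x).
Proof.
elim: n u v => [|n IH] u v Cu Cv; have [cu du] := Cu; have [cv dv] := Cv; split => //.
- by move=> x; apply: continuousM; [exact: cu|exact: cv].
- by move=> x; apply: continuousM; [exact: cu|exact: cv].
- move=> i; have [diu Ciu] := du i; have [div Civ] := dv i.
  split=> [x|]; first exact: derivableM.
  by rewrite partialM//; apply: CnD; apply: IH => //; exact: CnS.
Qed.

Lemma Cn_cst n (c : R) : Cn n (fun=> c).
Proof.
elim: n c => [|n IH] c; split => //; try exact: cst_continuous.
move=> i; split=> [x|]; first exact: derivable_cst.
rewrite (_ : partial i _ = fun=> 0)//.
by apply/funext => x; rewrite /partial derive_cst.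
Qed.

Lemma Cn_prod n (I : Type) (r : seq I) (u : I -> RN -> R) :
  (forall i, Cn n (u i)) -> Cn n (fun x => \prod_(i <- r) u i x).
Proof.
move=> Cu; elim: r => [|i r IH].
  rewrite (_ : (fun _ => _) = fun=> 1); first exact: Cn_cst.
  by apply/funext => x; rewrite big_nil.
rewrite (_ : (fun _ => _) = fun x => u i x * \prod_(j <- r) u j x); first exact: CnM.
by apply/funext => x; rewrite big_cons.
Qed.

Lemma is_derive_flat_coord P (a c : R) (j i : 'I_N) (x : RN) :
  is_derive x (e_ i) (fun x : RN => flat P (a + c * x ord0 j))
   (c * (i == j)%:R * flat ('X ^+ 2 * (P - P^`())) (a + c * x ord0 j)).
Proof.
have H : is_derive (x ord0 j) 1 (fun t => flat P (a + c * t))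
    (c * flat ('X ^+ 2 * (P - P^`())) (a + c * x ord0 j)).
  have h1 : is_derive (x ord0 j) 1 (fun t : R => a + c * t) c.
    by apply: is_derive_eq; rewrite /GRing.scale/= add0r mul1r mulr1.
  have h2 := is_derive_flat P (a + c * x ord0 j).
  have := @is_derive1_comp R (flat P) (fun t : R => a + c * t) _ _ _ h2 h1.
  by rewrite mulrC.
apply/is_derive_cvgP.
have coordE h : (h *: e_ i + x) ord0 j = h * (i == j)%:R + x ord0 j.
  by rewrite !mxE eqxx/= eq_sym.
have [ij|ij] := eqVneq i j.
  rewrite mulr1; move/is_derive_cvgP: H; apply: cvg_trans.
  apply: near_eq_cvg; near=> h.
  by rewrite coordE ij eqxx /GRing.scale/=.
rewrite mulr0 mul0r.
have z : (fun _ : R => 0 : R) @ (0 : R)^' --> (0 : R) by exact: cvg_cst.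
apply: cvg_trans z.
apply: near_eq_cvg; near=> h.
by rewrite coordE (negbTE ij) mulr0 add0r subrr scaler0.
Unshelve. all: by end_near. Qed.

Lemma flat_continuous P : continuous (@flat R P).
Proof.
by move=> x; apply/differentiable_continuous/derivable1_diffP; case: (is_derive_flat P x).
Qed.

Lemma Cn_flat_coord n P (a c : R) (j : 'I_N) :
  Cn n (fun x : RN => flat P (a + c * x ord0 j)).
Proof.
have cont Q : continuous (fun x : RN => flat Q (a + c * x ord0 j)).
  move=> x; apply: (@continuous_comp _ _ _ (fun x : RN => a + c * x ord0 j) (flat Q)); last exact: flat_continuous.
  by apply: continuousD; [exact: cst_continuous|apply: continuousM;
    [exact: cst_continuous|exact: coord_continuous]].
elim: n P => [|n IH] P; split => // i; split=> [x|].
  by case: (is_derive_flat_coord P a c j i x).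
rewrite (_ : partial i _ = fun x => c * (i == j)%:R * flat ('X ^+ 2 * (P - P^`())) (a + c * x ord0 j)).
  by apply: CnM => //; exact: Cn_cst.
by apply/funext => x; case: (is_derive_flat_coord P a c j i x).
Qed.

Definition test_fun (u : RN -> R) : Prop :=
  smooth u /\ exists M : R, forall x, M < `|x| -> u x = 0.

Lemma smooth_partial (u : RN -> R) i : smooth u -> smooth (partial i u).
Proof.
move=> su l; have := su (rcons l i).
by rewrite /iter_partial -cats1 foldr_cat.
Qed.

Lemma smooth_derivable (u : RN -> R) i x : smooth u -> derivable u x (e_ i).
Proof. by move=> /(_ [::])[_]; exact. Qed.

Lemma smooth_continuous (u : RN -> R) : smooth u -> continuous u.
Proof. by move=> /(_ [::])[]. Qed.

Lemma partial_far (u : RN -> R) i M : (forall x, M < `|x| -> u x = 0) ->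
  forall x, M < `|x| -> partial i u x = 0.
Proof.
move=> uM x Mx; rewrite /partial (@near_eq_derive _ _ _ u (cst 0)) ?derive_cst//.
near=> y; apply: uM; near: y.
have o : open [set y : RN | M < `|y|].
  apply: (@open_comp _ _ (fun y : RN => `|y|) [set r : R | M < r]); last exact: open_gt.
  by move=> y _; exact: norm_continuous.
exact: open_nbhs_nbhs (conj o Mx).
Unshelve. all: by end_near. Qed.

Lemma test_partial u i : test_fun u -> test_fun (partial i u).
Proof.
by move=> [su [M uM]]; split; [exact: smooth_partial|exists M; exact: partial_far].
Qed.

Lemma test_bounded u : test_fun u -> exists2 B, 0 <= B & forall x, `|u x| <= B.
Proof.
move=> [/smooth_continuous cu [M uM]].
have cK : compact (cube (0 : RN) `|M|).
  apply: bounded_closed_compact.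
    exists `|M|; split; first exact: num_real.
    by move=> K MK x; rewrite /cube/= subr0 => /le_trans; apply; exact: ltW.
  rewrite (_ : cube 0 _ = (fun y : RN => `|y|) @^-1` [set r : R | r <= `|M|]); last first.
    by apply/seteqP; split => x; rewrite /cube/= subr0.
  apply: closed_comp; last exact: closed_le.
  by move=> y _; exact: norm_continuous.
have : compact (u @` cube (0 : RN) `|M|).
  by apply: continuous_compact => //; exact: continuous_subspaceT.
move=> /compact_bounded[B [_ uB]].
exists (`|B| + 1); first by rewrite addr_ge0.
move=> x; have [xM|Mx] := leP `|x| `|M|.
  apply: (uB (`|B| + 1)); first by rewrite (le_lt_trans (ler_norm _))// ltrDl.
  by exists x => //; rewrite /cube/= subr0.
by rewrite uM ?normr0 ?addr_ge0// (le_lt_trans (ler_norm _)).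
Qed.

End smooth_functions.

(** * Convolution with a test function *)

Section lipschitz.
Context {R : realType} {N : nat}.
Local Notation RN := 'rV[R]_N.
Local Notation e_ i := (delta_mx ord0 i : RN).

Lemma is_derive_line (u : RN -> R) i (x : RN) (t : R) :
  (forall x, derivable u x (e_ i)) ->
  is_derive t 1 (fun t : R => u (t *: e_ i + x)) (partial i u (t *: e_ i + x)).
Proof.
move=> du; have /is_derive_cvgP H := derivableP (du (t *: e_ i + x)).
apply/is_derive_cvgP; apply: cvg_trans H; apply: near_eq_cvg; near=> h.
have -> : h *: (1 : R) = h by exact: mulr1.
by rewrite scalerDl addrA.
Unshelve. all: by end_near. Qed.

(** The mean value theorem along a coordinate line; h may be negative. *)
Lemma mvt_line (u : RN -> R) i (x : RN) (h : R) :
  (forall x, derivable u x (e_ i)) ->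
  exists2 t, `|t| <= `|h| & u (h *: e_ i + x) - u x = h * partial i u (t *: e_ i + x).
Proof.
move=> du; pose F t := u (t *: e_ i + x).
have dF (t : R) : is_derive t 1 F (partial i u (t *: e_ i + x)) by exact: is_derive_line.
have cF a b : {within `[a, b], continuous F}.
  apply: continuous_subspaceT => t.
  by apply/differentiable_continuous/derivable1_diffP; case: (dF t).
have F0 : F 0 = u x by rewrite /F scale0r add0r.
have [h0|h0] := leP 0 h.
  have [c] := MVT_segment h0 (fun t _ => dF t) (cF 0 h).
  rewrite in_itv/= => /andP[c0 ch]; rewrite F0 subr0 => E.
  by exists c; [rewrite !ger0_norm|rewrite mulrC].
have [c] := MVT_segment (ltW h0) (fun t _ => dF t) (cF h 0).
rewrite in_itv/= => /andP[hc c0]; rewrite F0 sub0r => E.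
exists c; first by rewrite !ler0_norm ?lerN2// ltW.
by rewrite -opprB E mulrN opprK mulrC.
Qed.

Lemma norm_delta (i : 'I_N) : `|e_ i| <= 1.
Proof.
apply/rV_norm_leP => // j; rewrite mxE eqxx/=.
by case: (j == i); rewrite ?normr1 ?normr0.
Qed.

(** The points z k, whose first k coordinates are those of x and the others
    those of y, lead from y to x one coordinate at a time. *)
Lemma lipschitz_of_partial (u : RN -> R) (B : R) :
  (forall i x, derivable u x (e_ i)) -> (forall i x, `|partial i u x| <= B) ->
  forall x y, `|u x - u y| <= N%:R * B * `|x - y|.
Proof.
move=> du uB x y.
pose z (k : nat) : RN := \row_j (if (j < k)%N then x ord0 j else y ord0 j).
have z0 : z 0%N = y by apply/rowP => j; rewrite mxE.
have zN : z N = x by apply/rowP => j; rewrite mxE ltn_ord.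
have zS (k : 'I_N) : z k.+1 = (x - y) ord0 k *: e_ k + z k.
  apply/rowP => j; rewrite !mxE eqxx/=; have [->|jk] := eqVneq j k.
    by rewrite ltnS leqnn ltnn mulr1 subrK.
  by rewrite mulr0 add0r ltnS leq_eqVlt -val_eqE/= in jk *; rewrite (negbTE jk).
have -> : u x - u y = \sum_(k < N) (u (z k.+1) - u (z k)).
  by rewrite -(big_mkord xpredT (fun k => u (z k.+1) - u (z k))) telescope_sumr// zN z0.
apply: le_trans (ler_norm_sum _ _ _) _.
rewrite -mulrA mulr_natl -[X in _ *+ X]card_ord -sumr_const; apply: ler_sum => k _.
rewrite [z k.+1]zS; have [t _ ->] := mvt_line (z k) ((x - y) ord0 k) (du k).
by rewrite normrM mulrC ler_pM// norm_coord.
Qed.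

Lemma test_lipschitz (u : RN -> R) : test_fun u ->
  exists2 L, 0 <= L & forall x y, `|u x - u y| <= L * `|x - y|.
Proof.
move=> tu; have /choice[B HB] : forall i, exists B, 0 <= B /\ forall x, `|partial i u x| <= B.
  by move=> i; have [B B0 HB] := test_bounded (test_partial i tu); exists B.
pose C := \sum_i B i.
have BC i : B i <= C by rewrite /C (bigD1 i)//= lerDl sumr_ge0// => j _; case: (HB j).
exists (N%:R * C).
  by rewrite mulr_ge0// sumr_ge0// => i _; case: (HB i).
apply: lipschitz_of_partial => [i x|i x]; first exact: smooth_derivable (proj1 tu).
by apply: le_trans (BC i); case: (HB i).
Qed.

(** The partial derivative is itself a test function, hence Lipschitz. *)
Lemma test_taylor (u : RN -> R) i : test_fun u ->
  exists L, forall x h, `|u (h *: e_ i + x) - u x - h * partial i u x| <= L * h ^+ 2.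
Proof.
move=> tu; have [L L0 HL] := test_lipschitz (test_partial i tu).
exists L => x h.
have [t th ->] := @mvt_line u i x h (fun x => smooth_derivable (proj1 tu)).
rewrite -mulrBr normrM -(real_normK (num_real h)) expr2 mulrCA ler_wpM2l//.
apply: le_trans (HL _ _) _; rewrite addrK ler_wpM2l//.
by rewrite normrZ (le_trans _ th)// ler_piMr// norm_delta.
Qed.

End lipschitz.

Section convolution.
Context {R : realType} {N : nat}.
Local Notation RN := 'rV[R]_N.
Local Notation mu := (@lebesgue_rV R N).
Local Notation e_ i := (delta_mx ord0 i : RN).

Definition conv (g u : RN -> R) (x : RN) : R := \int[mu]_y (g (x - y) * u y).

Lemma integrable_scale (c : R) (f : RN -> R) : mu.-integrable setT (EFin \o f) ->
  mu.-integrable setT (EFin \o (fun y => c * f y)).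
Proof. by move=> fi; have := integrableZl measurableT c fi. Qed.

Lemma integrable_sub (f g : RN -> R) : mu.-integrable setT (EFin \o f) ->
  mu.-integrable setT (EFin \o g) -> mu.-integrable setT (EFin \o (fun y => f y - g y)).
Proof. by move=> fi gi; have := integrableB measurableT fi gi. Qed.

Lemma integrable_normr (f : RN -> R) : mu.-integrable setT (EFin \o f) ->
  mu.-integrable setT (EFin \o (fun y => `|f y|)).
Proof. by move=> fi; exact: integrable_norm. Qed.

Variable u : RN -> R.
Hypothesis iu : mu.-integrable setT (EFin \o u).

Let mu_ : measurable_fun setT u.
Proof. by apply/measurable_EFinP; exact: measurable_int iu. Qed.

Lemma measurable_subl (g : RN -> R) x : measurable_fun setT g ->
  measurable_fun setT (fun y : RN => g (x - y)).
Proof.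
move=> mg; rewrite (_ : (fun _ => _) = (fun y => g (y + x)) \o (fun y : RN => - y)).
  by apply: measurableT_comp; [exact: measurable_comp_addr|exact: measurable_opp_rV].
by apply/funext => y /=; rewrite addrC.
Qed.

Lemma integrable_bounded_mul (G : RN -> R) C : measurable_fun setT G ->
  (forall y, `|G y| <= C) -> mu.-integrable setT (EFin \o (fun y => G y * u y)).
Proof.
move=> mG GC; have C0 : 0 <= C by apply: le_trans (GC 0).
have iCu : mu.-integrable setT (EFin \o (fun y => C * u y)) := integrable_scale C iu.
apply: le_integrable iCu => //.
  by apply/measurable_EFinP; exact: measurable_funM.
by move=> y _; rewrite lee_fin !normrM ler_wpM2r// (ger0_norm C0).
Qed.

Lemma Rintegral_bounded_mul (G : RN -> R) C : measurable_fun setT G ->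
  (forall y, `|G y| <= C) ->
  `|\int[mu]_y (G y * u y)| <= C * \int[mu]_y `|u y|.
Proof.
move=> mG GC; have iG := integrable_bounded_mul mG GC.
apply: le_trans (le_normr_Rintegral measurableT iG) _.
rewrite -RintegralZl//; last exact: integrable_normr.
apply: le_Rintegral => //.
- exact: integrable_normr.
- by apply: integrable_scale; exact: integrable_normr.
- by move=> y _; rewrite normrM ler_wpM2r.
Qed.

Lemma test_measurable (g : RN -> R) : test_fun g -> measurable_fun setT g.
Proof. by move=> [/smooth_continuous cg _]; exact: continuous_rV_measurable. Qed.

Let integrable_conv g x : test_fun g ->
  mu.-integrable setT (EFin \o (fun y => g (x - y) * u y)).
Proof.
move=> tg; have [B _ gB] := test_bounded tg.
apply: (@integrable_bounded_mul (fun y => g (x - y)) B) => //.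
by apply: measurable_subl; exact: test_measurable.
Qed.

Lemma conv_lipschitz g : test_fun g ->
  exists2 L, 0 <= L & forall x y, `|conv g u x - conv g u y| <= L * `|x - y|.
Proof.
move=> tg; have [L L0 HL] := test_lipschitz tg.
exists (L * \int[mu]_y `|u y|); first by rewrite mulr_ge0// Rintegral_ge0.
move=> x y; rewrite /conv -RintegralB//; try exact: integrable_conv.
rewrite (_ : \int[mu]_y0 _ = \int[mu]_z ((g (x - z) - g (y - z)) * u z)); last first.
  by apply: eq_Rintegral => z _; rewrite mulrBl.
rewrite mulrAC; apply: Rintegral_bounded_mul.
  by apply: measurable_funB; apply: measurable_subl; exact: test_measurable.
by move=> z; apply: le_trans (HL _ _) _; rewrite opprB addrA subrK.
Qed.

Lemma lipschitz_continuous (f : RN -> R) L : 0 <= L ->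
  (forall x y, `|f x - f y| <= L * `|x - y|) -> continuous f.
Proof.
move=> L0 HL x.
apply/(@cvgrPdist_lt _ _ _ (nbhs x) (nbhs_filter x)) => e e0.
apply/nbhs_ballP; exists (e / (L + 1)) => /=; first by rewrite divr_gt0// ltr_pwDr.
move=> y; rewrite -ball_normE/= ltr_pdivlMr ?ltr_pwDr// => h.
apply: le_lt_trans (HL _ _) _; apply: le_lt_trans h.
by rewrite mulrC ler_wpM2l// lerDl.
Qed.

(** The quadratic Taylor estimate of g is uniform in the base point, and so can
    be integrated against u: the derivative passes under the integral sign
    without any limit of integrals. *)
Lemma is_derive_conv g i x : test_fun g ->
  is_derive x (e_ i) (conv g u) (conv (partial i g) u x).
Proof.
move=> tg; have [L HL] := test_taylor i tg; have tpg := test_partial i tg.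
apply: (@is_derive_quadratic _ _ _ _ _ _ (L * \int[mu]_y `|u y|)) => h.
rewrite /conv -RintegralB//; try exact: integrable_conv.
rewrite -[h * _]RintegralZl//; last exact: integrable_conv.
rewrite -RintegralB//; last 2 first.
- by apply: integrable_sub; exact: integrable_conv.
- by apply: integrable_scale; exact: integrable_conv.
rewrite mulrAC (_ : \int[mu]_x0 _ = \int[mu]_z
   ((g (h *: e_ i + (x - z)) - g (x - z) - h * partial i g (x - z)) * u z)); last first.
  by apply: eq_Rintegral => z _; rewrite !mulrBl mulrA addrA.
apply: Rintegral_bounded_mul.
  have m1 := test_measurable tg; have m2 := test_measurable tpg.
  apply: measurable_funB; [apply: measurable_funB|apply: measurable_funM => //]; last 2 first.
  - exact: measurable_subl.
  - exact: measurable_subl.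
  rewrite (_ : (fun _ => _) = fun z => g ((h *: e_ i + x) - z)); first exact: measurable_subl.
  by apply/funext => z; rewrite addrA.
by move=> z; exact: HL.
Qed.

Lemma conv_smooth g : test_fun g -> smooth (conv g u).
Proof.
move=> tg; have tl l : test_fun (iter_partial l g).
  by elim: l => //= i l; exact: test_partial.
have E l : iter_partial l (conv g u) = conv (iter_partial l g) u.
  elim: l => //= i l ->; apply/funext => x.
  by case: (is_derive_conv i x (tl l)).
move=> l; rewrite E; split.
  by have [L L0] := conv_lipschitz (tl l); exact: lipschitz_continuous.
by move=> i x; case: (is_derive_conv i x (tl l)).
Qed.

End convolution.

(** * Mollifiers *)

Section bump.
Context {R : realType} {N : nat}.
Local Notation RN := 'rV[R]_N.
Local Notation mu := (@lebesgue_rV R N).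

Let bump (d : R) (x : RN) : R :=
  \prod_(j < N) (flat 1 (d + 1 * x ord0 j) * flat 1 (d + (- 1) * x ord0 j)).

Let flat1_ge0 (t : R) : 0 <= flat 1 t.
Proof. by rewrite /flat; case: ifPn => // _; rewrite hornerC mul1r expR_ge0. Qed.

Let flat1_mono (t t' : R) : 0 < t -> t <= t' -> flat 1 t <= flat 1 t'.
Proof.
move=> t0 tt'; have t'0 := lt_le_trans t0 tt'.
by rewrite /flat t0 t'0 !hornerC !mul1r ler_expR lerN2 lef_pV2.
Qed.

Let bump_support d x : 0 < d -> d < `|x| -> bump d x = 0.
Proof.
move=> d0 dx; have [|] := pselect (exists j, d < `|x ord0 j|).
  move=> [j dj]; rewrite /bump (bigD1 j)//=.
  move: dj; rewrite ltr_normr => /orP[dj|dj].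
    by rewrite [X in _ * X * _]flat_le0 ?mulr0 ?mul0r//; lra.
  by rewrite [X in X * _ * _]flat_le0 ?mul0r//; lra.
move=> nex; move: dx; rewrite ltNge => /negP[].
apply/(rV_norm_leP _ (ltW d0)) => j; rewrite leNgt; apply/negP => dj.
by apply: nex; exists j.
Qed.

Let bump_test d : 0 < d -> test_fun (bump d).
Proof.
move=> d0; split; last by exists d => x; exact: bump_support.
apply: Cn_smooth => n; apply: Cn_prod => j.
by apply: CnM; exact: Cn_flat_coord.
Qed.

Let bump_ge0 d x : 0 <= bump d x.
Proof. by apply: prodr_ge0 => j _; rewrite mulr_ge0. Qed.

Lemma integrable_of_bounded_support (u : RN -> R) (B M : R) : measurable_fun setT u ->
  (forall x, `|u x| <= B) -> (forall x, M < `|x| -> u x = 0) ->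
  mu.-integrable setT (EFin \o u).
Proof.
move=> mu_ uB uM; have B0 : 0 <= B by apply: le_trans (uB 0).
have mc := @measurable_cube R N 0 `|M| (normr_ge0 M).
have ic : mu.-integrable setT (EFin \o (fun x : RN => B * \1_(cube 0 `|M|) x)).
  apply: integrable_scale; apply/integrableP; split.
    by apply/measurable_EFinP; exact: measurable_indic.
  under eq_integral do rewrite /= ger0_norm//.
  rewrite integral_indic// setIT.
  have lc : (lebesgue_rV N (cube (0 : RN) `|M|) < +oo)%E by rewrite lebesgue_cube ?ltry.
  exact: lc.
apply: le_integrable ic => //; first exact/measurable_EFinP.
move=> x _; rewrite lee_fin normrM (ger0_norm B0) indicE.
case: (boolP (x \in _)) => [_|]; first by rewrite normr1 mulr1.
rewrite notin_setE /cube/= subr0 => /negP; rewrite -ltNge => Mx.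
by rewrite uM ?normr0 ?mulr0// (le_lt_trans (ler_norm _)).
Qed.

(** The normalized product over the coordinates of the bumps
    exp(-1/(d + x_j)) exp(-1/(d - x_j)). *)
Lemma exists_mollifier (d : R) : 0 < d -> exists rho : RN -> R,
  [/\ test_fun rho, forall x, 0 <= rho x, forall x, d < `|x| -> rho x = 0,
      forall x, rho (- x) = rho x & (\int[mu]_x (rho x)%:E = 1)%E].
Proof.
move=> d0; have tb := bump_test d0.
have mb := test_measurable tb.
have [B B0 bB] := test_bounded tb.
have ib : mu.-integrable setT (EFin \o bump d).
  by apply: integrable_of_bounded_support mb bB _ => x; exact: bump_support.
set c := \int[mu]_x bump d x.
have cE : (\int[mu]_x (bump d x)%:E = c%:E)%E.
  by rewrite /c /Rintegral fineK// integrable_fin_num.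
have c0 : 0 < c.
  pose m := flat 1 (d / 2) : R.
  have m0 : 0 < m by rewrite /m /flat divr_gt0// hornerC mul1r expR_gt0.
  have mc := @measurable_cube R N 0 (d / 2) (ltW (divr_gt0 d0 (ltr0Sn R 1))).
  rewrite -lte_fin -cE.
  apply: (@lt_le_trans _ _ (\int[mu]_(x in cube (0 : RN) (d / 2)) ((m * m) ^+ N)%:E)%E).
    rewrite integral_cst//.
    rewrite mule_gt0 ?lte_fin ?exprn_gt0 ?mulr_gt0//.
    have lc : (0 < lebesgue_rV N (cube (0 : RN) (d / 2)))%E.
      by rewrite lebesgue_cube ?divr_ge0 ?(ltW d0)// lte_fin exprn_gt0// mulrn_wgt0// divr_gt0.
    exact: lc.
  apply: (@le_trans _ _ (\int[mu]_(x in cube (0 : RN) (d / 2)) (bump d x)%:E)%E).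
    apply: ge0_le_integral => //.
    - by move=> x _; rewrite lee_fin exprn_ge0// mulr_ge0// ltW.
    - by apply/measurable_EFinP; exact: measurable_funTS.
    - move=> x; rewrite /cube/= subr0 => xd; rewrite lee_fin.
      rewrite -[X in _ ^+ X]card_ord -prodr_const; apply: ler_prod => j _.
      have := le_trans (norm_coord x j) xd; rewrite ler_norml => /andP[x1 x2].
      rewrite mulr_ge0 ?(ltW m0)//=.
      by apply: ler_pM; rewrite ?(ltW m0)//; apply: flat1_mono; rewrite ?divr_gt0//; lra.
  apply: ge0_subset_integral => //; first exact/measurable_EFinP.
  by move=> x _; rewrite lee_fin bump_ge0.
exists (fun x => c^-1 * bump d x); split.
- split; last by exists d => x dx; rewrite bump_support ?mulr0.
  apply: Cn_smooth => n; apply: CnM; first exact: Cn_cst.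
  by apply: Cn_prod => j; apply: CnM; exact: Cn_flat_coord.
- by move=> x; rewrite mulr_ge0// invr_ge0 ltW.
- by move=> x dx; rewrite bump_support ?mulr0.
- move=> x; congr (_ * _); apply: eq_bigr => j _.
  by rewrite mxE mulrC !mulN1r !mul1r opprK.
- under eq_integral do rewrite EFinM.
  rewrite ge0_integralZl//; last 3 first.
  + exact/measurable_EFinP.
  + by move=> x _; rewrite lee_fin bump_ge0.
  + by rewrite lee_fin invr_ge0 ltW.
  by rewrite cE -EFinM mulVf// gt_eqF.
Qed.

End bump.

Section mollify.
Context {R : realType} {N : nat} (s : R).
Local Notation RN := 'rV[R]_N.
Local Notation mu := (@lebesgue_rV R N).
Local Notation kern := (@fractional_kernel R N s).
Local Notation gagliardo := (@gagliardo R N s).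

Variables (u rho : RN -> R) (B M d : R).
Hypotheses (mu_ : measurable_fun setT u) (u0 : forall x, 0 <= u x)
  (uB : forall x, `|u x| <= B) (uM : forall x, M < `|x| -> u x = 0).
Hypotheses (trho : test_fun rho) (rho0 : forall x, 0 <= rho x)
  (rhod : forall x, d < `|x| -> rho x = 0) (rhoN : forall x, rho (- x) = rho x)
  (rho1 : (\int[mu]_x (rho x)%:E = 1)%E).

Let mrho : measurable_fun setT rho := test_measurable trho.
Let iu : mu.-integrable setT (EFin \o u) := integrable_of_bounded_support mu_ uB uM.

Let irho x : mu.-integrable setT (EFin \o (fun z => rho z * u (z + x))).
Proof.
have [C C0 rhoC] := test_bounded trho.
apply: (@integrable_of_bounded_support _ _ _ (C * B) d).
- by apply: measurable_funM => //; exact: measurable_comp_addr.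
- by move=> z; rewrite normrM ler_pM.
- by move=> z dz; rewrite rhod ?mul0r.
Qed.

(** Written as an average of translates of u, the convolution inherits every
    translation invariant estimate; this uses that rho is even. *)
Lemma conv_shiftE x : conv rho u x = \int[mu]_z (rho z * u (z + x)).
Proof.
rewrite /conv /Rintegral; congr fine.
transitivity (\int[mu]_z ((rho (x - (z + x)) * u (z + x))%:E))%E; last first.
  by apply: eq_integral => z _; rewrite opprD addrCA subrr addr0 rhoN.
apply/esym; apply: (@integral_shift R N x (fun y => (rho (x - y) * u y)%:E)).
apply/measurable_EFinP; apply: measurable_funM => //.
exact: measurable_subl.
Qed.

Lemma conv_shiftEe x :
  ((conv rho u x)%:E = \int[mu]_z (rho z * u (z + x))%:E)%E.
Proof.
rewrite conv_shiftE /Rintegral fineK//.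
exact: integrable_fin_num (irho x).
Qed.

Let m12 : measurable_fun setT (fun p : RN * RN => rho p.1 * u (p.1 + p.2)).
Proof.
apply: measurable_funM; first exact: (measurableT_comp mrho measurable_fst).
exact: (measurableT_comp mu_ (@measurable_add_rV R N)).
Qed.

Lemma integral_conv : (\int[mu]_x (conv rho u x)%:E = \int[mu]_x (u x)%:E)%E.
Proof.
under eq_integral do rewrite conv_shiftEe.
rewrite -(@fubini_tonelli _ _ RN RN R mu mu (fun p => (rho p.1 * u (p.1 + p.2))%:E))//=; last 2 first.
- exact/measurable_EFinP.
- by move=> p; rewrite lee_fin mulr_ge0.
have mue : measurable_fun setT (fun x => (u x)%:E) by exact/measurable_EFinP.
transitivity (\int[mu]_z ((rho z)%:E * \int[mu]_x (u x)%:E))%E.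
  apply: eq_integral => z _; under eq_integral do rewrite EFinM addrC.
  rewrite ge0_integralZl//; last 3 first.
  - by apply/measurable_EFinP; exact: measurable_comp_addr.
  - by move=> x _; rewrite lee_fin.
  - by rewrite lee_fin.
  congr (_ * _)%E.
  by apply: (@ge0_integral_shift R N z (fun x => (u x)%:E)) => // x; rewrite lee_fin.
rewrite ge0_integralZr//; last 3 first.
- exact/measurable_EFinP.
- by move=> x _; rewrite lee_fin.
- by apply: integral_ge0 => x _; rewrite lee_fin.
by rewrite rho1 mul1e.
Qed.

(** The seminorm is convex and translation invariant, hence does not increase
    under averages of translates. *)
Lemma gagliardo_conv : (gagliardo (conv rho u) <= gagliardo u)%E.
Proof.
have mw : measurable_fun setT (conv rho u).
  exact: continuous_rV_measurable (smooth_continuous (conv_smooth iu trho)).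
pose F (z y x : RN) := (rho z * (`|u (x + z) - u (y + z)| * kern x y))%:E.
have F0 z y x : (0 <= F z y x)%E by rewrite lee_fin !mulr_ge0// kern_ge0.
have mF : measurable_fun setT (fun p : RN * RN * RN => F p.1.1 p.1.2 p.2).
  pose T3 := (RN * RN * RN)%type.
  have m1 : measurable_fun setT (fun p : T3 => p.1.1).
    exact: (measurableT_comp measurable_fst measurable_fst).
  have m2 : measurable_fun setT (fun p : T3 => p.1.2).
    exact: (measurableT_comp measurable_snd measurable_fst).
  have m3 : measurable_fun setT (fun p : T3 => p.2) by exact: measurable_snd.
  have m31 : measurable_fun setT (fun p : T3 => (p.2, p.1.1)).
    by apply/measurable_fun_pairP; split.
  have m21 : measurable_fun setT (fun p : T3 => (p.1.2, p.1.1)).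
    by apply/measurable_fun_pairP; split.
  have m32 : measurable_fun setT (fun p : T3 => (p.2, p.1.2)).
    by apply/measurable_fun_pairP; split.
  apply/measurable_EFinP; apply: measurable_funM.
    exact: (measurableT_comp mrho m1).
  apply: measurable_funM; last exact: (measurableT_comp (@measurable_kern R N s) m32).
  apply: (measurableT_comp (@normr_measurable R setT)); apply: measurable_funB.
    exact: (measurableT_comp mu_ (measurableT_comp (@measurable_add_rV R N) m31)).
  exact: (measurableT_comp mu_ (measurableT_comp (@measurable_add_rV R N) m21)).
have mF' : measurable_fun setT (fun p : RN * RN * RN => F p.2 p.1.1 p.1.2).
  have m : measurable_fun setT (fun p : RN * RN * RN => ((p.2, p.1.1), p.1.2)).
    apply/measurable_fun_pairP; split.
      apply/measurable_fun_pairP; split; first exact: measurable_snd.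
      exact: (measurableT_comp measurable_fst measurable_fst).
    exact: (measurableT_comp measurable_snd measurable_fst).
  exact: (measurableT_comp mF m).
have mFz : measurable_fun setT (fun p : RN * RN => \int[mu]_z F z p.1 p.2)%E.
  by apply: (@measurable_fun_fubini_tonelli_F _ _ _ RN R mu _ mF') => p; exact: F0.
have mFxz : measurable_fun setT (fun y : RN => \int[mu]_x \int[mu]_z F z y x)%E.
  apply: (@measurable_fun_fubini_tonelli_F _ _ _ RN R mu _ mFz) => p.
  by apply: integral_ge0 => z _; exact: F0.
have mFy y : measurable_fun setT (fun x : RN => \int[mu]_z F z y x)%E.
  have m2 : measurable_fun setT (fun x : RN => (y, x)).
    by apply/measurable_fun_pairP; split; [exact: measurable_cst|exact: measurable_id].
  exact: (measurableT_comp mFz m2).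
have pw x y : ((`|conv rho u x - conv rho u y| * kern x y)%:E <= \int[mu]_z F z y x)%E.
  have iB : mu.-integrable setT (EFin \o (fun z => rho z * u (z + x) - rho z * u (z + y))).
    by apply: integrable_sub; exact: irho.
  have mG : measurable_fun setT (fun z => (rho z * `|u (x + z) - u (y + z)|)%:E).
    have [m _] : measurable_fun setT (fun z => rho z * u (z + x) - rho z * u (z + y)) /\ True.
      by split=> //; apply/measurable_EFinP; exact: measurable_int iB.
    rewrite (_ : (fun _ => _) = (fun z => `|rho z * u (z + x) - rho z * u (z + y)|%:E)).
      by apply/measurable_EFinP; exact: (measurableT_comp (@normr_measurable R setT) m).
    apply/funext => z; rewrite -mulrBr normrM (ger0_norm (rho0 z)).
    by rewrite (addrC z x) (addrC z y).
  have h : ((`|conv rho u x - conv rho u y|)%:E <=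
      \int[mu]_z (rho z * `|u (x + z) - u (y + z)|)%:E)%E.
    rewrite !conv_shiftE -RintegralB//.
    apply: (@le_trans _ _ (\int[mu]_z `|rho z * u (z + x) - rho z * u (z + y)|)%R%:E).
      by rewrite lee_fin; exact: le_normr_Rintegral.
    rewrite /Rintegral fineK; last first.
      by apply: integrable_fin_num => //; exact: integrable_normr.
    rewrite le_eqVlt; apply/orP; left; apply/eqP; apply: eq_integral => z _; congr EFin.
    rewrite -mulrBr normrM (ger0_norm (rho0 z)).
    by rewrite (addrC z x) (addrC z y).
  rewrite EFinM muleC.
  apply: (@le_trans _ _ ((kern x y)%:E * \int[mu]_z (rho z * `|u (x + z)%R - u (y + z)%R|)%:E)%E).
    by rewrite lee_wpmul2l// lee_fin kern_ge0.
  rewrite -ge0_integralZl//; last 2 first.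
  - by move=> z _; rewrite lee_fin mulr_ge0.
  - by rewrite lee_fin kern_ge0.
  rewrite le_eqVlt; apply/orP; left; apply/eqP; apply: eq_integral => z _; rewrite /F -EFinM; congr EFin; ring.
have inner z : (\int[mu]_y \int[mu]_x F z y x = (rho z)%:E * gagliardo u)%E.
  have muz : measurable_fun setT (fun x : RN => u (x + z)) by exact: measurable_comp_addr.
  rewrite -(gagliardo_shift s z mu_) -ge0_integralZl//; last 3 first.
  - exact: measurable_gagliardo_inner.
  - by move=> y _; apply: integral_ge0 => x _; exact: (gagliardo_fun_ge0 s (fun x => u (x + z))%R).
  - by rewrite lee_fin.
  apply: eq_integral => y _; rewrite -ge0_integralZl//; last 3 first.
  - exact: (measurable_gagliardo_section s y muz).
  - by move=> x _; exact: (gagliardo_fun_ge0 s (fun x => u (x + z))%R).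
  - by rewrite lee_fin.
clearbody F.
apply: (@le_trans _ _ (\int[mu]_y \int[mu]_x \int[mu]_z F z y x)%E).
  apply: ge0_le_integral => //.
  - by move=> y _; apply: integral_ge0 => x _; exact: gagliardo_fun_ge0.
  - exact: measurable_gagliardo_inner.
  - move=> y _; apply: ge0_le_integral => //.
    + by move=> x _; exact: gagliardo_fun_ge0.
    + exact: measurable_gagliardo_section.
rewrite -(@tonelli3 R _ _ _ RN RN RN mu mu mu F mF F0).
under eq_integral do rewrite inner.
rewrite ge0_integralZr//; last 3 first.
- exact/measurable_EFinP.
- by move=> x _; rewrite lee_fin.
- exact: gagliardo_ge0.
by rewrite rho1 mul1e.
Qed.

End mollify.

(** * Test functions: approximation and finite seminorm *)

Section approximation.
Context {R : realType} {N : nat} (s : R).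
Local Notation RN := 'rV[R]_N.
Local Notation mu := (@lebesgue_rV R N).
Local Notation kern := (@fractional_kernel R N s).
Local Notation gagliardo := (@gagliardo R N s).

Lemma bounded_cubeP (A : set RN) : bounded_set A -> exists M, A `<=` cube 0 M.
Proof.
move=> [M [_ AM]]; exists (M + 1) => x Ax; rewrite /cube/= subr0.
by apply: AM Ax; rewrite ltrDl.
Qed.

Lemma cube_bounded (A : set RN) M : A `<=` cube 0 M -> bounded_set A.
Proof.
move=> AM; exists M; split; first exact: num_real.
by move=> K MK x /AM; rewrite /cube/= subr0 => /le_trans; apply; exact: ltW.
Qed.

Lemma closed_cube (y : RN) r : closed (cube y r).
Proof.
rewrite (_ : cube y r = (fun x : RN => `|x - y|) @^-1` [set t : R | t <= r]) //.
apply: closed_comp; last exact: closed_le.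
by move=> x _; apply: continuous_comp; [apply: continuousB; [exact: cvg_id|exact: cst_continuous]|exact: norm_continuous].
Qed.

Lemma Ccinfty_test (Omega : set RN) u : Ccinfty Omega u -> test_fun u.
Proof.
move=> [su cu _]; split => //.
have [M HM] := bounded_cubeP (compact_bounded cu).
exists M => x Mx; apply/eqP/negPn/negP => ux.
have := HM x (@subset_closure _ [set x | u x != 0] x ux).
by rewrite /cube/= subr0 leNgt Mx.
Qed.

Lemma Ccinfty_supp (Omega : set RN) u x : Ccinfty Omega u -> u x != 0 -> Omega x.
Proof. by move=> [_ _ uO] ux; apply: uO; exact: (@subset_closure _ [set x | u x != 0] x ux). Qed.

Lemma test_Ccinfty (Omega : set RN) u : test_fun u ->
  closure [set x | u x != 0] `<=` Omega -> Ccinfty Omega u.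
Proof.
move=> [su [M uM]] uO; split => //.
apply: bounded_closed_compact; last exact: closed_closure.
apply: (@cube_bounded _ M).
rewrite [X in _ `<=` X](proj1 (closure_id _) (@closed_cube 0 M)); apply: closureS.
move=> x /= ux; rewrite /cube/= subr0 leNgt; apply/negP => /uM ux0.
by rewrite ux0 eqxx in ux.
Qed.

Lemma integral_supp (Omega : set RN) (u : RN -> R) : measurable Omega ->
  measurable_fun setT u -> (forall x, u x != 0 -> Omega x) ->
  (\int[mu]_(x in Omega) (u x)%:E = \int[mu]_x (u x)%:E)%E.
Proof.
move=> mO mu_ uO; rewrite [LHS]integral_mkcond; apply: eq_integral => x _.
rewrite patchE; case: ifPn => //; rewrite notin_setE => nO.
by have [->//|/uO] := eqVneq (u x) 0.
Qed.

(** A function whose support keeps a distance d from the complement of Omega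
    becomes a test function by mollification at scale d / 2, without changing
    its integral or increasing its seminorm. *)
Lemma exists_Ccinfty_approx (Omega : set RN) (u : RN -> R) (B M d : R) :
  measurable Omega ->
  measurable_fun setT u -> (forall x, 0 <= u x) -> (forall x, `|u x| <= B) ->
  (forall x, M < `|x| -> u x = 0) -> 0 < d ->
  (forall x z, u x != 0 -> `|x - z| <= d -> Omega z) ->
  exists w, [/\ Ccinfty Omega w,
    (\int[mu]_(x in Omega) (w x)%:E = \int[mu]_x (u x)%:E)%E &
    (gagliardo w <= gagliardo u)%E].
Proof.
move=> mO mu_ u0 uB uM d0 uO.
have [rho [trho rho0 rhod rhoN rho1]] := @exists_mollifier R N (d / 2) (divr_gt0 d0 (ltr0Sn R 1)).
have iu := integrable_of_bounded_support mu_ uB uM.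
set w := conv rho u.
have wsupp x : w x != 0 -> exists2 y, u y != 0 & `|x - y| <= d / 2.
  move=> wx; apply: contrapT => nex; move/eqP: wx; apply.
  rewrite /w /conv (_ : \int[mu]_y _ = \int[mu]_(y in setT) (0 : R)).
    by rewrite Rintegral_cst// mul0r.
  apply: eq_Rintegral => y _.
  have [->|uy] := eqVneq (u y) 0; first by rewrite mulr0.
  rewrite rhod ?mul0r// ltNge; apply/negP => xy.
  by apply: nex; exists y.
have Cw : Ccinfty Omega w.
  apply: test_Ccinfty.
    split; first exact: conv_smooth.
    exists (M + d / 2) => x Mx; apply/eqP/negPn/negP => /wsupp[y uy xy].
    have yM : `|y| <= M by rewrite leNgt; apply/negP => /uM uy0; rewrite uy0 eqxx in uy.
    have := ler_normD y (x - y); rewrite addrC subrK; lra.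
  move=> x clx.
  have [z [/= wz]] := clx _ (nbhsx_ballx x (d / 2) (divr_gt0 d0 (ltr0Sn R 1))).
  rewrite -ball_normE/= => /ltW xz; have [y uy zy] := wsupp z wz.
  apply: (uO y x uy).
  have := ler_normD (y - z) (z - x); rewrite addrA subrK (distrC y z) (distrC z x); lra.
exists w; split => //.
  rewrite integral_supp//.
  - exact: (integral_conv mu_ u0 uB trho rho0 rhod rhoN rho1).
  - exact: test_measurable (Ccinfty_test Cw).
  - by move=> x; exact: Ccinfty_supp Cw.
exact: (gagliardo_conv s mu_ uB uM trho rho0 rhod rhoN rho1).
Qed.

End approximation.

Section finiteness.
Context {R : realType} {N : nat} (s : R).
Hypotheses (N_gt0 : (0 < N)%N) (s_gt0 : 0 < s) (s_lt1 : s < 1).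
Local Notation RN := 'rV[R]_N.
Local Notation mu := (@lebesgue_rV R N).
Local Notation kern := (@fractional_kernel R N s).
Local Notation gagliardo := (@gagliardo R N s).

Lemma measurable_min_kern : measurable_fun setT
  (fun p : RN * RN => Num.min 1 `|p.1 - p.2| * kern p.1 p.2).
Proof.
apply: measurable_funM; last exact: measurable_kern.
apply: measurable_minr => //.
have m : measurable_fun setT (fun p : RN * RN => p.1 - p.2).
  apply: measurable_fun_rV => i.
  rewrite (_ : (fun _ => _) = (fun p : RN * RN => p.1 ord0 i - p.2 ord0 i)); last first.
    by apply/funext => p; rewrite !mxE.
  apply: measurable_funB.
    exact: (measurableT_comp (measurable_coord i) measurable_fst).
  exact: (measurableT_comp (measurable_coord i) measurable_snd).
apply: (measurableT_comp _ m).
by apply: continuous_rV_measurable; exact: norm_continuous.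
Qed.

Lemma min_kern_ge0 (x y : RN) : 0 <= Num.min 1 `|x - y| * kern x y.
Proof. by rewrite mulr_ge0 ?kern_ge0// le_min ler01 normr_ge0. Qed.

(** The kernel bound, integrated against a weight depending on one of the two
    variables. *)
Lemma min_kern_weight : exists2 kappa : R, 0 <= kappa &
  forall f : RN -> R, measurable_fun setT f -> (forall x, 0 <= f x) ->
  (\int[mu]_y \int[mu]_x (Num.min 1 `|x - y| * kern x y * f y)%:E
     <= kappa%:E * \int[mu]_y (f y)%:E)%E /\
  (\int[mu]_y \int[mu]_x (Num.min 1 `|x - y| * kern x y * f x)%:E
     <= kappa%:E * \int[mu]_y (f y)%:E)%E.
Proof.
have [kappa k0 Hk] := @kern_min_bound R N s s_gt0 s_lt1.
exists kappa => // f mf f0.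
have mF1 : measurable_fun setT (fun p : RN * RN =>
    Num.min 1 `|p.1 - p.2| * kern p.1 p.2 * f p.2).
  apply: measurable_funM; first exact: measurable_min_kern.
  exact: (measurableT_comp mf measurable_snd).
have mK (y : RN) : measurable_fun setT (fun x : RN => (Num.min 1 `|x - y| * kern x y)%:E).
  have m2 : measurable_fun setT (fun x : RN => (x, y)).
    by apply/measurable_fun_pairP; split; [exact: measurable_id|exact: measurable_cst].
  apply/measurable_EFinP; exact: (measurableT_comp measurable_min_kern m2).
have first : (\int[mu]_y \int[mu]_x (Num.min 1 `|x - y| * kern x y * f y)%:E
     <= kappa%:E * \int[mu]_y (f y)%:E)%E.
  rewrite -ge0_integralZl//; last 2 first.
  - exact/measurable_EFinP.
  - by move=> y _; rewrite lee_fin.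
  apply: ge0_le_integral => //.
  - by move=> y _; apply: integral_ge0 => x _; rewrite lee_fin mulr_ge0// min_kern_ge0.
  - apply: (@measurable_inner R N (fun x y => Num.min 1 `|x - y| * kern x y * f y) mF1).
    by move=> x y; rewrite mulr_ge0// min_kern_ge0.
  - by apply: measurable_funeM; exact/measurable_EFinP.
  - move=> y _; under eq_integral do rewrite EFinM muleC.
    rewrite ge0_integralZl//; last 2 first.
    + by move=> x _; rewrite lee_fin min_kern_ge0.
    + by rewrite lee_fin.
    by rewrite muleC lee_wpmul2r// lee_fin.
split; first exact: first.
suff E : (\int[mu]_y \int[mu]_x (Num.min 1 `|x - y| * kern x y * f x)%:E =
    \int[mu]_y \int[mu]_x (Num.min 1 `|x - y| * kern x y * f y)%:E)%E.
  by rewrite E.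
transitivity (\int[mu]_x \int[mu]_y (Num.min 1 `|x - y| * kern x y * f x)%:E)%E.
  apply: (@tonelli2 R _ _ RN RN mu mu (fun y x => (Num.min 1 `|x - y| * kern x y * f x)%:E)).
    apply/measurable_EFinP.
    have m2 : measurable_fun setT (fun p : RN * RN => (p.2, p.1)).
      by apply/measurable_fun_pairP; split; [exact: measurable_snd|exact: measurable_fst].
    apply: measurable_funM; first exact: (measurableT_comp measurable_min_kern m2).
    exact: (measurableT_comp mf measurable_snd).
  by move=> y x; rewrite lee_fin mulr_ge0// min_kern_ge0.
apply: eq_integral => y _; apply: eq_integral => x _.
by rewrite distrC kern_sym.
Qed.

(** The increment |u x - u y| is at most a multiple of min(1, |x - y|), by the
    Lipschitz bound and the sup bound, and it vanishes unless x or y is in the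
    support of u. *)
Lemma gagliardo_test_lty (u : RN -> R) : test_fun u -> (gagliardo u < +oo)%E.
Proof.
move=> tu; have [L L0 uL] := test_lipschitz tu; have [B B0 uB] := test_bounded tu.
have [_ [M uM]] := tu; have mu_ := test_measurable tu.
have [kappa k0 Hk] := min_kern_weight.
pose Q := cube (0 : RN) `|M|.
have mQ : measurable Q by exact: measurable_cube.
pose C := L + 2 * B.
pose f x : R := C * \1_Q x.
have mf : measurable_fun setT f by apply: measurable_funM => //; exact: measurable_indic.
have f0 x : 0 <= f x by rewrite mulr_ge0// addr_ge0// mulr_ge0.
have [H1 H2] := Hk f mf f0.
have pw (x y : RN) : `|u x - u y| * kern x y <=
    Num.min 1 `|x - y| * kern x y * f y + Num.min 1 `|x - y| * kern x y * f x.
  rewrite -mulrDr mulrAC ler_wpM2r ?kern_ge0//.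
  have uQ z : u z != 0 -> f z = C.
    move=> uz; rewrite /f indicE mem_set ?mulr1// /Q /cube/= subr0 leNgt.
    by apply/negP => h; move: uz; rewrite uM ?eqxx// (le_lt_trans (ler_norm _)).
  have uC : `|u x - u y| <= Num.min 1 `|x - y| * C.
    rewrite minr_pMl ?addr_ge0 ?mulr_ge0// le_min mul1r; apply/andP; split.
      by have := ler_normB (u x) (u y); have := uB x; have := uB y; rewrite /C; lra.
    apply: le_trans (uL x y) _; rewrite mulrC ler_wpM2l// /C lerDl mulr_ge0//.
  have m0 : 0 <= Num.min 1 `|x - y| by rewrite le_min ler01 normr_ge0.
  have [ux|/uQ fx] := eqVneq (u x) 0; last first.
    by apply: le_trans uC _; rewrite ler_wpM2l// fx lerDr.
  have [uy|/uQ fy] := eqVneq (u y) 0; last first.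
    by apply: le_trans uC _; rewrite ler_wpM2l// fy lerDl.
  by rewrite ux uy subrr normr0 mulr_ge0// addr_ge0.
have mf1 : measurable_fun setT (fun p : RN * RN =>
    Num.min 1 `|p.1 - p.2| * kern p.1 p.2 * f p.2).
  apply: measurable_funM; first exact: measurable_min_kern.
  exact: (measurableT_comp mf measurable_snd).
have mf2 : measurable_fun setT (fun p : RN * RN =>
    Num.min 1 `|p.1 - p.2| * kern p.1 p.2 * f p.1).
  apply: measurable_funM; first exact: measurable_min_kern.
  exact: (measurableT_comp mf measurable_fst).
have g0 (x y z : RN) : 0 <= Num.min 1 `|x - y| * kern x y * f z.
  by rewrite mulr_ge0// min_kern_ge0.
have sec := @measurable_section R N.
have inner1 := measurable_inner mf1 (fun x y => g0 x y y).
have inner2 := measurable_inner mf2 (fun x y => g0 x y x).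
apply: (@le_lt_trans _ _ (kappa%:E * \int[mu]_y (f y)%:E + kappa%:E * \int[mu]_y (f y)%:E)%E); last first.
  have ff : (\int[mu]_y (f y)%:E < +oo)%E.
    under eq_integral do rewrite EFinM.
    rewrite ge0_integralZl//; last 2 first.
    - by apply/measurable_EFinP; exact: measurable_indic.
    - by rewrite lee_fin addr_ge0// mulr_ge0.
    rewrite integral_indic// setIT.
    have lc : (lebesgue_rV N Q < +oo)%E by rewrite lebesgue_cube ?ltry.
    by rewrite lte_mul_pinfty// lee_fin addr_ge0// mulr_ge0.
  have ff' : (kappa%:E * \int[mu]_y (f y)%:E < +oo)%E by rewrite lte_mul_pinfty.
  by rewrite lte_add_pinfty.
apply: le_trans (leeD H1 H2).
rewrite -ge0_integralD//; last 2 first.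
- by move=> y _; apply: integral_ge0 => x _; rewrite lee_fin.
- by move=> y _; apply: integral_ge0 => x _; rewrite lee_fin.
apply: ge0_le_integral => //.
- by move=> y _; apply: integral_ge0 => x _; exact: gagliardo_fun_ge0.
- exact: measurable_gagliardo_inner.
- exact: emeasurable_funD.
- move=> y _; rewrite -ge0_integralD//; last 4 first.
  + by move=> x _; rewrite lee_fin.
  + exact: (sec (fun x y => Num.min 1 `|x - y| * kern x y * f y) y mf1).
  + by move=> x _; rewrite lee_fin.
  + exact: (sec (fun x y => Num.min 1 `|x - y| * kern x y * f x) y mf2).
  apply: ge0_le_integral => //.
  + by move=> x _; exact: gagliardo_fun_ge0.
  + exact: measurable_gagliardo_section.
  + apply: emeasurable_funD.
      exact: (sec (fun x y => Num.min 1 `|x - y| * kern x y * f y) y mf1).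
    exact: (sec (fun x y => Num.min 1 `|x - y| * kern x y * f x) y mf2).
  + by move=> x _; rewrite -EFinD lee_fin.
Qed.

End finiteness.

(** * Lipschitz boundaries: inward directions *)

Section margins.
Context {R : realType} {N : nat}.
Local Notation RN := 'rV[R]_N.

Lemma finite_pos_lower_bound n (r : 'I_n -> R) : (forall i, 0 < r i) ->
  exists2 r0, 0 < r0 & forall i, r0 <= r i.
Proof.
move=> rp; have s0 : 0 <= \sum_i (r i)^-1.
  by apply: sumr_ge0 => i _; rewrite invr_ge0 ltW.
exists (1 + \sum_i (r i)^-1)^-1; first by rewrite invr_gt0 ltr_pwDl.
move=> i; rewrite -[leRHS]invrK lef_pV2 ?posrE ?ltr_pwDl ?invr_gt0//.
rewrite (bigD1 i)//= addrCA lerDl addr_ge0// sumr_ge0// => j _.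
by rewrite invr_ge0 ltW.
Qed.

(** The distance from K to the complement of Omega is positive. *)
Lemma compact_open_margin (K Omega : set RN) : compact K -> open Omega ->
  K `<=` Omega -> exists2 d : R, 0 < d &
  forall x z, K x -> `|x - z| <= d -> Omega z.
Proof.
move=> /compact_near_coveringP cK oO KO.
have := cK R 0^'+ (fun d x => forall z, `|x - z| <= d -> Omega z) _ => /(_ _).
case.
  move=> x Kx; have : nbhs x Omega by apply: open_nbhs_nbhs; split => //; exact: KO.
  move=> /nbhs_ballP[e /= e0 eO].
  exists (ball x (e / 2), [set d | 0 < d < e / 2]).
    split => /=; first by apply: nbhsx_ballx; rewrite divr_gt0.
    exists (e / 2) => //=; first by rewrite divr_gt0.
    by move=> d /=; rewrite sub0r normrN => + d0; rewrite gtr0_norm// d0.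
  move=> [y d] [/=]; rewrite -ball_normE/= => xy /andP[d0 de] z yz.
  apply: eO; rewrite -ball_normE/=.
  have := ler_normD (x - y) (y - z); rewrite addrA subrK; lra.
move=> e /= e0 H; exists (e / 2); first by rewrite divr_gt0.
move=> x z Kx xz; apply: (H (e / 2) _ _ x) => //=; last by rewrite divr_gt0.
by rewrite sub0r normrN gtr0_norm ?divr_gt0// ltr_pdivrMr// ltr_pMr// ltr1n.
Qed.

(** In the rotated coordinates Omega is, near p, the set {h > 0} where h is the
    height above the graph. Moving by t in the vertical direction a raises h by
    exactly t, while h >= 0 on the closure: a point whose translate by - t a is
    in the closure is therefore in Omega. *)
Lemma inward_direction (Omega : set RN) (p : RN) : lipschitz_set Omega ->
  (closure Omega `\` interior Omega) p ->
  exists (r : R) (a : RN), 0 < r /\ forall t x, 0 < t < r -> `|x - p| <= r *+ 2 ->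
    closure Omega (x - t *: a) -> Omega x.
Proof.
move=> LO /LO[i [Q [g [QQ Lg near_p]]]].
move: near_p => /nbhs_ballP[R0 /= R00 H].
have [k [k0 gk]] : exists k : R, 0 <= k /\ forall y y', `|g y - g y'| <= k * `|y - y'|.
  have [M [_ HM]] := Lg; exists (`|M| + 1); split; first by rewrite addr_ge0.
  move=> y y'; apply: (HM (`|M| + 1) _ (y, y')) => //.
  by rewrite (le_lt_trans (ler_norm M))// ltrDl.
pose h (x : RN) := (x *m Q) ord0 i - g (col' i (x *m Q)).
pose C := \sum_k \sum_j `|Q k j|.
have C0 : 0 <= C by apply: sumr_ge0 => ? _; apply: sumr_ge0.
have QC (x : RN) : `|x *m Q| <= C * `|x|.
  apply/rV_norm_leP => [|j]; first by rewrite mulr_ge0.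
  rewrite mxE; apply: le_trans (ler_norm_sum _ _ _) _.
  rewrite mulr_suml; apply: ler_sum => l _; rewrite normrM mulrC ler_pM// ?norm_coord//.
  by rewrite (bigD1 j)//= lerDl sumr_ge0.
have ch : continuous h.
  apply: (@lipschitz_continuous _ _ h (C + k * C)) => [|x y].
    by rewrite addr_ge0// mulr_ge0.
  rewrite (_ : h x - h y = ((x - y) *m Q) ord0 i -
      (g (col' i (x *m Q)) - g (col' i (y *m Q)))); last first.
    by rewrite /h mulmxBl !mxE; ring.
  rewrite mulrDl; apply: le_trans (ler_normB _ _) _; apply: lerD.
    exact: le_trans (norm_coord _ _) (QC _).
  apply: le_trans (gk _ _) _; rewrite -mulrA ler_wpM2l//; apply: le_trans (QC _).
  apply/rV_norm_leP => // j; rewrite mulmxBl.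
  have := norm_coord (x *m Q - y *m Q) (lift i j); by rewrite !mxE.
pose a : RN := delta_mx ord0 i *m Q^T.
have aQ : a *m Q = delta_mx ord0 i.
  by rewrite /a -mulmxA (mulmx1C QQ) mulmx1.
have ha t x : h (x + t *: a) = h x + t.
  rewrite /h mulmxDl -scalemxAl aQ.
  have -> : col' i (x *m Q + t *: delta_mx ord0 i) = col' i (x *m Q).
    by apply/rowP => j; rewrite !mxE eqxx/= [lift i j == i]eq_sym (negbTE (neq_lift i j)) mulr0 addr0.
  by rewrite !mxE !eqxx mulr1; ring.
(* Small enough for x and x - t a to stay in the ball where Omega is described
   by the graph. *)
pose r := R0 / (4 * (`|a| + 1)).
have a1 : 0 < `|a| + 1 by rewrite ltr_pwDr.
have r0 : 0 < r by rewrite divr_gt0// mulr_gt0.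
have ra : r * (`|a| + 1) = R0 / 4 by rewrite /r; field; rewrite gt_eqF.
exists r, a; split => // t x /andP[t0 tr] xp clz.
set z := x - t *: a.
have xz : x = z + t *: a by rewrite subrK.
have ta : `|t *: a| <= R0 / 4.
  rewrite normrZ gtr0_norm// -ra; apply: ler_pM; rewrite ?(ltW t0) ?(ltW tr)//.
  by rewrite lerDl.
have r4 : r <= R0 / 4.
  by rewrite -ra ler_peMr ?(ltW r0)// lerDr.
have zp : `|z - p| < R0.
  have := ler_normB (x - p) (t *: a); rewrite addrAC -/z; rewrite mulr2n in xp; lra.
have hz : 0 <= h z.
  rewrite leNgt; apply/negP => hz0.
  have n1 : nbhs z [set y | h y < 0].
    by apply: (ch z [set r : R | r < 0]); exact: open_nbhs_nbhs (conj (@open_lt R 0) hz0).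
  have n2 : nbhs z (ball p R0).
    apply: open_nbhs_nbhs; split; first exact: (@ball_open R RN).
    by rewrite -ball_normE/= distrC.
  have [y [Oy [/= hy yp]]] := clz _ (filterI n1 n2).
  move: ((H y yp).1 Oy); rewrite -subr_gt0 -/(h y); lra.
have xp' : ball p R0 x.
  by rewrite -ball_normE/= distrC; rewrite mulr2n in xp; lra.
by apply/(H x xp'); rewrite -subr_gt0 -/(h x) xz ha ltr_wpDl.
Qed.

End margins.

(** * A partition of unity with inward directions *)

Section partition.
Context {R : realType} {N : nat}.
Local Notation RN := 'rV[R]_N.

Let clip (t : R) : R := Num.max 0 (Num.min 1 t).

Let clip_ge0 t : 0 <= clip t.
Proof. by rewrite /clip le_max lexx. Qed.

Let max_lip (c t t' : R) : `|Num.max c t - Num.max c t'| <= `|t - t'|.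
Proof.
have h := ler_norm (t - t'); have h' := ler_norm (t' - t); rewrite (distrC t') in h'.
by case: (leP c t) => ?; case: (leP c t') => ?; rewrite ?subrr ?normr0//;
  rewrite ler_norml; apply/andP; split; lra.
Qed.

Let min_lip (c t t' : R) : `|Num.min c t - Num.min c t'| <= `|t - t'|.
Proof.
have h := ler_norm (t - t'); have h' := ler_norm (t' - t); rewrite (distrC t') in h'.
by case: (leP c t) => ?; case: (leP c t') => ?; rewrite ?subrr ?normr0//;
  rewrite ler_norml; apply/andP; split; lra.
Qed.

Let clip_lip t t' : `|clip t - clip t'| <= `|t - t'|.
Proof. exact: le_trans (max_lip _ _ _) (min_lip _ _ _). Qed.

(* Lipschitz dependence of a quotient whose value is in [0, 1]. *)
Let quot_lip (f f' m m' : R) : 0 <= f' <= m' -> 1 <= m -> 1 <= m' ->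
  `|f / m - f' / m'| <= `|f - f'| + `|m - m'|.
Proof.
move=> /andP[f0 fm] m1 m1'.
have m0 : 0 < m by lra. have m0' : 0 < m' by lra.
rewrite (_ : f / m - f' / m' = (f - f') / m - (f' / m') * ((m - m') / m)); last first.
  by field; rewrite !gt_eqF.
have i0 : 0 <= m^-1 <= 1 by rewrite invr_ge0 ltW//= invf_le1.
case/andP: i0 => i0 i1.
apply: le_trans (ler_normB _ _) _; rewrite !normrM (ger0_norm i0); apply: lerD.
  by rewrite ler_piMr.
rewrite -normrM (@ger0_norm _ (f' / m')) ?divr_ge0 ?(ltW m0')//.
apply: (@le_trans _ _ (1 * (`|m - m'| * m^-1))).
  by rewrite ler_wpM2r ?mulr_ge0// ler_pdivrMr// mul1r.
by rewrite mul1r ler_piMr.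
Qed.

(** Cover the boundary by finitely many balls on which a direction points
    inwards, and complete their cut-off functions by an interior weight, moved by
    the zero vector, into a Lipschitz partition of unity. For small t, a function
    supported in Omega and translated by t a_j within the support of the j-th
    weight lands at a positive distance from the complement of Omega: each of the
    closed conditions describing such points defines a compact subset of Omega. *)
Lemma inward_partition (Omega : set RN) : open Omega -> bounded_set Omega ->
  lipschitz_set Omega ->
  exists n (eta : 'I_n -> RN -> R) (a : 'I_n -> RN) (L t0 : R),
  [/\ forall j x, 0 <= eta j x,
      forall x, \sum_j eta j x = 1,
      0 <= L /\ forall j x y, `|eta j x - eta j y| <= L * `|x - y|,
      0 < t0 &
      forall t, 0 < t < t0 -> exists2 d : R, 0 < d & forall j x z,
        eta j x != 0 -> Omega (x - t *: a j) -> `|x - z| <= d -> Omega z].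
Proof.
move=> oO bO LO.
pose K := closure Omega `\` interior Omega.
have [M OM] := bounded_cubeP bO.
have clM : closure Omega `<=` cube 0 M.
  by rewrite [X in _ `<=` X](proj1 (closure_id _) (@closed_cube _ _ 0 M)); exact: closureS.
have cK : compact K.
  apply: bounded_closed_compact.
    by apply: (@cube_bounded _ _ _ M) => x [/clM].
  by rewrite /K setDE; apply: closedI; [exact: closed_closure|exact/open_closedC/open_interior].
have [r0 [a0 Ha]] : exists (r : RN -> R) (a : RN -> RN), forall p, 0 < r p /\
    (K p -> forall t x, 0 < t < r p -> `|x - p| <= r p *+ 2 ->
      closure Omega (x - t *: a p) -> Omega x).
  have /choice[f Hf] : forall p, exists ra : R * RN, 0 < ra.1 /\
    (K p -> forall t x, 0 < t < ra.1 -> `|x - p| <= ra.1 *+ 2 ->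
      closure Omega (x - t *: ra.2) -> Omega x).
    move=> p; have [Kp|nKp] := pselect (K p).
      by have [r [a [? ?]]] := inward_direction LO Kp; exists (r, a).
    by exists (1, 0).
  by exists (fst \o f), (snd \o f).
have [D' D'K cov] : finite_subset_cover K (fun p : RN => ball p (r0 p)) K.
  move: cK; rewrite compact_cover; apply.
    by move=> p _; exact: (@ball_open R RN).
  by move=> p Kp; exists p => //; apply: ballxx; case: (Ha p).
pose sq : seq RN := enum_fset D'.
pose n := size sq.
pose p (k : 'I_n) : RN := nth 0 sq k.
have pK k : K (p k).
  by apply: set_mem; apply: D'K; apply: mem_nth.
pose r k := r0 (p k).
have rp k : 0 < r k by case: (Ha (p k)).
(* The factor 2 makes S >= 2 close to the boundary, so that the interior weight
   1 - S / max(1, S), which lives where S < 1, vanishes there with a margin. *)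
pose b k x := 2 * clip (2 - `|x - p k| / r k).
have b0 k x : 0 <= b k x by rewrite mulr_ge0.
pose Lam := \sum_k 2 * (r k)^-1.
have Lam0 : 0 <= Lam.
  by apply: sumr_ge0 => k _; rewrite mulr_ge0// invr_ge0 ltW.
have bL k x y : `|b k x - b k y| <= Lam * `|x - y|.
  apply: (@le_trans _ _ (2 * (r k)^-1 * `|x - y|)); last first.
    rewrite ler_wpM2r// /Lam (bigD1 k)//= lerDl sumr_ge0// => j _.
    by rewrite mulr_ge0// invr_ge0 ltW.
  rewrite /b -mulrBr normrM ger0_norm// -mulrA ler_wpM2l//.
  apply: le_trans (clip_lip _ _) _.
  rewrite (_ : _ - _ = (r k)^-1 * (`|y - p k| - `|x - p k|)); last by ring.
  rewrite normrM gtr0_norm ?invr_gt0// ler_wpM2l ?invr_ge0 ?(ltW (rp k))//.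
  apply: le_trans (ler_dist_dist _ _) _.
  by rewrite opprB addrA subrK distrC.
pose S x := \sum_k b k x.
have bS k x : b k x <= S x.
  by rewrite /S (bigD1 k)//= lerDl sumr_ge0.
have S0 x : 0 <= S x by apply: sumr_ge0.
have SL x y : `|S x - S y| <= n%:R * Lam * `|x - y|.
  rewrite /S -sumrB; apply: le_trans (ler_norm_sum _ _ _) _.
  rewrite -mulrA mulr_natl -[X in _ *+ X]card_ord -sumr_const; apply: ler_sum => k _.
  exact: bL.
pose m x := Num.max 1 (S x).
have m1 x : 1 <= m x by rewrite le_max lexx.
have Sm x : S x <= m x by rewrite le_max lexx orbT.
pose eta (i : 'I_n.+1) x := if unlift ord0 i is Some k then b k x / m x else 1 - S x / m x.
pose a (i : 'I_n.+1) := if unlift ord0 i is Some k then a0 (p k) else 0.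
have [t0 t00 t0r] := finite_pos_lower_bound rp.
have etaL i x y : `|eta i x - eta i y| <= (Lam + n%:R * Lam + n%:R * Lam) * `|x - y|.
  have mL : `|m x - m y| <= n%:R * Lam * `|x - y| by apply: le_trans (max_lip _ _ _) (SL _ _).
  rewrite /eta; case: unliftP => [k _|_].
    apply: le_trans (quot_lip _ _ _ _) _ => //; first by rewrite b0 (le_trans (bS _ _)).
    rewrite !mulrDl -addrA; apply: lerD; first exact: bL.
    by rewrite (le_trans mL)// lerDl !mulr_ge0.
  rewrite opprB addrC addrA subrK; rewrite distrC.
  apply: le_trans (quot_lip _ _ _ _) _ => //; first by rewrite S0 Sm.
  rewrite !mulrDl -addrA [X in _ <= X]addrC; apply: (@le_trans _ _ (n%:R * Lam * `|x - y| + n%:R * Lam * `|x - y|)).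
    exact: lerD.
  by rewrite lerDl mulr_ge0.
exists n.+1, eta, a, (Lam + n%:R * Lam + n%:R * Lam), t0; split => //.
- move=> i x; rewrite /eta; case: unliftP => [k _|_].
    by rewrite divr_ge0// (le_trans ler01).
  by rewrite subr_ge0 ler_pdivrMr ?mul1r// (lt_le_trans ltr01).
- move=> x; rewrite big_ord_recl /eta unlift_none.
  under eq_bigr do rewrite liftK.
  by rewrite -mulr_suml subrK.
- by split => //; rewrite !addr_ge0// mulr_ge0.
move=> t /andP[tgt0 tt0].
(* A compact subset of Omega containing the points x with eta i x != 0 and
   x - t a i in Omega. *)
pose P (i : 'I_n.+1) : set RN := if unlift ord0 i is Some k then
    cube (p k) (r k *+ 2) `&` (fun x => x - t *: a0 (p k)) @^-1` closure Omega
  else closure Omega `&` S @^-1` [set u | u <= 1].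
have cS : continuous S.
  by apply: (@lipschitz_continuous _ _ _ (n%:R * Lam)) => //; rewrite mulr_ge0.
have cP i : compact (P i).
  rewrite /P; case: unliftP => [k _|_]; apply: bounded_closed_compact.
  - apply: (@cube_bounded _ _ _ (r k *+ 2 + `|p k|)) => x [xp _].
    rewrite /cube/= subr0 -[x in `|x|](subrK (p k)).
    by rewrite (le_trans (ler_normD _ _))// lerD2r.
  - apply: closedI; first exact: closed_cube.
    apply: closed_comp; last exact: closed_closure.
    move=> x _; apply: (@continuousB _ _ _ (fun x : RN => x) (fun=> t *: a0 (p k))).
      exact: cvg_id.
    exact: cst_continuous.
  - by apply: (@cube_bounded _ _ _ M) => x [/clM].
  - apply: closedI; first exact: closed_closure.
    by apply: closed_comp => [x _|]; [exact: cS|exact: closed_le].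
have PO i : P i `<=` Omega.
  rewrite /P; case: unliftP => [k _|_] x [].
    move=> xp clx; have [_ H] := Ha (p k).
    by apply: (H (pK k) t x _ xp clx); rewrite tgt0 (lt_le_trans tt0 (t0r k)).
  move=> clx /= Sx1; apply: contrapT => nOx.
  have Kx : K x by split => // /interior_subset.
  have [q qD xq] := cov x Kx.
  have qs : q \in sq by exact: qD.
  have ks : (index q sq < n)%N by rewrite /n index_mem.
  pose k := Ordinal ks.
  have pq : p k = q by rewrite /p /= nth_index.
  have bk : b k x = 2.
    rewrite /b /clip min_l ?max_r ?mulr1//.
    rewrite lerBrDr -lerBrDl (_ : 2 - 1 = 1 :> R); last by ring.
    rewrite ler_pdivrMr// mul1r pq /r pq.
    by move: xq; rewrite -ball_normE/= distrC => /ltW.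
  by have := bS k x; rewrite bk => /le_trans /(_ Sx1); rewrite leNgt ltr1n.
have /choice[d Hd] : forall j, exists d : R, 0 < d /\ forall x z, P j x -> `|x - z| <= d -> Omega z.
  by move=> j; have [d ? ?] := compact_open_margin (cP j) oO (PO j); exists d.
have [d0 d00 d0d] := finite_pos_lower_bound (fun i => (Hd i).1).
exists d0 => // j x z ex Ox xz.
apply: ((Hd j).2 x z _ (le_trans xz (d0d j))).
move: ex Ox; rewrite /eta /a /P; case: unliftP => [k _|_].
  move=> bx Ox; split; last exact: subset_closure.
  rewrite /cube/= leNgt; apply/negP => h; move/eqP: bx; apply.
  rewrite /b /clip min_r ?max_l ?mulr0 ?mul0r//.
  - by rewrite subr_le0 ler_pdivlMr// mulr_natl ltW.
  - by rewrite (@le_trans _ _ 0)// subr_le0 ler_pdivlMr// mulr_natl ltW.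
rewrite scaler0 subr0 => Sx Ox; split; first exact: subset_closure.
rewrite /= leNgt; apply/negP => S1; move/eqP: Sx; apply.
by rewrite /m max_r ?ltW// divff ?subrr// gt_eqF// (lt_trans ltr01).
Qed.

End partition.

(** * Patching translates of a function *)

Section translated_partition.
Context {R : realType} {N : nat} (s : R).
Hypotheses (N_gt0 : (0 < N)%N) (s_gt0 : 0 < s) (s_lt1 : s < 1).
Local Notation RN := 'rV[R]_N.
Local Notation mu := (@lebesgue_rV R N).
Local Notation kern := (@fractional_kernel R N s).
Local Notation gagliardo := (@gagliardo R N s).

Lemma ge0_double_integral_le (F G : RN -> RN -> R) :
  measurable_fun setT (fun p : RN * RN => F p.1 p.2) ->
  measurable_fun setT (fun p : RN * RN => G p.1 p.2) ->
  (forall x y, 0 <= F x y <= G x y) ->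
  (\int[mu]_y \int[mu]_x (F x y)%:E <= \int[mu]_y \int[mu]_x (G x y)%:E)%E.
Proof.
move=> mF mG FG.
have F0 x y : 0 <= F x y by case/andP: (FG x y).
have G0 x y : 0 <= G x y by case/andP: (FG x y) => /le_trans; apply.
apply: ge0_le_integral => //.
- by move=> y _; apply: integral_ge0 => x _; rewrite lee_fin.
- exact: measurable_inner.
- exact: measurable_inner.
- move=> y _; apply: ge0_le_integral => //.
  + by move=> x _; rewrite lee_fin.
  + exact: measurable_section.
  + exact: measurable_section.
  + by move=> x _; rewrite lee_fin; case/andP: (FG x y).
Qed.

Lemma double_integral_sum n (F : 'I_n -> RN -> RN -> R) :
  (forall j, measurable_fun setT (fun p : RN * RN => F j p.1 p.2)) ->
  (forall j x y, 0 <= F j x y) ->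
  (\int[mu]_y \int[mu]_x (\sum_j F j x y)%:E = \sum_j \int[mu]_y \int[mu]_x (F j x y)%:E)%E.
Proof.
move=> mF F0.
rewrite -ge0_integral_sum//; last 2 first.
- by move=> j; exact: measurable_inner.
- by move=> j y _; apply: integral_ge0 => x _; rewrite lee_fin.
apply: eq_integral => y _.
rewrite -ge0_integral_sum//; last 2 first.
- by move=> j; exact: measurable_section.
- by move=> j x _; rewrite lee_fin.
by apply: eq_integral => x _; rewrite sumEFin.
Qed.

Lemma double_integralD (F G : RN -> RN -> R) :
  measurable_fun setT (fun p : RN * RN => F p.1 p.2) ->
  measurable_fun setT (fun p : RN * RN => G p.1 p.2) ->
  (forall x y, 0 <= F x y) -> (forall x y, 0 <= G x y) ->
  (\int[mu]_y \int[mu]_x (F x y + G x y)%:E =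
   \int[mu]_y \int[mu]_x (F x y)%:E + \int[mu]_y \int[mu]_x (G x y)%:E)%E.
Proof.
move=> mF mG F0 G0; rewrite -ge0_integralD//; last 4 first.
- by move=> y _; apply: integral_ge0 => x _; rewrite lee_fin.
- exact: measurable_inner.
- by move=> y _; apply: integral_ge0 => x _; rewrite lee_fin.
- exact: measurable_inner.
apply: eq_integral => y _; rewrite -ge0_integralD//; last 4 first.
- by move=> x _; rewrite lee_fin.
- exact: measurable_section.
- by move=> x _; rewrite lee_fin.
- exact: measurable_section.
Qed.

Lemma double_integralZl (c : R) (F : RN -> RN -> R) : 0 <= c ->
  measurable_fun setT (fun p : RN * RN => F p.1 p.2) -> (forall x y, 0 <= F x y) ->
  (\int[mu]_y \int[mu]_x (c * F x y)%:E = c%:E * \int[mu]_y \int[mu]_x (F x y)%:E)%E.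
Proof.
move=> c0 mF F0; rewrite -ge0_integralZl//; last 2 first.
- exact: measurable_inner.
- by move=> y _; apply: integral_ge0 => x _; rewrite lee_fin.
apply: eq_integral => y _; rewrite -ge0_integralZl//; last 2 first.
- exact: measurable_section.
- by move=> x _; rewrite lee_fin.
Qed.

Lemma translation_modulus : exists2 C : R, 0 <= C &
  forall (u : RN -> R) (a : RN), measurable_fun setT u ->
  (\int[mu]_y (`|u (y + a)%R - u y|)%:E <= (C * `|a| `^ s)%:E * gagliardo u)%E.
Proof.
have [C C0 HC] := translation_le_gagliardo N_gt0 s_gt0.
exists C => // u a mu_; have [->|a0] := eqVneq a 0; last exact: HC.
under eq_integral do rewrite addr0 subrr normr0.
by rewrite integral0 mule_ge0 ?gagliardo_ge0// lee_fin mulr_ge0// powR_ge0.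
Qed.

Variables (n : nat) (eta : 'I_n -> RN -> R) (L : R).
Hypotheses (eta0 : forall j x, 0 <= eta j x) (eta1 : forall x, \sum_j eta j x = 1)
  (L0 : 0 <= L) (etaL : forall j x y, `|eta j x - eta j y| <= L * `|x - y|).

Let eta_le1 j x : eta j x <= 1.
Proof. by rewrite -(eta1 x) (bigD1 j)//= lerDl sumr_ge0. Qed.

Let meta j : measurable_fun setT (eta j).
Proof.
by apply: continuous_rV_measurable; exact: lipschitz_continuous L0 (etaL j).
Qed.

Let eta_min j x y : `|eta j x - eta j y| <= (L + 1) * Num.min 1 `|x - y|.
Proof.
rewrite minr_pMr ?addr_ge0// le_min mulr1; apply/andP; split.
  have := eta_le1 j x; have := eta_le1 j y; have := eta0 j x; have := eta0 j y.
  by move: L0 => ? ? ? ? ?; rewrite ler_norml; apply/andP; split; lra.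
by apply: le_trans (etaL j x y) _; rewrite ler_wpM2r// lerDl.
Qed.

(** In the application b_j = - t a_j, and the result is supported well inside
    Omega when v is supported in Omega. *)
Definition patched (b : 'I_n -> RN) (v : RN -> R) (x : RN) : R :=
  \sum_j eta j x * v (x + b j).

Lemma measurable_patched b v : measurable_fun setT v -> measurable_fun setT (patched b v).
Proof.
move=> mv; apply: measurable_sum => j; apply: measurable_funM => //.
exact: measurable_comp_addr.
Qed.

(** The increment splits into increments of translates, weighted by the
    partition, and increments of the weights. Since the weights add up to 1, v y
    may be subtracted from the factors of the latter, which makes them small. *)
Lemma patched_increment b v x y : `|patched b v x - patched b v y| * kern x y <=
  \sum_j (eta j x * (`|v (x + b j) - v (y + b j)| * kern x y)) +
  \sum_j ((L + 1) * (Num.min 1 `|x - y| * kern x y * `|v (y + b j) - v y|)).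
Proof.
rewrite -big_split/=.
rewrite (_ : patched b v x - patched b v y = \sum_j (eta j x * (v (x + b j) - v (y + b j))
    + (eta j x - eta j y) * (v (y + b j) - v y))); last first.
  have z : \sum_j (eta j x - eta j y) * v y = 0.
    by rewrite -mulr_suml sumrB !eta1 subrr mul0r.
  rewrite /patched -[LHS]subr0 -[X in _ - X = _]z -!sumrB; apply: eq_bigr => j _; ring.
apply: le_trans (ler_wpM2r (kern_ge0 _ _ _) (ler_norm_sum _ _ _)) _.
rewrite mulr_suml; apply: ler_sum => j _.
rewrite mulrA [in X in _ <= _ + X]mulrAC [(L + 1) * (_ * _)]mulrA -mulrDl ler_wpM2r ?kern_ge0//.
apply: le_trans (ler_normD _ _) _; rewrite !normrM ger0_norm// lerD2l.
by rewrite mulrA ler_wpM2r.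
Qed.

(** Patching small translates multiplies the seminorm by a factor close to 1, up
    to an error controlled by the L1 distance of v to its translates. *)
Lemma gagliardo_patched : exists2 kappa : R, 0 <= kappa &
  forall b v, measurable_fun setT v ->
  (gagliardo (patched b v) <= (1 + L * \sum_j `|b j|)%:E * gagliardo v +
    \sum_j kappa%:E * \int[mu]_y (`|v (y + b j)%R - v y|)%:E)%E.
Proof.
have [kappa k0 Hk] := @min_kern_weight R N s s_gt0 s_lt1.
exists ((L + 1) * kappa); first by rewrite mulr_ge0// addr_ge0.
move=> b v mv.
have mp := measurable_patched b mv.
have mg := measurable_gagliardo_fun s mv.
have mmk := @measurable_min_kern R N s.
have mw j : measurable_fun setT (fun y : RN => `|v (y + b j) - v y|).
  apply: (measurableT_comp (@normr_measurable R setT)); apply: measurable_funB => //.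
  exact: measurable_comp_addr.
pose F1 j (x y : RN) := eta j x * (`|v (x + b j) - v (y + b j)| * kern x y).
pose F2 j (x y : RN) := (L + 1) * (Num.min 1 `|x - y| * kern x y * `|v (y + b j) - v y|).
have F10 j x y : 0 <= F1 j x y by rewrite !mulr_ge0// kern_ge0.
have F20 j x y : 0 <= F2 j x y by rewrite mulr_ge0 ?addr_ge0// mulr_ge0// min_kern_ge0.
have mF1 j : measurable_fun setT (fun p : RN * RN => F1 j p.1 p.2).
  apply: measurable_funM; first exact: (measurableT_comp (meta j) measurable_fst).
  exact: measurable_gagliardo_fun (measurable_comp_addr _ mv).
have mF2' j : measurable_fun setT (fun p : RN * RN =>
    Num.min 1 `|p.1 - p.2| * kern p.1 p.2 * `|v (p.2 + b j) - v p.2|).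
  by apply: measurable_funM => //; exact: (measurableT_comp (mw j) measurable_snd).
have mF2 j : measurable_fun setT (fun p : RN * RN => F2 j p.1 p.2).
  exact: measurable_funM.
(* After translating both variables by b_j, the increments are those of v itself
   and the weights, which no longer add up to 1, still do so up to L |b_j|. *)
pose H j (x y : RN) := eta j (x - b j) * (`|v x - v y| * kern x y).
have mH j : measurable_fun setT (fun p : RN * RN => H j p.1 p.2).
  apply: measurable_funM => //.
  exact: (measurableT_comp (measurable_comp_addr (- b j) (meta j)) measurable_fst).
have H0 j x y : 0 <= H j x y by rewrite !mulr_ge0// kern_ge0.
have F1H j : (\int[mu]_y \int[mu]_x (F1 j x y)%:E = \int[mu]_y \int[mu]_x (H j x y)%:E)%E.
  rewrite -(double_integral_shift (b j) (mH j) (H0 j)).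
  apply: eq_integral => y _; apply: eq_integral => x _.
  by rewrite /H addrK kern_shift.
have sF1 : measurable_fun setT (fun p : RN * RN => \sum_j F1 j p.1 p.2).
  by apply: measurable_sum.
have sF2 : measurable_fun setT (fun p : RN * RN => \sum_j F2 j p.1 p.2).
  by apply: measurable_sum.
have sF10 x y : 0 <= \sum_j F1 j x y by exact: sumr_ge0.
have sF20 x y : 0 <= \sum_j F2 j x y by exact: sumr_ge0.
apply: (@le_trans _ _ (\int[mu]_y \int[mu]_x (\sum_j F1 j x y + \sum_j F2 j x y)%:E)%E).
  apply: (@ge0_double_integral_le (fun x y => `|patched b v x - patched b v y| * kern x y)
    (fun x y => \sum_j F1 j x y + \sum_j F2 j x y)).
  - exact: measurable_gagliardo_fun.
  - exact: measurable_funD.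
  - move=> x y; rewrite mulr_ge0 ?kern_ge0//=; exact: patched_increment.
rewrite (double_integralD sF1 sF2 sF10 sF20); apply: leeD.
  rewrite double_integral_sum//.
  rewrite (eq_bigr (fun j => \int[mu]_y \int[mu]_x (H j x y)%:E)%E); last by move=> j _.
  rewrite -double_integral_sum//.
  have c0 : 0 <= 1 + L * \sum_j `|b j|.
    by rewrite addr_ge0// mulr_ge0// sumr_ge0.
  have g0 x y : 0 <= `|v x - v y| * kern x y by rewrite mulr_ge0// kern_ge0.
  rewrite -(double_integralZl c0 mg g0).
  apply: ge0_double_integral_le.
  - exact: measurable_sum.
  - exact: measurable_funM.
  - move=> x y; rewrite sumr_ge0//= -mulr_suml ler_wpM2r// mulr_sumr -(eta1 x) -big_split/=.
    apply: ler_sum => j _; rewrite -lerBlDl; apply: le_trans (ler_norm _) _.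
    by apply: le_trans (etaL _ _ _) _; rewrite addrAC subrr sub0r normrN.
rewrite double_integral_sum//; apply: lee_sum => j _.
have mk0 (x y : RN) : 0 <= Num.min 1 `|x - y| * kern x y * `|v (y + b j) - v y|.
  by rewrite mulr_ge0// min_kern_ge0.
have L10 : 0 <= L + 1 by rewrite addr_ge0.
rewrite (double_integralZl L10 (mF2' j) mk0) EFinM -muleA lee_wpmul2l ?lee_fin//.
by have [] := Hk _ (mw j) (fun y => normr_ge0 _).
Qed.

End translated_partition.

(** * The pairing as an integral over the product space *)

Section pairing.
Context {R : realType} {N : nat} (s : R).
Local Notation RN := 'rV[R]_N.
Local Notation mu := (@lebesgue_rV R N).
Local Notation mm := (mu \x mu)%E.
Local Notation kern := (@fractional_kernel R N s).
Local Notation gagliardo := (@gagliardo R N s).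

Lemma measurable_Rs (u : RN -> R) : measurable_fun setT u ->
  measurable_fun setT (fun p : RN * RN => Rs s u p.1 p.2).
Proof.
move=> mu_; rewrite (_ : (fun _ => _) = fun p : RN * RN => (u p.1 - u p.2) * kern p.1 p.2).
  apply: measurable_funM; last exact: measurable_kern.
  apply: measurable_funB.
    exact: (measurableT_comp mu_ measurable_fst).
  exact: (measurableT_comp mu_ measurable_snd).
by apply/funext => p; rewrite RsE.
Qed.

(** The operator R_{s,1} is an isometry from the seminorm to L1 of the product. *)
Lemma gagliardo_product (u : RN -> R) : measurable_fun setT u ->
  (\int[mm]_p `|Rs s u p.1 p.2|%:E = gagliardo u)%E.
Proof.
move=> mu_; have mg := measurable_gagliardo_fun s mu_.
pose F (x y : RN) := (`|u x - u y| * kern x y)%:E.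
have mF : measurable_fun setT (fun p : RN * RN => F p.1 p.2) by exact/measurable_EFinP.
have F0 x y : (0 <= F x y)%E by exact: gagliardo_fun_ge0.
transitivity (\int[mm]_p F p.1 p.2)%E.
  apply: eq_integral => p _; rewrite RsE normrM (ger0_norm (kern_ge0 _ _ _))//.
have -> : gagliardo u = (\int[mu]_y \int[mu]_x F x y)%E by [].
clearbody F.
by rewrite fubini_tonelli1//; exact: tonelli2.
Qed.

Lemma Linfty_bound (phi : RN * RN -> R) : Linfty phi ->
  exists l : R, [/\ Linfty_norm phi = l%:E, 0 <= l, measurable_fun setT phi &
    {ae mm, forall p, `|phi p| <= l}].
Proof.
move=> phiL; have := sub_Lfun_mfun phiL; rewrite inE => mphi.
have := sub_Lfun_finLfun phiL; rewrite inE/= => fin.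
have n0 : (0 <= Linfty_norm phi)%E by exact: Lnorm_ge0.
have fn : Linfty_norm phi \is a fin_num by rewrite ge0_fin_numE.
exists (fine (Linfty_norm phi)); rewrite fineK//; split => //.
- exact: fine_ge0.
have : {ae mm, forall p, (`|(phi p)%:E| <= Linfty_norm phi)%E}.
  rewrite /Linfty_norm unlock; case: ifPn => [_|mm0]; first exact: ess_sup_ge.
  exists setT; split => //.
  by apply/eqP; rewrite eq_le measure_ge0 andbT leNgt.
apply: filterS => p; rewrite -[X in (_ <= X)%E -> _]fineK// abse_EFin lee_fin.
Qed.

(** Fubini applies to the pairing because phi R_{s,1} u is integrable. *)
Lemma pairing_product (phi : RN * RN -> R) (l : R) (u : RN -> R) :
  0 <= l -> measurable_fun setT phi -> {ae mm, forall p, `|phi p| <= l} ->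
  measurable_fun setT u -> (gagliardo u < +oo)%E ->
  mm.-integrable setT (fun p => (phi p * Rs s u p.1 p.2)%:E) /\
  Rs_adj s phi u = (\int[mm]_p (phi p * Rs s u p.1 p.2)%:E)%E /\
  (`|Rs_adj s phi u| <= l%:E * gagliardo u)%E.
Proof.
move=> l0 mphi phil mu_ fu; have mR := measurable_Rs mu_.
have mpR : measurable_fun setT (fun p => (phi p * Rs s u p.1 p.2)%:E).
  by apply/measurable_EFinP; exact: measurable_funM.
have bound : (\int[mm]_p `|(phi p * Rs s u p.1 p.2)%:E| <= l%:E * gagliardo u)%E.
  rewrite -gagliardo_product// -ge0_integralZl//; last first.
    by apply/measurable_EFinP; exact: measurableT_comp.
  apply: ae_ge0_le_integral => //.
  - exact: measurableT_comp.
  - by move=> p _; rewrite mule_ge0// lee_fin.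
  - by apply: measurable_funeM; apply/measurable_EFinP; exact: measurableT_comp.
  - apply: filterS phil => p pl _; rewrite -EFinM lee_fin normrM.
    by rewrite ler_wpM2r.
have ip : mm.-integrable setT (fun p => (phi p * Rs s u p.1 p.2)%:E).
  by apply/integrableP; split => //; apply: le_lt_trans bound _; rewrite lte_mul_pinfty.
have E : Rs_adj s phi u = (\int[mm]_p (phi p * Rs s u p.1 p.2)%:E)%E.
  exact: (@integral21_prod_meas1 _ _ RN RN R mu mu (fun p => (phi p * Rs s u p.1 p.2)%:E) ip).
split => //; split => //; rewrite E.
by apply: le_trans (le_abse_integral _ _ _) bound.
Qed.

Lemma Rs_adj_eq1_le (Omega : set RN) (phi : RN * RN -> R) : Linfty phi ->
  (forall u, Ccinfty Omega u -> (gagliardo u < +oo)%E) ->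
  Rs_adj_eq1 s Omega phi ->
  forall u, Ccinfty Omega u ->
  (\int[mu]_(x in Omega) (u x)%:E <= Linfty_norm phi * gagliardo u)%E.
Proof.
move=> /Linfty_bound[l [-> l0 mphi phil]] fin eq1 u Cu.
rewrite -(eq1 u Cu).
have mu_ : measurable_fun setT u by exact: test_measurable (Ccinfty_test Cu).
have [_ [_ H]] := pairing_product l0 mphi phil mu_ (fin u Cu).
exact: le_trans (lee_abs _) H.
Qed.

End pairing.

(** * The constraint bounds the volume by the perimeter *)

Section lower_bound.
Context {R : realType} {N : nat} (s : R).
Hypotheses (N_gt0 : (0 < N)%N) (s_gt0 : 0 < s) (s_lt1 : s < 1).
Local Notation RN := 'rV[R]_N.
Local Notation mu := (@lebesgue_rV R N).
Local Notation gagliardo := (@gagliardo R N s).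

Lemma le_of_small_error (m X alpha beta t0 : R) : 0 <= alpha -> 0 <= beta -> 0 < t0 ->
  (forall t, 0 < t < t0 -> m <= X + alpha * t + beta * t `^ s) -> m <= X.
Proof.
move=> al0 be0 t00 H; rewrite leNgt; apply/negP => Xm.
pose e := (m - X) / 2; have e0 : 0 < e by rewrite divr_gt0// subr_gt0.
have al1 : 0 < alpha + 1 by rewrite ltr_pwDr.
have be1 : 0 < beta + 1 by rewrite ltr_pwDr.
have q0 : 0 < e / (beta + 1) by rewrite divr_gt0.
pose t := Num.min (t0 / 2) (Num.min (e / (alpha + 1)) ((e / (beta + 1)) `^ s^-1)).
have tp : 0 < t.
  by rewrite !lt_min; apply/and3P; split; [exact: divr_gt0|exact: divr_gt0|exact: powR_gt0].
have tt0 : t < t0.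
  by rewrite /t gt_min ltr_pdivrMr// ltr_pMr// ltr1n.
have t1 : t <= e / (alpha + 1) by rewrite /t !ge_min lexx orbT.
have t2 : t <= (e / (beta + 1)) `^ s^-1 by rewrite /t !ge_min lexx !orbT.
have ts : t `^ s <= e / (beta + 1).
  have -> : e / (beta + 1) = ((e / (beta + 1)) `^ s^-1) `^ s.
    by rewrite -powRrM mulVf ?gt_eqF// powRr1// ltW.
  by rewrite ge0_ler_powR// ?nnegrE ?powR_ge0// ltW.
have h1 : alpha * t < e.
  apply: le_lt_trans (ler_wpM2l al0 t1) _.
  by rewrite mulrCA gtr_pMr// ltr_pdivrMr// mul1r ltrDl.
have h2 : beta * t `^ s < e.
  apply: le_lt_trans (ler_wpM2l be0 ts) _.
  by rewrite mulrCA gtr_pMr// ltr_pdivrMr// mul1r ltrDl.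
have := H t; rewrite tp tt0 => /(_ isT).
have : e *+ 2 = m - X by rewrite /e; field.
by rewrite mulr2n; lra.
Qed.

(** The constraint, tested against smooth functions w, gives
    int w <= |phi|_oo * seminorm of w. The indicator of E is approached by the
    admissible functions obtained by patching its inward translates and
    mollifying; this is where the regularity of the boundary is used. *)
Lemma measure_le_perimeter (Omega : set RN) (phi : RN * RN -> R) (E : set RN) :
  open Omega -> bounded_set Omega -> lipschitz_set Omega ->
  Linfty phi -> Rs_adj_eq1 s Omega phi ->
  measurable E -> E `<=` Omega -> (perimeter s E < +oo)%E ->
  (mu E <= Linfty_norm phi * perimeter s E)%E.
Proof.
move=> oO bO LO phiL phi1 mE EO; rewrite perimeterE => fP.
have mO := open_rV_measurable oO.
have [M OM] := bounded_cubeP bO.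
have [n [eta [a [L [t0 [eta0 eta1 [L0 etaL] t00 Ht]]]]]] := inward_partition oO bO LO.
have [kappa k0 Hk] := gagliardo_patched s_gt0 s_lt1 eta0 eta1 L0 etaL.
have [C C0 HC] := @translation_modulus R N s N_gt0 s_gt0.
have finC u : Ccinfty Omega u -> (gagliardo u < +oo)%E.
  by move=> Cu; apply: gagliardo_test_lty => //; exact: Ccinfty_test Cu.
have key := Rs_adj_eq1_le phiL finC phi1.
have [l [phil l0 _ _]] := Linfty_bound phiL.
rewrite phil in key *.
pose v : RN -> R := \1_E.
have mv : measurable_fun setT v by exact: measurable_indic.
have v01 x : 0 <= v x <= 1 by rewrite /v indicE; case: (x \in E); rewrite ?lexx ?ler01.
have v0 x : 0 <= v x by case/andP: (v01 x).
have [G GE G0] : exists2 G : R, gagliardo v = G%:E & 0 <= G.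
  exists (fine (gagliardo v)); last by apply: fine_ge0; exact: gagliardo_ge0.
  by rewrite fineK// ge0_fin_numE ?gagliardo_ge0.
have Ev : (mu E = \int[mu]_x (v x)%:E)%E by rewrite /v integral_indic// setIT.
have fE : (mu E < +oo)%E.
  by apply: bounded_rV_lty => //; apply: (@cube_bounded _ _ _ M) => x /EO /OM.
have [m mEm] : exists m : R, mu E = m%:E.
  by exists (fine (mu E)); rewrite fineK// ge0_fin_numE.
rewrite -/v GE mEm -EFinM lee_fin.
pose A := \sum_j `|a j|.
pose B := C * \sum_j `|a j| `^ s.
have A0 : 0 <= A by exact: sumr_ge0.
have B0 : 0 <= B by rewrite mulr_ge0// sumr_ge0// => j _; exact: powR_ge0.
(* The terms in t come from the variation of the weights, those in t^s from the
   L1 distance between the indicator of E and its translates. *)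
apply: (@le_of_small_error m (l * G) (l * (L * A * G)) (l * (kappa * B * G) + B * G) t0).
- by rewrite !mulr_ge0.
- by apply: addr_ge0; apply: mulr_ge0 => //; apply: mulr_ge0 => //; apply: mulr_ge0.
- exact: t00.
move=> t tt; have /andP[tp _] := tt; have [d d0 Hd] := Ht t tt.
pose b j := - (t *: a j).
have bE j : `|b j| = t * `|a j| by rewrite normrN normrZ gtr0_norm.
set u := patched eta b v.
have mu_ : measurable_fun setT u by exact: (measurable_patched L0 etaL b mv).
have u0 x : 0 <= u x by apply: sumr_ge0 => j _; rewrite mulr_ge0.
have u1 x : `|u x| <= 1.
  rewrite ger0_norm// -(eta1 x); apply: ler_sum => j _.
  by rewrite ler_piMr//; case/andP: (v01 (x + b j)).
have uO x z : u x != 0 -> `|x - z| <= d -> Omega z.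
  move=> ux xz; have [j ej vj] : exists2 j, eta j x != 0 & v (x + b j) != 0.
    apply: contrapT => nex; move/eqP: ux; apply; apply: big1 => j _.
    have [->|ej] := eqVneq (eta j x) 0; first by rewrite mul0r.
    have [->|vj] := eqVneq (v (x + b j)) 0; first by rewrite mulr0.
    by case: nex; exists j.
  apply: (Hd j x z ej _ xz); apply: EO; move: vj; rewrite /v indicE.
  by case: (boolP (_ \in E)) => [|_]; rewrite ?eqxx// inE.
have uM x : M < `|x| -> u x = 0.
  move=> Mx; apply/eqP/negPn/negP => ux.
  have Ox : Omega x by apply: (uO x x ux); rewrite subrr normr0 ltW.
  by have := OM x Ox; rewrite /cube/= subr0 leNgt Mx.
have [w [Cw wu gw]] := exists_Ccinfty_approx s mO mu_ u0 u1 uM d0 uO.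
have D : (\sum_j \int[mu]_y (`|v (y + b j)%R - v y|)%:E <= (t `^ s * B * G)%:E)%E.
  rewrite (_ : t `^ s * B * G = \sum_j C * `|b j| `^ s * G); last first.
    rewrite /B -mulr_suml; congr (_ * _); rewrite mulrCA mulr_sumr mulr_sumr.
    by apply: eq_bigr => j _; rewrite bE powRM// ltW.
  rewrite -sumEFin; apply: lee_sum => j _; rewrite EFinM -GE; exact: HC.
have iu : (\int[mu]_x (u x)%:E <= (l * ((1 + L * (t * A)) * G + kappa * (t `^ s * B * G)))%:E)%E.
  rewrite -wu; apply: (le_trans (key w Cw)); rewrite EFinM lee_wpmul2l// ?lee_fin//.
  apply: (le_trans gw); apply: le_trans (Hk b v mv) _; rewrite [leRHS]EFinD; apply: leeD.
    rewrite GE -EFinM lee_fin ler_wpM2r// lerD2l ler_wpM2l//.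
    by rewrite /A mulr_sumr; apply: ler_sum => j _; rewrite bE.
  rewrite EFinM -ge0_sume_distrr; last by move=> j _; apply: integral_ge0.
  by rewrite lee_wpmul2l.
have mu1 : (mu E <= \int[mu]_x (u x)%:E + \sum_j \int[mu]_y (`|v (y + b j)%R - v y|)%:E)%E.
  have mw j : measurable_fun setT (fun y : RN => (`|v (y + b j)%R - v y|)%:E).
    apply/measurable_EFinP; apply: (measurableT_comp (@normr_measurable R setT)).
    by apply: measurable_funB => //; exact: measurable_comp_addr.
  have ms : measurable_fun setT (fun x : RN => \sum_j (`|v (x + b j)%R - v x|)%:E).
    exact: emeasurable_sum.
  rewrite Ev -ge0_integral_sum// -ge0_integralD//; last 3 first.
  - by move=> x _; rewrite lee_fin.
  - exact/measurable_EFinP.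
  - by move=> x _; rewrite sumEFin lee_fin sumr_ge0.
  apply: ge0_le_integral => //.
  - by move=> x _; rewrite lee_fin.
  - exact/measurable_EFinP.
  - by apply: emeasurable_funD; [exact/measurable_EFinP|exact: ms].
  - move=> x _; rewrite sumEFin -EFinD lee_fin /u /patched -big_split/=.
    rewrite -[leLHS]mul1r -(eta1 x) mulr_suml; apply: ler_sum => j _.
    have e1 : eta j x <= 1 by rewrite -(eta1 x) (bigD1 j)//= lerDl sumr_ge0.
    rewrite -lerBlDl -mulrBr; apply: le_trans (ler_norm _) _.
    by rewrite normrM distrC ger0_norm// ler_piMl.
have := le_trans mu1 (leeD iu D); rewrite mEm -EFinD lee_fin => /le_trans; apply.
by rewrite le_eqVlt; apply/orP; left; apply/eqP; ring.
Qed.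

End lower_bound.

(** * The Hahn-Banach theorem *)

Section hahn_banach.
Context {R : realType} {X : lmodType R}.

Definition sublinear (q : X -> R) : Prop :=
  (forall x y, q (x + y) <= q x + q y) /\
  (forall t x, 0 <= t -> q (t *: x) = t * q x).

Lemma sublinear0 q : sublinear q -> q 0 = 0.
Proof. by move=> [_ h]; rewrite -(scale0r 0) h// mul0r. Qed.

Lemma sublinear_opp q x : sublinear q -> - q (- x) <= q x.
Proof.
move=> qs; rewrite lerNl -subr_ge0 opprK -(sublinear0 qs) -(addNr x).
by case: qs => [h _]; exact: h.
Qed.

(** Infimal convolution of q with a function c given on a cone C: the largest
    sublinear functional below both q and c. *)
Definition inf_conv (q : X -> R) (C : set X) (c : X -> R) (x : X) : R :=
  inf [set q (x - v) + c v | v in C].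

Section inf_conv.
Variables (q : X -> R) (C : set X) (c : X -> R).
Hypotheses (qs : sublinear q) (C0 : C 0)
  (CD : forall v w, C v -> C w -> C (v + w))
  (CZ : forall t v, 0 <= t -> C v -> C (t *: v))
  (cD : forall v w, C v -> C w -> c (v + w) = c v + c w)
  (cZ : forall t v, 0 <= t -> C v -> c (t *: v) = t * c v)
  (cq : forall v, C v -> - c v <= q (- v)).

Let c0 : c 0 = 0.
Proof. by rewrite -(scale0r 0) cZ// mul0r. Qed.

Let lower x v : C v -> - q (- x) <= q (x - v) + c v.
Proof.
move=> Cv; have := cq Cv; have := qs.1 (x - v) (- x).
rewrite addrAC subrr add0r; lra.
Qed.

Let nonempty_vals x : [set q (x - v) + c v | v in C] !=set0.
Proof. by exists (q (x - 0) + c 0), 0. Qed.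

Lemma inf_conv_le x v : C v -> inf_conv q C c x <= q (x - v) + c v.
Proof.
move=> Cv; apply: ge_inf; last by exists v.
by exists (- q (- x)) => _ [w Cw <-]; exact: lower.
Qed.

Lemma le_inf_conv x r : (forall v, C v -> r <= q (x - v) + c v) -> r <= inf_conv q C c x.
Proof. by move=> H; apply: lb_le_inf => // _ [w Cw <-]; exact: H. Qed.

Lemma inf_conv_le_self x : inf_conv q C c x <= q x.
Proof. by have := inf_conv_le x C0; rewrite subr0 c0 addr0. Qed.

Lemma inf_conv_le_cone v : C v -> inf_conv q C c v <= c v.
Proof. by move=> Cv; have := inf_conv_le v Cv; rewrite subrr (sublinear0 qs) add0r. Qed.

Lemma inf_conv_sublinear : sublinear (inf_conv q C c).
Proof.
have homo t x : 0 < t -> t * inf_conv q C c x <= inf_conv q C c (t *: x).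
  move=> t0; apply: le_inf_conv => v Cv.
  have Cv' : C (t^-1 *: v) by apply: CZ => //; rewrite invr_ge0 ltW.
  have := inf_conv_le x Cv'; rewrite -(ler_pM2l t0) => /le_trans; apply.
  rewrite mulrDr -(cZ (ltW t0) Cv') -(qs.2 _ _ (ltW t0)) scalerBr scalerA.
  by rewrite divff ?gt_eqF// scale1r.
split=> [x y|t x]; last first.
  rewrite le_eqVlt => /predU1P[<-|t0].
    rewrite scale0r mul0r; apply/eqP; rewrite eq_le; apply/andP; split.
      by have := inf_conv_le_cone C0; rewrite c0.
    by apply: le_inf_conv => v Cv; have := lower 0 Cv; rewrite oppr0 (sublinear0 qs) oppr0.
  apply/eqP; rewrite eq_le homo// andbT.
  have := @homo t^-1 (t *: x); rewrite invr_gt0 => /(_ t0).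
  by rewrite scalerA mulVf ?gt_eqF// scale1r ler_pdivrMl.
rewrite -lerBlDr; apply: le_inf_conv => v Cv.
rewrite lerBlDr -lerBlDl; apply: le_inf_conv => w Cw.
rewrite lerBlDl; apply: le_trans (inf_conv_le (x + y) (CD Cv Cw)) _.
rewrite cD// opprD addrACA; have := qs.1 (x - v) (y - w); lra.
Qed.

End inf_conv.

(** Zorn's lemma: the pointwise infimum of a chain is sublinear, since along a
    chain any two of its members can be replaced by the smaller one. *)
Lemma minimal_sublinear (q0 : X -> R) : sublinear q0 ->
  exists q, [/\ sublinear q, forall x, q x <= q0 x &
   forall r, sublinear r -> (forall x, r x <= q x) -> r = q].
Proof.
move=> q0s.
pose T := {q : X -> R | sublinear q /\ forall x, q x <= q0 x}.
pose rel (q r : T) := `[< forall x, sval r x <= sval q x >].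
have [||q r|A Atot|q Hq] := @Zorn T rel.
- by move=> q; apply/asboolP => x; exact: lexx.
- move=> q r u /asboolP qr /asboolP ru; apply/asboolP => x.
  exact: le_trans (ru x) (qr x).
- case: q r => [q pq] [r pr] /asboolP/= qr /asboolP/= rq; apply: eq_exist.
  by apply/funext => x; apply/eqP; rewrite eq_le qr rq.
- have [A0|nA] := pselect (A !=set0); last first.
    have q00 : sublinear q0 /\ forall x, q0 x <= q0 x by split.
    by exists (exist _ q0 q00) => r Ar; case: nA; exists r.
  pose vals x := [set sval q x | q in A].
  have lb x : lbound (vals x) (- q0 (- x)).
    move=> _ [q Aq <-]; have [qs qq0] := svalP q.
    by apply: le_trans (sublinear_opp x qs); rewrite lerN2.
  have ne x : vals x !=set0 by case: A0 => q Aq; exists (sval q x), q.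
  pose m x := inf (vals x).
  have mle q x : A q -> m x <= sval q x.
    by move=> Aq; apply: ge_inf; [exists (- q0 (- x)); exact: lb|exists q].
  have le_m x r : (forall q, A q -> r <= sval q x) -> r <= m x.
    by move=> H; apply: lb_le_inf => // _ [q Aq <-]; exact: H.
  have ms : sublinear m.
    split=> [x y|t x t0].
      rewrite -lerBlDr; apply: (le_m) => q Aq; rewrite lerBlDr -lerBlDl; apply: (le_m) => r Ar.
      rewrite lerBlDl; have [qr|rq] := Atot _ _ Aq Ar.
        have := mle r (x + y) Ar; have := (svalP r).1.1 x y.
        by move/asboolP: qr => /(_ x); lra.
      have := mle q (x + y) Aq; have := (svalP q).1.1 x y.
      by move/asboolP: rq => /(_ y); lra.
    apply/eqP; rewrite eq_le; apply/andP; split; last first.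
      apply: (le_m) => q Aq; rewrite (svalP q).1.2// ler_wpM2l//; exact: mle.
    have [->|tn0] := eqVneq t 0.
      rewrite scale0r mul0r; case: A0 => q Aq; apply: le_trans (mle q _ Aq) _.
      by rewrite (sublinear0 (svalP q).1).
    have tp : 0 < t by rewrite lt_neqAle eq_sym tn0.
    rewrite mulrC -ler_pdivrMr//; apply: (le_m) => q Aq.
    by rewrite ler_pdivrMr// mulrC -(svalP q).1.2//; exact: mle.
  have mq0 x : m x <= q0 x.
    by case: A0 => q Aq; apply: le_trans (mle q _ Aq) _; exact: (svalP q).2.
  by exists (exist _ m (conj ms mq0)) => q Aq; apply/asboolP => x; exact: mle.
exists (sval q); split; [exact: (svalP q).1|exact: (svalP q).2|].
move=> r rs rq.
have rq0 x : r x <= q0 x by exact: le_trans (rq x) ((svalP q).2 x).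
have := Hq (exist _ r (conj rs rq0)) => /(_ _)/(congr1 sval) /= <- //.
by apply/asboolP.
Qed.

(** Infimal convolution with the ray through - y, on which the functional is set
    to its least admissible value - q y, decreases q; by minimality it leaves q
    unchanged, which forces q (- y) = - q y. An odd sublinear functional is
    linear. *)
Lemma minimal_sublinear_linear (q : X -> R) : sublinear q ->
  (forall r, sublinear r -> (forall x, r x <= q x) -> r = q) ->
  (forall x y, q (x + y) = q x + q y) /\ (forall t x, q (t *: x) = t * q x).
Proof.
move=> qs qmin.
have odd y : q (- y) = - q y.
  apply/eqP; rewrite eq_le; apply/andP; split; last first.
    by have := sublinear_opp (- y) qs; rewrite opprK.
  pose C := [set v | exists2 t, 0 <= t & v = - (t *: y)].
  pose c v := - q (- v).
  have C0 : C 0 by exists 0 => //; rewrite scale0r oppr0.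
  have CD v w : C v -> C w -> C (v + w).
    move=> [t t0 ->] [t' t0' ->]; exists (t + t'); first exact: addr_ge0.
    by rewrite scalerDl opprD.
  have CZ u v : 0 <= u -> C v -> C (u *: v).
    move=> u0 [t t0 ->]; exists (u * t); first exact: mulr_ge0.
    by rewrite scalerN scalerA.
  have cD v w : C v -> C w -> c (v + w) = c v + c w.
    move=> [t t0 ->] [t' t0' ->]; rewrite /c opprD !opprK -scalerDl.
    by rewrite !qs.2// ?addr_ge0// mulrDl opprD.
  have cZ u v : 0 <= u -> C v -> c (u *: v) = u * c v.
    move=> u0 [t t0 ->]; rewrite /c -scalerN opprK !scalerA.
    by rewrite !qs.2// ?mulr_ge0// -mulrA mulrN.
  have cq v : C v -> - c v <= q (- v) by rewrite /c opprK.
  have E : inf_conv q C c = q.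
    apply: qmin => [|x]; first exact: inf_conv_sublinear.
    exact: inf_conv_le_self.
  have Cy : C (- y) by exists 1 => //; rewrite scale1r.
  have := @inf_conv_le_cone q C c qs cq (- y) Cy; rewrite E /c opprK//.
have add x y : q (x + y) = q x + q y.
  apply/eqP; rewrite eq_le qs.1/=.
  by have := qs.1 (x + y) (- y); rewrite addrK odd; lra.
split => // t x; have [t0|t0] := leP 0 t; first exact: qs.2.
by rewrite -[LHS]opprK -odd -scaleNr qs.2 ?oppr_ge0 ?ltW// mulNr opprK.
Qed.

(** Infimal convolution of p with f on V produces a sublinear functional below p
    and below f on V; a minimal one below it is linear, and equals f on V because
    it is below f at v and at - v. *)
Theorem hahn_banach (p f : X -> R) (V : set X) :
  sublinear p -> V 0 -> (forall x y, V x -> V y -> V (x + y)) ->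
  (forall t x, V x -> V (t *: x)) ->
  (forall x y, V x -> V y -> f (x + y) = f x + f y) ->
  (forall t x, V x -> f (t *: x) = t * f x) ->
  (forall x, V x -> f x <= p x) ->
  exists g : X -> R, [/\ forall x y, g (x + y) = g x + g y,
    forall t x, g (t *: x) = t * g x, forall x, g x <= p x &
    forall x, V x -> g x = f x].
Proof.
move=> ps V0 VD VZ fD fZ fp.
have VN v : V v -> V (- v) by move=> Vv; rewrite -scaleN1r; exact: VZ.
have fN v : V v -> f (- v) = - f v by move=> Vv; rewrite -scaleN1r fZ// mulN1r.
have cq v : V v -> - f v <= p (- v) by move=> Vv; rewrite -fN//; exact/fp/VN.
have VZ' t v : 0 <= t -> V v -> V (t *: v) by move=> _; exact: VZ.
have fZ' t v : 0 <= t -> V v -> f (t *: v) = t * f v by move=> _; exact: fZ.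
have q0s := inf_conv_sublinear ps V0 VD VZ' fD fZ' cq.
have [q [qs qle qmin]] := minimal_sublinear q0s.
have [qD qZ] := minimal_sublinear_linear qs qmin.
exists q; split => // [x|v Vv].
  by apply: le_trans (qle x) _; exact: inf_conv_le_self.
have le w : V w -> q w <= f w.
  by move=> Vw; apply: le_trans (qle w) _; exact: inf_conv_le_cone.
apply/eqP; rewrite eq_le le//=.
have := le _ (VN _ Vv); rewrite fN// -scaleN1r qZ mulN1r; lra.
Qed.

End hahn_banach.

(** * The dual of L1 *)

Section weight.
Context d (T : measurableType d) {R : realType}
  (m : {sigma_finite_measure set T -> \bar R}).

(** The series of the indicators of a countable cover by sets of finite measure,
    with coefficients making both its sum and its integral at most 1. *)
Lemma exists_integrable_weight : exists w : T -> R,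
  (forall x, 0 < w x) /\ m.-integrable setT (EFin \o w).
Proof.
have [F FT mF] := sigma_finiteT m.
have mFn n : measurable (F n) by case: (mF n).
pose c n : R := 2^-1 * 2^-1 ^+ n / (1 + fine (m (F n))).
have d0 n : 0 < 1 + fine (m (F n)) by rewrite ltr_pwDl// fine_ge0.
have c0 n : 0 < c n by rewrite /c divr_gt0// mulr_gt0 ?exprn_gt0// invr_gt0.
pose f n x : \bar R := (c n * \1_(F n) x)%:E.
have f0 n x : (0 <= f n x)%E by rewrite lee_fin mulr_ge0// ltW.
have mf n : measurable_fun setT (f n).
  by apply/measurable_EFinP; apply: measurable_funM => //; exact: measurable_indic.
have half : 0 <= (2^-1 : R) < 1 by rewrite invr_ge0 ler0n/= invf_lt1// ltr1n.
have c1 n : c n <= 2^-1 * 2^-1 ^+ n.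
  rewrite /c ler_pdivrMr// ler_peMr ?mulr_ge0 ?exprn_ge0 ?invr_ge0//.
  by rewrite lerDl fine_ge0.
have cm n : c n * fine (m (F n)) <= 2^-1 * 2^-1 ^+ n.
  rewrite /c -[leLHS]mulrA -[leRHS]mulr1; apply: ler_wpM2l.
    by rewrite ?mulr_ge0 ?exprn_ge0 ?invr_ge0.
  by rewrite mulrC ler_pdivrMr// mul1r lerDr.
have le1 (a : nat -> \bar R) : (forall n, 0 <= a n)%E ->
    (forall n, a n <= (2^-1 * 2^-1 ^+ n)%:E)%E -> (\sum_(0 <= n <oo) a n < +oo)%E.
  move=> a0 al; apply: (le_lt_trans _ (ltry (2^-1 / (1 - 2^-1)))).
  apply: le_trans (geometric_nneseries_le _ half); last by rewrite invr_ge0.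
  by apply: lee_nneseries => n *; [exact: a0|exact: al].
pose W x := (\sum_(0 <= n <oo) f n x)%E.
have W0 x : (0 <= W x)%E by exact: nneseries_ge0.
have Wfin x : W x \is a fin_num.
  rewrite ge0_fin_numE//; apply: le1 => // n.
  rewrite lee_fin; apply: le_trans (c1 n).
  by rewrite ler_piMr ?(ltW (c0 n))// indicE; case: (_ \in _).
have mW : measurable_fun setT W by apply: ge0_emeasurable_sum.
exists (fun x => fine (W x)); split=> [x|].
  have [k _ Fkx] : (\bigcup_n F n) x by rewrite -FT.
  rewrite fine_gt0// -ge0_fin_numE// Wfin andbT.
  apply: (@lt_le_trans _ _ (f k x)); first by rewrite lte_fin indicE mem_set// mulr1.
  rewrite /W (@nneseriesD1 _ _ k)//.
  by rewrite leeDl//; apply: nneseries_ge0.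
have -> : EFin \o (fun x => fine (W x)) = W by apply/funext => x /=; rewrite fineK.
apply/integrableP; split=> //.
rewrite (_ : integral _ _ _ = \int[m]_x W x)%E; last first.
  by apply: eq_integral => x _; rewrite gee0_abs.
rewrite integral_nneseries//; apply: le1 => n; first exact: integral_ge0.
rewrite (_ : integral _ _ _ = (c n)%:E * m (F n))%E; last first.
  under eq_integral do rewrite /f EFinM.
  rewrite ge0_integralZl//; last 2 first.
  - by apply/measurable_EFinP; exact: measurable_indic.
  - by rewrite lee_fin ltW.
  by rewrite integral_indic// setIT.
rewrite -(@fineK _ (m (F n))) -?EFinM ?lee_fin ?cm//.
by rewrite ge0_fin_numE//; case: (mF n).
Qed.

End weight.

Section riesz.
Context d (T : measurableType d) {R : realType}
  (m : {sigma_finite_measure set T -> \bar R}).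
Local Notation intg f := (m.-integrable setT (EFin \o f)).

Variables (L : (T -> R) -> R) (C : R).
Hypotheses (C0 : 0 <= C)
  (LD : forall f g, intg f -> intg g -> L (fun x => f x + g x) = L f + L g)
  (LZ : forall c f, intg f -> L (fun x => c * f x) = c * L f)
  (LC : forall f, intg f -> (`|L f|%:E <= C%:E * \int[m]_x `|f x|%:E)%E).

(** Continuity of L in dominated convergence, from its bound by the L1 norm. *)
Lemma functional_cvg (f_ : nat -> T -> R) (f g : T -> R) :
  (forall n, measurable_fun setT (f_ n)) -> intg g ->
  (forall n x, `|f_ n x| <= g x) -> (forall x, f_ ^~ x @ \oo --> f x) ->
  [/\ intg f, forall n, intg (f_ n) & L \o f_ @ \oo --> L f].
Proof.
move=> mf ig fg fl.
have if_ n : intg (f_ n).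
  apply: (le_integrable measurableT _ _ ig); first exact/measurable_EFinP.
  by move=> x _ /=; rewrite lee_fin (le_trans (fg n x))// ler_norm.
have [|||||ifi cv _] := @dominated_convergence _ _ _ m _ measurableT
    (fun n => EFin \o f_ n) (EFin \o f) (EFin \o g).
- by move=> n; exact/measurable_EFinP.
- by apply/measurable_EFinP; exact: (measurable_fun_cvg (fun n => mf n) (fun x _ => fl x)).
- by apply: aeW => x _ /=; apply: cvg_EFin; [exact: nearW|exact: fl].
- exact: ig.
- by apply: aeW => x n _ /=; rewrite lee_fin.
split=> //.
have LB n : L (f_ n) - L f = L (fun x => f_ n x + -1 * f x).
  rewrite LD//; first by rewrite LZ// mulN1r.
  by have := integrableZl measurableT (-1) ifi; apply: eq_integrable.
have iB n : intg (fun x => f_ n x + -1 * f x).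
  have := integrableB measurableT (if_ n) ifi.
  by apply: eq_integrable => // x _ /=; rewrite mulN1r.
have cv' : (fun n => C%:E * \int[m]_x `|(f_ n x)%:E - (f x)%:E|)%E @ \oo --> 0%E.
  by rewrite -(mule0 C%:E); apply: cvgeZl.
have sq : (fun n => `|L (f_ n) - L f|%:E) @ \oo --> 0%E.
  apply: (squeeze_cvge _ (@cvg_cst _ _ _ _ _) cv'); apply: nearW => n.
  rewrite lee_fin normr_ge0/= LB (le_trans (LC (iB n)))//.
  apply: lee_wpmul2l; first by rewrite lee_fin.
  apply: ge0_le_integral => //.
  - apply/measurable_EFinP; apply: measurableT_comp => //.
    exact/measurable_EFinP/(measurable_int _ (iB n)).
  - apply/measurable_EFinP; apply: measurableT_comp => //.
    by apply: measurable_funB => //; exact/measurable_EFinP/(measurable_int _ ifi).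
  - by move=> x _; rewrite mulN1r.
have [_] := (fine_cvgP _ _).1 sq.
by move=> h; apply/subr_cvg0/norm_cvg0P.
Qed.

Section density.
Variable w : T -> R.
Hypotheses (w0 : forall x, 0 < w x) (iw : intg w).

Let mw : measurable_fun setT w.
Proof. exact/measurable_EFinP/(measurable_int _ iw). Qed.

Lemma integrable_weight_indic A : measurable A -> intg (fun x => w x * \1_A x).
Proof.
move=> mA; apply: (le_integrable measurableT _ _ iw).
  by apply/measurable_EFinP; apply: measurable_funM => //; exact: measurable_indic.
move=> x _ /=; rewrite lee_fin normrM ler_piMr// indicE.
by case: (_ \in _); rewrite ?normr1 ?normr0.
Qed.

(** The weight w makes the indicators of all measurable sets integrable, even
    those of infinite measure, so that the charge is defined everywhere and
    finite. *)
Definition weighted_charge (A : set T) : \bar R :=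
  (L (fun x => w x * \1_A x))%:E.

Lemma functional0 : L (fun=> 0) = 0.
Proof.
have i0 : intg (fun _ : T => 0 : R) by exact: integrable0.
rewrite -[RHS](mul0r (L (fun=> 0))) -(LZ 0 i0); congr L.
by apply/funext => x; rewrite mul0r.
Qed.

Lemma functional_sum (n : nat) (c : 'I_n -> R) (f : 'I_n -> T -> R) :
  (forall i, intg (f i)) ->
  intg (fun x => \sum_(i < n) c i * f i x) /\
  L (fun x => \sum_(i < n) c i * f i x) = \sum_(i < n) c i * L (f i).
Proof.
elim: n c f => [|n IH] c f fi.
  rewrite big_ord0; under eq_fun do rewrite big_ord0.
  by split; [exact: integrable0|exact: functional0].
rewrite big_ord_recr/=; under eq_fun do rewrite big_ord_recr/=.
have [i1 E] := IH (fun i => c (widen_ord (leqnSn n) i))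
  (fun i => f (widen_ord (leqnSn n) i)) (fun i => fi _).
have i2 : intg (fun x => c ord_max * f ord_max x).
  by have := integrableZl measurableT (c ord_max) (fi ord_max); apply: eq_integrable.
split; first by have := integrableD measurableT i1 i2; apply: eq_integrable.
by rewrite LD// E LZ.
Qed.

Let charge0 : weighted_charge set0 = 0%E.
Proof.
transitivity (L (fun=> 0))%:E; last by rewrite functional0.
congr ((L _)%:E).
by apply/funext => x; rewrite indic0 mulr0.
Qed.

Let charge_fin A : measurable A -> weighted_charge A \is a fin_num.
Proof. by []. Qed.

Let charge_sigma_additive : semi_sigma_additive weighted_charge.
Proof.
move=> F mF tF mU.
pose f_ n x := w x * \1_(\big[setU/set0]_(i < n) F i) x.
have [||||_ _ cv] := @functional_cvg f_ (fun x => w x * \1_(\bigcup_n F n) x) w.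
- move=> n; apply: measurable_funM => //; apply: measurable_indic.
  exact: bigsetU_measurable.
- by [].
- move=> n x; rewrite /f_ normrM (gtr0_norm (w0 x)) ler_piMr ?(ltW (w0 x))// indicE.
  by case: (_ \in _); rewrite ?normr1 ?normr0.
- move=> x; apply: cvgMr.
  have [[k _ Fkx]|nF] := pselect ((\bigcup_n F n) x).
    apply: cvg_near_cst; near=> n.
    rewrite !indicE !mem_set//; first by exists k.
    rewrite -bigcup_mkord; exists k => //=; near: n.
    by exists k.+1.
  rewrite indicE memNset//; apply: cvg_near_cst; apply: nearW => n.
  rewrite indicE memNset// -bigcup_mkord => -[k _ Fk].
  by apply: nF; exists k.
have -> : (fun n => \sum_(0 <= i < n) weighted_charge (F i))%E = EFin \o (L \o f_).
  apply/funext => n /=; rewrite big_mkord /weighted_charge sumEFin; congr _%:E.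
  have [_] := functional_sum (fun _ : 'I_n => 1)
    (fun i => integrable_weight_indic (mF i)).
  under [X in _ = X -> _]eq_bigr do rewrite mul1r.
  move=> <-; congr L; apply/funext => x.
  under eq_bigr do rewrite mul1r.
  rewrite /f_ -mulr_sumr; congr (_ * _); apply/eqP; rewrite -eqe.
  apply/eqP; rewrite -sumEFin; have := @measure_bigsetU _ _ _ (@dirac _ T x R) F mF tF n.
  by rewrite /= /dirac /= => ->.
by apply: cvg_EFin => //; exact: nearW.
Unshelve. all: by end_near.
Qed.

HB.instance Definition _ := isCharge.Build _ _ _ weighted_charge
  charge0 charge_fin charge_sigma_additive.

Local Notation nu := weighted_charge.

Lemma weighted_charge_le A : measurable A ->
  (`|nu A| <= C%:E * \int[m]_(x in A) (w x)%:E)%E.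
Proof.
move=> mA; apply: le_trans (LC (integrable_weight_indic mA)) _.
rewrite (integral_mkcond A); apply: lee_wpmul2l; first by rewrite lee_fin.
rewrite le_eqVlt; apply/orP; left; apply/eqP; apply: eq_integral => x _.
rewrite /restrict /patch normrM (gtr0_norm (w0 x)) indicE.
by case: ifPn; rewrite ?normr1 ?normr0 ?mulr1 ?mulr0.
Qed.

Let nu_dominated : nu `<< m.
Proof.
apply/null_content_dominatesP => A mA mA0; have := weighted_charge_le mA.
rewrite (null_set_integral mA _ mA0) ?mule0; last first.
  by apply/measurable_EFinP/measurable_funTS.
by move=> h; apply/eqP; rewrite -abse_eq0 eq_le h abse_ge0.
Qed.

Let psi x := fine (Radon_Nikodym nu m x).

Let ipsi : intg psi.
Proof.
apply: eq_integrable (Radon_Nikodym_integrable nu_dominated) => // x _ /=.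
by rewrite fineK// Radon_Nikodym_fin_num.
Qed.

Let nu_psi A : measurable A -> nu A = (\int[m]_(x in A) (psi x)%:E)%E.
Proof.
move=> mA; rewrite (Radon_Nikodym_integral nu_dominated mA).
by apply: eq_integral => x _; rewrite fineK// Radon_Nikodym_fin_num.
Qed.

(* Comparison of e nu and C w m on the set where the density of the former exceeds
   that of the latter; e is a sign. *)
Let density_le (e : R) : `|e| = 1 -> {ae m, forall x, e * psi x <= C * w x}.
Proof.
move=> e1; pose h x := e * psi x - C * w x.
have ih : intg h.
  have i1 := integrableZl measurableT e ipsi.
  have i2 := integrableZl measurableT C iw.
  by have := integrableB measurableT i1 i2; apply: eq_integrable.
have mh : measurable_fun setT h by exact/measurable_EFinP/(measurable_int _ ih).
pose A := [set x | 0 < h x].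
have mA : measurable A.
  rewrite (_ : A = setT `&` h @^-1` `]0, +oo[%classic); first exact: mh.
  by apply/seteqP; split=> x; rewrite /A/= in_itv/= andbT => // -[].
have iA f : intg f -> m.-integrable A (EFin \o f) by exact: integrableS.
have h0 : (\int[m]_(x in A) `|(h x)%:E| = 0)%E.
  apply/eqP; rewrite eq_le integral_ge0// andbT.
  rewrite (_ : integral _ _ _ = e%:E * nu A - C%:E * \int[m]_(x in A) (w x)%:E)%E.
    rewrite sube_le0; apply: le_trans (weighted_charge_le mA).
    by rewrite -EFinM lee_fin (le_trans (ler_norm _))// normrM e1 mul1r.
  rewrite nu_psi// -!integralZl//; [|exact: iA..].
  rewrite -integralB//; last 2 first.
  - by apply: integrableZl => //; exact: iA.
  - by apply: integrableZl => //; exact: iA.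
  by apply: eq_integral => x; rewrite inE => /ltW h0; rewrite gee0_abs.
have mAh : measurable_fun A (EFin \o h).
  by apply/measurable_EFinP; exact: measurable_funTS.
have [N [mN N0 sN]] := (ae_eq_integral_abs m mA mAh).1 h0.
exists N; split=> // x /= /negP; rewrite -ltNge => hx.
apply: sN => /= /(_ _) H; have : 0 < h x by rewrite subr_gt0.
by move=> /[dup] /H [] ->; rewrite ltxx.
Qed.

(** The Radon-Nikodym density of the charge, divided by w. It is bounded by C only
    almost everywhere, and is therefore truncated. *)
Lemma exists_bounded_density : exists phi : T -> R,
  [/\ measurable_fun setT phi, forall x, `|phi x| <= C &
    forall A, measurable A ->
      nu A = (\int[m]_x (phi x * (w x * \1_A x))%:E)%E].
Proof.
pose phi x := Num.max (- C) (Num.min C (psi x / w x)).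
have mpsi : measurable_fun setT psi by exact/measurable_EFinP/(measurable_int _ ipsi).
have mphi : measurable_fun setT phi.
  apply: measurable_maxr => //; apply: measurable_minr => //.
  apply: measurable_funM => //.
  rewrite (_ : (fun _ => _) = fun x => w x `^ (-1)).
    exact: (measurableT_comp (measurable_powR _)).
  by apply/funext => x; rewrite powR_inv1// ltW.
exists phi; split=> //.
  by move=> x; rewrite ler_norml /phi le_max lexx ge_max ge_min lexx/= andbT ge0_cp.
move=> A mA; rewrite nu_psi// integral_mkcond; apply: ae_eq_integral => //.
- exact/(measurable_restrictT _ mA).1/measurable_funTS/measurable_EFinP.
- apply/measurable_EFinP; apply: measurable_funM => //.
  by apply: measurable_funM => //; exact: measurable_indic.
have e1 := density_le (normr1 _).
have e2 : {ae m, forall x, -1 * psi x <= C * w x} by apply: density_le; rewrite normrN1.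
move: e1 e2; apply: filterS2 => x; rewrite mul1r mulN1r => h1 h2 _.
rewrite /restrict /patch indicE; case: ifPn; rewrite ?mulr0// mulr1 => _.
congr _%:E; have wx := w0 x.
rewrite /phi min_r ?max_r ?divfK ?gt_eqF//.
  by rewrite ler_pdivlMr// mulNr lerNl.
by rewrite ler_pdivrMr.
Qed.

End density.

End riesz.

Section representation.
Context d (T : measurableType d) {R : realType}
  (m : {sigma_finite_measure set T -> \bar R}).
Local Notation intg f := (m.-integrable setT (EFin \o f)).

Section vanish.
Import HBSimple HBNNSimple.
Variables (L : (T -> R) -> R) (C : R) (w : T -> R).
Hypotheses (C0 : 0 <= C)
  (LD : forall f g, intg f -> intg g -> L (fun x => f x + g x) = L f + L g)
  (LZ : forall c f, intg f -> L (fun x => c * f x) = c * L f)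
  (LC : forall f, intg f -> (`|L f|%:E <= C%:E * \int[m]_x `|f x|%:E)%E)
  (w0 : forall x, 0 < w x) (iw : intg w)
  (L0 : forall A, measurable A -> L (fun x => w x * \1_A x) = 0).

(* Apply the continuity of L to w times simple functions increasing to f / w. *)
Let vanish_ge0 f : intg f -> (forall x, 0 <= f x) -> L f = 0.
Proof.
move=> fi f0.
have mf : measurable_fun setT f by exact/measurable_EFinP/(measurable_int _ fi).
have mw : measurable_fun setT w by exact/measurable_EFinP/(measurable_int _ iw).
have mh : measurable_fun setT (fun x => (f x / w x)%:E).
  apply/measurable_EFinP; apply: measurable_funM => //.
  rewrite (_ : (fun _ => _) = fun x => w x `^ (-1)).
    exact: (measurableT_comp (measurable_powR _)).
  by apply/funext => x; rewrite powR_inv1// ltW.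
have h0 x : setT x -> (0 <= (f x / w x)%:E)%E.
  by move=> _; rewrite lee_fin divr_ge0// ltW.
pose g n := nnsfun_approx measurableT mh n.
have gle n x : g n x <= f x / w x.
  by rewrite -lee_fin /g nnsfun_approxE; exact: le_approx.
have gcv x : (fun n => g n x) @ \oo --> f x / w x.
  have := cvg_nnsfun_approx measurableT mh h0 (x := x) I.
  by move/fine_cvgP => [_].
have [|||_ _ cv] := @functional_cvg _ _ _ m L C C0 LD LZ LC
    (fun n x => w x * g n x) f f _ fi.
- by move=> n; apply: measurable_funM.
- move=> n x; rewrite normrM (gtr0_norm (w0 x)) ger0_norm//.
  by rewrite mulrC -ler_pdivlMr.
- move=> x; rewrite -[f x](divfK (lt0r_neq0 (w0 x))) mulrC; apply: cvgMr.
  exact: gcv.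
have gl n : L (fun x => w x * g n x) = 0.
  pose r := fset_set (g n @` setT).
  have [_] := @functional_sum _ _ _ m L LD LZ #|` r| (fun i => r`_i)
    (fun i x => w x * \1_(g n @^-1` [set r`_i]) x)
    (fun i => integrable_weight_indic iw (measurable_sfunP (g n) (measurable_set1 _))).
  rewrite [X in _ = X -> _]big1; last by move=> i _; rewrite L0// mulr0.
  move=> <-; congr L; apply/funext => x; rewrite fimfunEord mulr_sumr.
  by apply: eq_bigr => i _; rewrite mulrCA.
have : L \o (fun n x => w x * g n x) @ \oo --> (0 : R).
  rewrite (_ : _ \o _ = cst 0); first exact: cvg_cst.
  by apply/funext => n /=; rewrite gl.
exact: cvg_unique.
Qed.

Lemma functional_vanish f : intg f -> L f = 0.
Proof.
move=> fi.
have mf : measurable_fun setT f by exact/measurable_EFinP/(measurable_int _ fi).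
pose part (h : T -> R) x := Num.max (h x) 0.
have ipart h : intg h -> intg (part h).
  move=> ih; apply: (le_integrable measurableT _ _ ih).
    apply/measurable_EFinP; apply: measurable_maxr => //.
    exact/measurable_EFinP/(measurable_int _ ih).
  move=> x _ /=; rewrite lee_fin /part; case: (leP (h x) 0) => _ //.
  by rewrite normr0.
have part0 h x : 0 <= part h x by rewrite le_max lexx orbT.
have iN : intg (fun x => -1 * f x).
  by have := integrableZl measurableT (-1) fi; apply: eq_integrable.
have iN' : intg (fun x => -1 * part (fun x => -1 * f x) x).
  by have := integrableZl measurableT (-1) (ipart _ iN); apply: eq_integrable.
have -> : f = fun x => part f x + -1 * part (fun x => -1 * f x) x.
  by apply/funext => x; rewrite /part; case: (leP (f x) 0); case: (leP (-1 * f x) 0) => *; lra.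
rewrite LD//; last exact: ipart.
by rewrite LZ ?vanish_ge0 ?mulr0 ?addr0//; exact: ipart.
Qed.

End vanish.

(** The dual of L1 is L^oo, for a sigma-finite measure. The functional and the
    integral against the density agree on the functions w * \1_A, and these span a
    dense subspace: their difference vanishes. *)
Theorem L1_dual_representation (L : (T -> R) -> R) (C : R) : 0 <= C ->
  (forall f g, intg f -> intg g -> L (fun x => f x + g x) = L f + L g) ->
  (forall c f, intg f -> L (fun x => c * f x) = c * L f) ->
  (forall f, intg f -> (`|L f|%:E <= C%:E * \int[m]_x `|f x|%:E)%E) ->
  exists phi : T -> R, [/\ measurable_fun setT phi, forall x, `|phi x| <= C &
    forall f, intg f -> (L f)%:E = (\int[m]_x (phi x * f x)%:E)%E].
Proof.
move=> C0 LD LZ LC; have [w [w0 iw]] := exists_integrable_weight m.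
have [phi [mphi phiC phiE]] := exists_bounded_density C0 LD LZ LC w0 iw.
exists phi; split=> //.
have iphi f : intg f -> intg (fun x => phi x * f x).
  move=> fi.
  have mf : measurable_fun setT f by exact/measurable_EFinP/(measurable_int _ fi).
  have := integrableZl measurableT C fi.
  apply: (le_integrable measurableT).
    by apply/measurable_EFinP; exact: measurable_funM.
  move=> x _ /=; rewrite lee_fin !normrM ler_wpM2r//.
  by rewrite (le_trans (phiC x))// ler_norm.
pose P f := fine (\int[m]_x (phi x * f x)%:E)%E.
have PE f : intg f -> ((P f)%:E = \int[m]_x (phi x * f x)%:E)%E.
  by move=> fi; rewrite /P fineK//; exact: integrable_fin_num (iphi _ fi).
have PD f g : intg f -> intg g -> P (fun x => f x + g x) = P f + P g.
  move=> ig ih; apply: EFin_inj.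
  have igh : intg (fun x => f x + g x).
    by have := integrableD measurableT ig ih; apply: eq_integrable.
  rewrite EFinD !PE//.
  transitivity (\int[m]_x ((phi x * f x)%:E + (phi x * g x)%:E))%E.
    by apply: eq_integral => x _; rewrite -EFinD mulrDr.
  by apply: integralD => //; exact: iphi.
have PZ c f : intg f -> P (fun x => c * f x) = c * P f.
  move=> ig; apply: EFin_inj.
  have igh : intg (fun x => c * f x).
    by have := integrableZl measurableT c ig; apply: eq_integrable.
  rewrite EFinM !PE//.
  transitivity (\int[m]_x (c%:E * (phi x * f x)%:E))%E.
    by apply: eq_integral => x _; rewrite -EFinM mulrCA.
  by apply: integralZl => //; exact: iphi.
have PC f : intg f -> (`|P f|%:E <= C%:E * \int[m]_x `|f x|%:E)%E.
  move=> ig; rewrite -abse_EFin PE//.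
  have mf : measurable_fun setT f by exact/measurable_EFinP/(measurable_int _ ig).
  apply: le_trans (le_abse_integral _ measurableT (measurable_int _ (iphi _ ig))) _.
  have mn : measurable_fun setT (fun x => `|f x|%:E).
    by apply/measurable_EFinP; exact: measurableT_comp.
  rewrite -ge0_integralZl//.
  apply: ge0_le_integral => //.
  - by apply: measurableT_comp => //; exact: measurable_int (iphi _ ig).
  - exact: measurable_funeM.
  - by move=> x _; rewrite /= -EFinM lee_fin normrM ler_wpM2r.
have Pw A : measurable A -> P (fun x => w x * \1_A x) = L (fun x => w x * \1_A x).
  move=> mA; apply: EFin_inj; rewrite PE; last exact: integrable_weight_indic.
  by rewrite -phiE.
clearbody P; move=> f fi; rewrite -PE//; congr _%:E.
apply/subr0_eq.
apply: (@functional_vanish (fun g => L g - P g) (C + C) w) => //.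
- exact: addr_ge0.
- by move=> g h ig ih; rewrite LD// PD// opprD addrACA.
- by move=> c g ig; rewrite LZ// PZ// mulrBr.
- move=> g ig; rewrite EFinD ge0_muleDl ?lee_fin//.
  apply: (@le_trans _ _ (`|L g|%:E + `|P g|%:E)%E).
    by rewrite -EFinD lee_fin ler_normB.
  by apply: leeD; [exact: LC|exact: PC].
- by move=> A mA; rewrite Pw// subrr.
Qed.

End representation.

(** * Functionals on a subspace of L1 *)

Section extension.
Context d (T : measurableType d) {R : realType}
  (m : {sigma_finite_measure set T -> \bar R}).
Local Notation intg f := (m.-integrable setT (EFin \o f)).
Local Notation X := (LfunType m (lexx (1%E : \bar R))).

(* The extension theorem takes place in the vector space X of integrable functions;
   functions that are not integrable are sent to 0. *)
Let inL f : X := if pselect (intg f) is left h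
  then Lfun_Sub (lexx 1%E) ((Lfun1_integrable m f).2 h) else 0.

Let inLE f : intg f -> (inL f : T -> R) = f.
Proof. by rewrite /inL; case: pselect => // h _; rewrite Lfun_valP. Qed.

Let intX (x : X) : intg (x : T -> R).
Proof. by apply/Lfun1_integrable; exact: LfunP. Qed.

Let DE (x y : X) : ((x + y : X) : T -> R) = fun t => x t + y t.
Proof. by []. Qed.

Let ZE c (x : X) : ((c *: x : X) : T -> R) = fun t => c * x t.
Proof. by []. Qed.

(** A functional dominated by the L1 norm on a subspace extends to all of L1 with
    the same bound, and the extension is an integral against a function with this
    bound. *)
Theorem bounded_functional_representation (V : set (T -> R)) (F : (T -> R) -> R)
    (C : R) : 0 <= C -> V (fun=> 0) ->
  (forall f, V f -> intg f) ->
  (forall f g, V f -> V g -> V (fun x => f x + g x)) ->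
  (forall c f, V f -> V (fun x => c * f x)) ->
  (forall f g, V f -> V g -> F (fun x => f x + g x) = F f + F g) ->
  (forall c f, V f -> F (fun x => c * f x) = c * F f) ->
  (forall f, V f -> (`|F f|%:E <= C%:E * \int[m]_x `|f x|%:E)%E) ->
  exists phi : T -> R, [/\ measurable_fun setT phi, forall x, `|phi x| <= C &
    forall f, V f -> (F f)%:E = (\int[m]_x (phi x * f x)%:E)%E].
Proof.
move=> C0 V0 Vi VD VZ FD FZ FC.
pose n1 (x : X) := fine (\int[m]_t `|x t|%:E)%E.
have n1E x : (n1 x)%:E = (\int[m]_t `|x t|%:E)%E.
  rewrite /n1 fineK//; have := integrable_fin_num measurableT (integrable_abse (intX x)).
  by [].
have n1D x y : n1 (x + y) <= n1 x + n1 y.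
  have mn (z : X) : measurable_fun setT (fun t => `|z t|%:E).
    by have := measurable_int _ (integrable_abse (intX z)).
  rewrite -lee_fin EFinD !n1E -ge0_integralD//.
  apply: ge0_le_integral => //.
  - exact: emeasurable_funD.
  - by move=> t _; rewrite -EFinD lee_fin DE ler_normD.
have n1Z c x : n1 (c *: x) = `|c| * n1 x.
  apply: EFin_inj; rewrite EFinM !n1E ZE -ge0_integralZl//.
    by apply: eq_integral => t _; rewrite normrM EFinM.
  by have := measurable_int _ (integrable_abse (intX x)).
have ps : sublinear (fun x : X => C * n1 x).
  split=> [x y|t x t0]; first by rewrite -mulrDr ler_wpM2l.
  by rewrite n1Z ger0_norm// mulrCA.
pose W : set X := [set x | V (x : T -> R)].
have [||||||g [gD gZ gp gW]] := @hahn_banach R X _ (fun x : X => F x) W ps.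
- exact: V0.
- by move=> x y; exact: VD.
- by move=> t x; exact: VZ.
- by move=> x y; exact: FD.
- by move=> t x; exact: FZ.
- move=> x Wx; apply: le_trans (ler_norm _) _; rewrite -lee_fin EFinM n1E.
  exact: FC.
have [||||phi [mphi phiC phiE]] := @L1_dual_representation _ _ _ m (fun f => g (inL f)) C.
- exact: C0.
- move=> f h fi hi; rewrite -gD; congr g; apply/LfuneqP => t.
  rewrite inLE ?DE ?inLE//.
  by have := integrableD measurableT fi hi; apply: eq_integrable.
- move=> c f fi; rewrite -gZ; congr g; apply/LfuneqP => t.
  rewrite inLE ?ZE ?inLE//.
  by have := integrableZl measurableT c fi; apply: eq_integrable.
- move=> f fi; have -> : (\int[m]_x `|f x|%:E)%E = (n1 (inL f))%:E by rewrite n1E inLE.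
  rewrite -EFinM lee_fin ler_norml gp andbT lerNl.
  rewrite -mulN1r -gZ (le_trans (gp _))// n1Z normrN1 mul1r//.
exists phi; split=> // f Vf; rewrite -phiE; last exact: Vi.
have ff := inLE (Vi _ Vf).
by rewrite gW /W/= ff.
Qed.

End extension.

(** * Duality *)

Section sigma_finite_product.
Context {R : realType} {N : nat}.
Local Notation mu := (@lebesgue_rV R N).

(** The product measure under a name of its own, which carries its structure of
    sigma-finite measure. *)
Definition lebesgue_square : set ('rV[R]_N * 'rV[R]_N) -> \bar R := (mu \x mu)%E.

HB.instance Definition _ := Measure.copy lebesgue_square (mu \x mu)%E.

Let lebesgue_square_sigma_finite : sigma_finite setT lebesgue_square.
Proof.
have /sigma_finiteP[F [TF ndF Foo]] := sigma_finiteT mu.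
exists (fun n => F n `*` F n).
  rewrite -setXTT; apply/seteqP; split=> // -[x y] _.
  have [[i _ Fx] [j _ Fy]] : (\bigcup_n F n) x /\ (\bigcup_n F n) y by rewrite -TF.
  exists (maxn i j) => //; split.
    by move: x Fx; exact/subsetPset/ndF/leq_maxl.
  by move: y Fy; exact/subsetPset/ndF/leq_maxr.
move=> k; have [mF fF] := Foo k; split; first exact: measurableX.
by rewrite /lebesgue_square product_measure1E// lte_mul_pinfty// ge0_fin_numE.
Qed.

HB.instance Definition _ := Measure_isSigmaFinite.Build _ _ _ lebesgue_square
  lebesgue_square_sigma_finite.

End sigma_finite_product.

Section duality.
Context {R : realType} {N : nat} (s : R).
Local Notation RN := 'rV[R]_N.
Local Notation mu := (@lebesgue_rV R N).
Local Notation mm := (mu \x mu)%E.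
Local Notation gagliardo := (@gagliardo R N s).
Hypotheses (N_gt0 : (0 < N)%N) (s_gt0 : 0 < s) (s_lt1 : s < 1).

Lemma smooth_Cn (u : RN -> R) n : smooth u -> Cn n u.
Proof.
elim: n u => [|n IH] u su; split=> //; try exact: smooth_continuous.
move=> i; split=> [x|]; first exact: smooth_derivable.
exact/IH/smooth_partial.
Qed.

Lemma Ccinfty_lincomb (Omega : set RN) c u v : Ccinfty Omega u -> Ccinfty Omega v ->
  Ccinfty Omega (fun x => c * u x + v x).
Proof.
move=> Cu Cv; have [su [M uM]] := Ccinfty_test Cu; have [sv [M' vM]] := Ccinfty_test Cv.
apply: test_Ccinfty.
  split.
    by apply: Cn_smooth => n; apply: CnD; [apply: CnM; [exact: Cn_cst|]|]; exact: smooth_Cn.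
  exists (Num.max M M') => x; rewrite gt_max => /andP[xM xM'].
  by rewrite uM// vM// mulr0 addr0.
have [_ _ uO] := Cu; have [_ _ vO] := Cv.
apply: (@subset_trans _ (closure [set x | u x != 0] `|` closure [set x | v x != 0])).
  rewrite -closureU; apply: closureS => x /=.
  have [->|] := eqVneq (u x) 0; last by left.
  by rewrite mulr0 add0r; right.
by move=> x [/uO|/vO].
Qed.

Lemma Ccinfty0 (Omega : set RN) : Ccinfty Omega (fun=> 0).
Proof.
apply: test_Ccinfty.
  by split; [apply: Cn_smooth => n; exact: Cn_cst|exists 0].
rewrite (_ : [set x | _] = set0) ?closure0//.
by apply/seteqP; split => // x /=; rewrite eqxx.
Qed.

Lemma gagliardo_normr_le (u : RN -> R) : measurable_fun setT u ->
  (gagliardo (fun x => `|u x|%R) <= gagliardo u)%E.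
Proof.
move=> mu_; have mn : measurable_fun setT (fun x => `|u x|) by exact: measurableT_comp.
rewrite -(gagliardo_product s mu_) -(gagliardo_product s mn).
have mR v : measurable_fun setT v ->
    measurable_fun setT (fun p : RN * RN => `|Rs s v p.1 p.2|%:E).
  move=> mv; apply/measurable_EFinP; apply: measurableT_comp => //.
  exact: measurable_Rs.
apply: ge0_le_integral => //; [exact: mR|exact: mR|].
move=> p _; rewrite lee_fin !RsE !normrM ler_wpM2r//.
exact: ler_dist_dist.
Qed.

Lemma Ccinfty_integrable (Omega : set RN) u : Ccinfty Omega u ->
  mu.-integrable setT (EFin \o u).
Proof.
move=> Cu; have tu := Ccinfty_test Cu.
have [B _ uB] := test_bounded tu; have [_ [M uM]] := tu.
exact: integrable_of_bounded_support (test_measurable tu) uB uM.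
Qed.

(** The Cheeger inequality applied to |u|, for the best constant. *)
Lemma fractional_poincare (Omega : set RN) : open Omega -> bounded_set Omega ->
  exists C : R, [/\ 0 <= C, C%:E = (cheeger s Omega)^-1%E &
    forall u, Ccinfty Omega u ->
      (\int[mu]_x `|u x|%:E <= C%:E * gagliardo u)%E].
Proof.
move=> oO bO; have mO := open_rV_measurable oO.
have [c c0 hc] := cheeger_pos N_gt0 s_gt0 bO.
have H h u : Ccinfty Omega u -> 0 <= h -> (h%:E <= cheeger s Omega)%E ->
    (h%:E * \int[mu]_x `|u x|%:E <= gagliardo u)%E.
  move=> Cu h0 hh; have mu_ := test_measurable (Ccinfty_test Cu).
  apply: le_trans (gagliardo_normr_le mu_).
  apply: (cheeger_mul_integral_le (bounded_rV_lty mO bO) mO) => //.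
    exact: measurableT_comp.
  by move=> x; rewrite normr_eq0; exact: Ccinfty_supp.
have fin u : Ccinfty Omega u -> exists2 I : R, 0 <= I & (\int[mu]_x `|u x|%:E = I%:E)%E.
  move=> /Ccinfty_integrable iu.
  have fI : (\int[mu]_x `|u x|%:E)%E \is a fin_num.
    by have := integrable_fin_num measurableT (integrable_abse iu).
  exists (fine (\int[mu]_x `|u x|%:E)%E); last by rewrite fineK.
  by apply: fine_ge0; apply: integral_ge0 => x _; rewrite lee_fin.
have fing u : Ccinfty Omega u -> exists2 G : R, 0 <= G & gagliardo u = G%:E.
  move=> /Ccinfty_test tu; have g1 := gagliardo_test_lty s_gt0 s_lt1 tu.
  have g0 : (0 <= gagliardo u)%E by exact: gagliardo_ge0.
  by exists (fine (gagliardo u)); [exact: fine_ge0|rewrite fineK// ge0_fin_numE].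
case E : (cheeger s Omega) hc H => [h| |] //; rewrite ?leeNy_eq// => hc H.
- have h0 : 0 < h by apply: lt_le_trans c0 _; rewrite -lee_fin.
  exists h^-1; split; rewrite ?invr_ge0 ?(ltW h0)//; first by rewrite inver gt_eqF.
  move=> u Cu; have := H h u Cu (ltW h0) (lexx _).
  have [I I0 ->] := fin u Cu; have [G G0 ->] := fing u Cu.
  by rewrite -!EFinM !lee_fin ler_pdivlMl.
(* Infinite Cheeger constant: the inequality holds with every real in its place,
   so the integral is 0. *)
- exists 0; split => //.
  move=> u Cu; rewrite mul0e; have := H _ u Cu _ (leey _).
  have [I I0 ->] := fin u Cu; have [G G0 ->] := fing u Cu => hI.
  rewrite lee_fin leNgt; apply/negP => Ip.
  have := hI ((G + 1) / I); rewrite divr_ge0 ?addr_ge0// => /(_ isT).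
  by rewrite -EFinM lee_fin divfK ?gt_eqF//; lra.
Qed.

(** On the image of the test functions under R_{s,1}, the functional
    R_{s,1} u |-> int u is well defined and dominated by 1 / h_s times the L1 norm,
    by the Poincare inequality. The density representing it is the minimizer. *)
Lemma exists_minimizer (Omega : set RN) : open Omega -> bounded_set Omega ->
  exists phi : RN * RN -> R, [/\ Linfty phi, Rs_adj_eq1 s Omega phi &
    (Linfty_norm phi <= (cheeger s Omega)^-1)%E].
Proof.
move=> oO bO; have mO := open_rV_measurable oO.
have [C [C0 <- HC]] := fractional_poincare oO bO.
pose Q (u : RN -> R) (p : RN * RN) := Rs s u p.1 p.2.
pose V := [set Q u | u in Ccinfty Omega].
pose I (u : RN -> R) := fine (\int[mu]_x (u x)%:E)%E.
(* The functional on the image, by choosing a preimage. *)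
pose F f := I (xget (fun=> 0) [set u | Ccinfty Omega u /\ Q u = f]).
have QZ c u : Q (fun x => c * u x) = (fun p => c * Q u p).
  by apply/funext => p; rewrite /Q /Rs; ring.
have QD u v : Q (fun x => u x + v x) = (fun p => Q u p + Q v p).
  by apply/funext => p; rewrite /Q /Rs; ring.
have CZ c u : Ccinfty Omega u -> Ccinfty Omega (fun x => c * u x).
  move=> Cu; have := Ccinfty_lincomb c Cu (Ccinfty0 Omega).
  by under eq_fun do rewrite addr0.
have CD u v : Ccinfty Omega u -> Ccinfty Omega v -> Ccinfty Omega (fun x => u x + v x).
  by move=> Cu Cv; have := Ccinfty_lincomb 1 Cu Cv; under eq_fun do rewrite mul1r.
have IE u : Ccinfty Omega u -> ((I u)%:E = \int[mu]_x (u x)%:E)%E.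
  by move=> /Ccinfty_integrable iu; rewrite /I fineK//; exact: integrable_fin_num iu.
have IZ c u : Ccinfty Omega u -> I (fun x => c * u x) = c * I u.
  move=> Cu; apply: EFin_inj; rewrite EFinM !IE//; last exact: CZ.
  under eq_integral do rewrite EFinM.
  by rewrite integralZl//; exact: Ccinfty_integrable Cu.
have ID u v : Ccinfty Omega u -> Ccinfty Omega v ->
    I (fun x => u x + v x) = I u + I v.
  move=> Cu Cv; apply: EFin_inj; rewrite EFinD !IE//; last exact: CD.
  under eq_integral do rewrite EFinD.
  by rewrite integralD//; [exact: Ccinfty_integrable Cu|exact: Ccinfty_integrable Cv].
have gC u : Ccinfty Omega u -> (\int[mm]_p `|Q u p|%:E = gagliardo u)%E.
  by move=> /Ccinfty_test/test_measurable; exact: gagliardo_product.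
have bC u : Ccinfty Omega u -> (`|I u|%:E <= C%:E * \int[mm]_p `|Q u p|%:E)%E.
  move=> Cu; rewrite gC//; apply: le_trans (HC u Cu).
  rewrite -abse_EFin IE//.
  exact: le_abse_integral (measurable_int _ (Ccinfty_integrable Cu)).
clearbody I.
have FE u : Ccinfty Omega u -> F (Q u) = I u.
  move=> Cu; rewrite /F; set v := xget _ _.
  have [Cv Qv] : Ccinfty Omega v /\ Q v = Q u.
    by rewrite /v; apply: (@xgetPex _ (fun=> 0) [set v | Ccinfty Omega v /\ Q v = Q u]); exists u.
  have CN := CZ (-1) _ Cv; have := bC _ (CD _ _ Cu CN).
  rewrite QD QZ Qv (_ : integral _ _ _ = 0)%E; last first.
    by under eq_integral do rewrite mulN1r subrr normr0; rewrite integral0.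
  rewrite mule0 lee_fin normr_le0 ID// IZ// mulN1r subr_eq0.
  by move=> /eqP ->.
clearbody F.
have [|||||||phi [mphi phiC phiE]] := @bounded_functional_representation _ _ _
  (@lebesgue_square R N) V F C C0.
- exists (fun=> 0); first exact: Ccinfty0.
  by apply/funext => p; rewrite /Q /Rs subrr mul0r.
- move=> _ [u Cu <-]; have mR := measurable_Rs s (test_measurable (Ccinfty_test Cu)).
  apply/integrableP; split; first exact/measurable_EFinP.
  have -> : (\int[mm]_x `|(EFin \o Q u) x| = gagliardo u)%E by rewrite -gC.
  have tu := Ccinfty_test Cu; have Hg := gagliardo_test_lty s_gt0 s_lt1 tu; exact Hg.
- by move=> _ _ [u Cu <-] [v Cv <-]; rewrite -QD; exists (fun x => u x + v x) => //; exact: CD.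
- by move=> c _ [u Cu <-]; rewrite -QZ; exists (fun x => c * u x) => //; exact: CZ.
- by move=> _ _ [u Cu <-] [v Cv <-]; rewrite -QD !FE ?ID//; exact: CD.
- by move=> c _ [u Cu <-]; rewrite -QZ !FE ?IZ//; exact: CZ.
- by move=> _ [u Cu <-]; rewrite FE//; exact: bC.
have phib : {ae mm, forall p, `|phi p| <= C} by exact: aeW.
have nphi : (Linfty_norm phi <= C%:E)%E.
  rewrite /Linfty_norm unlock; case: ifPn => [_|_]; last by rewrite lee_fin.
  by apply/ess_supP; apply: filterS phib => p; rewrite /= lee_fin.
exists phi; split=> //.
- rewrite /Linfty/= inE; apply/andP; split; rewrite inE//=.
  exact: le_lt_trans nphi (ltry _).
- move=> u Cu; have tu := Ccinfty_test Cu.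
  have [_ [-> _]] := pairing_product C0 mphi phib (test_measurable tu)
    (gagliardo_test_lty s_gt0 s_lt1 tu).
  rewrite integral_supp//; [|exact: test_measurable|by move=> x; exact: Ccinfty_supp].
  by rewrite -IE// -FE// phiE//; exists u.
Qed.

(** The bound |E| <= |phi|_oo P_s(E) holds for all competitors E of the Cheeger
    problem. The case |phi|_oo = 0 forces all perimeters, hence the Cheeger
    constant, to be infinite. *)
Lemma inv_cheeger_le_Linfty_norm (Omega : set RN) (phi : RN * RN -> R) :
  open Omega -> bounded_set Omega -> lipschitz_set Omega ->
  Linfty phi -> Rs_adj_eq1 s Omega phi ->
  ((cheeger s Omega)^-1 <= Linfty_norm phi)%E.
Proof.
move=> oO bO lO phiL phi1; have mO := open_rV_measurable oO.
have key := measure_le_perimeter N_gt0 s_gt0 s_lt1 oO bO lO phiL phi1.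
have [l [nl l0 _ _]] := Linfty_bound phiL; rewrite nl in key *.
have lower t : 0 <= t -> t * l <= 1 -> (t%:E <= cheeger s Omega)%E.
  move=> t0 tl; apply: le_ereal_inf_tmp => _ [E [mE EO E0] <-].
  have fE : (mu E < +oo)%E.
    by apply: le_lt_trans (bounded_rV_lty mO bO); apply: le_measure; rewrite ?inE.
  have [r r0 rE] : exists2 r : R, 0 < r & mu E = r%:E.
    by exists (fine (mu E)); rewrite ?fineK ?fine_gt0 ?E0// ge0_fin_numE.
  rewrite rE inver gt_eqF//.
  have P0 : (0 <= perimeter s E)%E by rewrite perimeterE; exact: gagliardo_ge0.
  have [->|Pfin] := eqVneq (perimeter s E) +oo%E.
    by rewrite gt0_mulye ?leey// lte_fin invr_gt0.
  have {}Pfin : (perimeter s E < +oo)%E by rewrite ltey.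
  have := key E mE EO Pfin; rewrite rE.
  have [q qE] : exists q : R, perimeter s E = q%:E.
    by exists (fine (perimeter s E)); rewrite fineK// ge0_fin_numE.
  move: P0; rewrite qE -!EFinM !lee_fin => q0 rq; rewrite ler_pdivlMr//.
  apply: le_trans (ler_wpM2l t0 rq) _.
  by rewrite mulrA ler_piMl.
have [l_eq0|lN0] := eqVneq l 0.
  have -> : cheeger s Omega = +oo%E.
    apply/eqyP => t /ltW t0; apply: lower => //.
    by rewrite l_eq0 mulr0.
  by rewrite invey lee_fin.
have lp : 0 < l by rewrite lt_neqAle eq_sym lN0.
have := lower l^-1; rewrite invr_ge0 mulVf// lexx => /(_ l0 isT).
case: (cheeger s Omega) => [h| |]; rewrite ?leeNy_eq// lee_fin => hl.
  have h0 : 0 < h by apply: lt_le_trans hl; rewrite invr_gt0.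
  by rewrite inver gt_eqF// lee_fin -[leRHS]invrK lef_pV2 ?posrE// invr_gt0.
Qed.

End duality.

Theorem theorem8p6 (R : realType) (N : nat) (s : R) (Omega : set 'rV[R]_N)
    (N_gt0 : (0 < N)%N) (s_gt0 : 0 < s) (s_lt1 : s < 1)
    (Omega_open : open Omega) (Omega_bounded : bounded_set Omega)
    (Omega_lipschitz : lipschitz_set Omega) :
  is_min [set Linfty_norm phi | phi in
            [set phi | Linfty phi /\ Rs_adj_eq1 s Omega phi]]
         ((cheeger s Omega)^-1)%E.
Proof.
have lb phi : Linfty phi -> Rs_adj_eq1 s Omega phi ->
    ((cheeger s Omega)^-1 <= Linfty_norm phi)%E by exact: inv_cheeger_le_Linfty_norm.
split; last by move=> _ [phi [phiL phi1] <-]; exact: lb.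
have [phi [phiL phi1 phile]] := exists_minimizer N_gt0 s_gt0 s_lt1 Omega_open Omega_bounded.
by exists phi => //; apply: le_anti; rewrite phile lb.
Qed.
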